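(* Let $\mathcal{H},\mathcal{K}$ be real Hilbert spaces, let $\mathbb{R}[\underline{x}]=\mathbb{R}[x_1,\ldots,x_d]$, let $L\colon\mathbb{R}[\underline{x}]\otimes B(\mathcal{H})_h\to B(\mathcal{K})_h$ be a linear operator, let $M\subseteq\mathbb{R}[\underline{x}]$ be an archimedean quadratic module, and let $K_M:=\{a\in\mathbb{R}^d\mid p(a)\ge 0\text{ for all }p\in M\}$. Then the following statements are equivalent: (1) There exists a unique non-negative operator-valued measure $m\colon\operatorname{Bor}(K_M)\to\mathcal{L}(B(\mathcal{H})_h,B(\mathcal{K})_h)$ such that $L(F)=\int_{K_M}F\,dm$ holds for all $F\in\mathbb{R}[\underline{x}]\otimes B(\mathcal{H})_h$. (2) $L(qA^{T}A)\succeq 0$ for every $q\in M$ and every $A\in\mathbb{R}[\underline{x}]\otimes B(\mathcal{H})$.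
   Context: All Hilbert spaces are real. For a Hilbert space $\mathcal{H}$, $B(\mathcal{H})$ is the algebra of bounded linear operators on $\mathcal{H}$, $B(\mathcal{H})_h$ is the real Banach space of self-adjoint ones, and $B(\mathcal{H})_+$ is the set of positive semidefinite ones (written $A\succeq 0$). $\mathcal{L}(B(\mathcal{H})_h,B(\mathcal{K})_h)$ is the Banach space of bounded linear operators from $B(\mathcal{H})_h$ to $B(\mathcal{K})_h$. $\operatorname{Bor}(X)$ is the Borel $\sigma$-algebra of $X$. Elements of $\mathbb{R}[\underline{x}]\otimes B(\mathcal{H})$ are polynomials with coefficients in $B(\mathcal{H})$; for such $A$, $A^T$ is the polynomial obtained by replacing each coefficient by its adjoint. A quadratic module in $\mathbb{R}[\underline{x}]$ is a subset $M$ with $1\in M$, $M+M\subseteq M$ and $p^2M\subseteq M$ for every $p\in\mathbb{R}[\underline{x}]$. It is archimedean if for every $p\in\mathbb{R}[\underline{x}]$ there is $n\in\mathbb{N}$ with $n+p\in M$ and $n-p\in M$. Let $\mathcal{P}$ be a $\sigma$-algebra of subsets of a set $X$. A positive operator-valued measure is a set function $E\colon\mathcal{P}\to B(\mathcal{K})_h$ such that: (a) $E(\Delta)\succeq 0$ for all $\Delta\in\mathcal{P}$; (b) $E(\Delta_1\cup\Delta_2)=E(\Delta_1)+E(\Delta_2)$ for disjoint $\Delta_1,\Delta_2\in\mathcal{P}$; (c) if $\Delta_i$ is an increasing sequence in $\mathcal{P}$ with union $\Delta\in\mathcal{P}$, then $E(\Delta)=\sup_i E(\Delta_i)$. A non-negative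 operator-valued measure is a set function $m\colon\mathcal{P}\to\mathcal{L}(B(\mathcal{H})_h,B(\mathcal{K})_h)$ such that for every $A\in B(\mathcal{H})_+$ the set function $m_A\colon\mathcal{P}\to B(\mathcal{K})_h$, $m_A(\Delta)=m(\Delta)(A)$, is a positive operator-valued measure. Integration. For a positive operator-valued measure $E$ and $x\in\mathcal{K}$ let $E_x(\Delta)=\langle E(\Delta)x,x\rangle$. A measurable $f\colon X\to\mathbb{R}$ is $E$-integrable if there is a constant $K_f$ with $\int|f|\,dE_x\le K_f\|x\|^2$ for all $x\in\mathcal{K}$; then $\int f\,dE\in B(\mathcal{K})_h$ is the unique operator with $\langle(\int f\,dE)x,x\rangle=\int f\,dE_x$ for all $x\in\mathcal{K}$. Let $\mathcal{I}$ be the space of measurable real functions on $X$ that are $m_A$-integrable for every $A\in B(\mathcal{H})_+$ (it contains all bounded measurable functions). For $f\in\mathcal{I}$ and $A\in B(\mathcal{H})_h$ put $\int f\,dm_A=\int f\,dm_{A_+}-\int f\,dm_{A_-}$, where $A_+,A_-\in B(\mathcal{H})_+$ are the positive and negative parts of $A$ ($A=A_+-A_-$, $A_+A_-=A_-A_+=0$). For $F=\sum_i f_i\otimes A_i\in\mathcal{I}\otimes B(\mathcal{H})_h$ (algebraic tensor product) put $\int F\,dm=\sum_i\int f_i\,dm_{A_i}$. For $F\in\mathbb{R}[\underline{x}]\otimes B(\mathcal{H})_h$, in $\int_{K_M}F\,dm$ the polynomials are regarded as functions on $K_M$. *)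

(* Defs.v *)
From HB Require Import structures.
From mathcomp Require Import all_boot all_order all_algebra.
From mathcomp Require Import all_classical all_reals all_analysis.
From mathcomp Require Import -(notations) mpoly.

Set Implicit Arguments.
Unset Strict Implicit.
Unset Printing Implicit Defensive.

Import Order.TTheory GRing.Theory Num.Theory.
Import numFieldNormedType.Exports.

Local Open Scope classical_set_scope.
Local Open Scope ring_scope.

HB.mixin Record CompleteNormedModule_isHilbert (R : realType) H
    & CompleteNormedModule R H := {
  inner : H -> H -> R;
  innerC : forall x y, inner x y = inner y x;
  innerDl : forall x y z, inner (x + y) z = inner x z + inner y z;
  innerZl : forall (a : R) x z, inner (a *: x) z = a * inner x z;
  inner_norm : forall x, inner x x = `|x| ^+ 2
}.

#[short(type="hilbertType")]
HB.structure Definition Hilbert (R : realType) :=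
  { H of CompleteNormedModule R H & CompleteNormedModule_isHilbert R H }.

Notation "''<' x , y >" := (inner x y)
  (at level 0, x, y at level 69, format "''<' x ,  y >") : ring_scope.

Section BoundedOperators.
Context (R : realType) (V W : normedModType R).

Definition bounded_linear : {pred V -> W} :=
  [pred f | `[< linear f /\ exists C : R, forall x, `|f x| <= C * `|x| >]].

Lemma bounded_linear_submod : submod_closed bounded_linear.
Proof.
split.
  apply/asboolP; split; first by move=> a x y; rewrite /= [RHS]addr0 [RHS]scaler0.
  by exists 0 => x; rewrite normr0 mul0r.
move=> a f g /asboolP[lf [C fC]] /asboolP[lg [D gD]].
apply/asboolP; split.
  move=> b x y; rewrite !fctE lf lg !scalerDr !scalerA (mulrC a b).
  by rewrite addrACA.
exists (`|a| * C + D) => x; rewrite fctE.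
rewrite (le_trans (ler_normD _ _))// normrZ mulrDl -mulrA lerD//.
by rewrite ler_wpM2l.
Qed.

HB.instance Definition _ :=
  GRing.isSubmodClosed.Build R (V -> W) bounded_linear bounded_linear_submod.

Record bop : predArgType :=
  Bop { bop_fun :> V -> W; _ : bop_fun \in bounded_linear }.

HB.instance Definition _ := [isSub for bop_fun].
HB.instance Definition _ := [Choice of bop by <:].
HB.instance Definition _ := [SubChoice_isSubLmodule of bop by <:].

Lemma bop_linear (f : bop) : linear f.
Proof. by case: f => f /= /asboolP[]. Qed.

HB.instance Definition _ (f : bop) :=
  GRing.isLinear.Build R V W *:%R f (bop_linear f).

Lemma bop_bounded (f : bop) : exists C : R, forall x, `|f x| <= C * `|x|.
Proof. by case: f => f /= /asboolP[]. Qed.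

Lemma bopP (f g : bop) : f =1 g -> f = g.
Proof. by move=> /funext fg; apply: val_inj. Qed.

Definition opnorm (f : bop) : R := sup [set `|f x| | x in [set x | `|x| <= 1]].

Lemma opnorm_has_sup (f : bop) :
  has_sup [set `|f x| | x in [set x | `|x| <= 1]].
Proof.
split; first by exists `|f 0|, 0 => //=; rewrite normr0.
have [C fC] := bop_bounded f; exists `|C| => _ [x /= x1 <-].
rewrite (le_trans (fC x))// (le_trans (ler_norm _))// normrM normr_id.
by rewrite ler_piMr.
Qed.

Lemma opnorm_ub (f : bop) x : `|f x| <= opnorm f * `|x|.
Proof.
have [->|x0] := eqVneq x 0; first by rewrite linear0 !normr0 mulr0.
have nx : 0 < `|x| by rewrite normr_gt0.
rewrite -ler_pdivrMr//.
have -> : `|f x| / `|x| = `|f (`|x|^-1 *: x)|.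
  by rewrite linearZ normrZ normfV normr_id mulrC.
apply: ub_le_sup; first exact: (opnorm_has_sup f).2.
exists (`|x|^-1 *: x) => //=.
by rewrite normrZ normfV normr_id mulVf ?gt_eqF.
Qed.

Lemma opnorm_le (f : bop) C : (forall x, `|x| <= 1 -> `|f x| <= C) ->
  opnorm f <= C.
Proof.
move=> fC; apply: sup_le_ub; first exact: (opnorm_has_sup f).1.
by move=> _ [x /= x1 <-]; exact: fC.
Qed.

Lemma opnorm_ge0 (f : bop) : 0 <= opnorm f.
Proof.
apply: le_trans (_ : `|f 0| <= _) => //; apply: ub_le_sup.
  exact: (opnorm_has_sup f).2.
by exists 0 => //=; rewrite normr0.
Qed.

Lemma opnormD (f g : bop) : opnorm (f + g) <= opnorm f + opnorm g.
Proof.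
apply: opnorm_le => x x1; rewrite (le_trans (ler_normD _ _))// lerD//.
  by rewrite (le_trans (opnorm_ub f x))// ler_piMr// opnorm_ge0.
by rewrite (le_trans (opnorm_ub g x))// ler_piMr// opnorm_ge0.
Qed.

Lemma opnormZ_le (a : R) (f : bop) : opnorm (a *: f) <= `|a| * opnorm f.
Proof.
apply: opnorm_le => x x1; rewrite [X in `|X|](_ : _ = a *: f x)// normrZ.
rewrite ler_wpM2l// (le_trans (opnorm_ub f x))// ler_piMr// opnorm_ge0//.
Qed.

Lemma opnormZ (a : R) (f : bop) : opnorm (a *: f) = `|a| * opnorm f.
Proof.
apply/eqP; rewrite eq_le opnormZ_le /=.
have [->|a0] := eqVneq a 0; first by rewrite normr0 mul0r opnorm_ge0.
have := opnormZ_le a^-1 (a *: f).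
rewrite scalerA mulVf// scale1r normfV mulrC.
by rewrite ler_pdivlMr ?normr_gt0// mulrC.
Qed.

Lemma opnorm0_eq0 (f : bop) : opnorm f = 0 -> f = 0.
Proof.
move=> f0; apply: bopP => x; apply/eqP; rewrite -normr_le0.
by have := opnorm_ub f x; rewrite f0 mul0r.
Qed.

End BoundedOperators.

Section SelfAdjointOperators.
Context (R : realType) (H : hilbertType R).

Definition selfadjoint : {pred bop H H} :=
  [pred A : bop H H | `[< forall x y, '< A x, y > = '< x, A y > >]].

Lemma selfadjoint_submod : submod_closed selfadjoint.
Proof.
split.
  apply/asboolP => x y; rewrite [LHS](_ : _ = '< 0, y >)//.
  by rewrite [RHS]innerC [RHS](_ : _ = '< 0, x >)// -(scale0r 0) !innerZl !mul0r.
move=> a A B /asboolP sA /asboolP sB; apply/asboolP => x y.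
rewrite [LHS](_ : _ = '< a *: A x + B x, y >)//.
rewrite [RHS](_ : _ = '< x, a *: A y + B y >)// (innerC x) !innerDl !innerZl sA sB.
by rewrite (innerC x) (innerC x).
Qed.

HB.instance Definition _ :=
  GRing.isSubmodClosed.Build R (bop H H) selfadjoint selfadjoint_submod.

Record sa : predArgType := Sa { sa_op :> bop H H; _ : sa_op \in selfadjoint }.

HB.instance Definition _ := [isSub for sa_op].
HB.instance Definition _ := [Choice of sa by <:].
HB.instance Definition _ := [SubChoice_isSubLmodule of sa by <:].

Definition sa_norm (A : sa) : R := opnorm A.

Lemma sa_normD (A B : sa) : sa_norm (A + B) <= sa_norm A + sa_norm B.
Proof. exact: opnormD. Qed.

Lemma sa_normZ (a : R) (A : sa) : sa_norm (a *: A) = `|a| * sa_norm A.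
Proof. exact: opnormZ. Qed.

Lemma sa_norm0_eq0 (A : sa) : sa_norm A = 0 -> A = 0.
Proof. by move=> /opnorm0_eq0 A0; apply: val_inj. Qed.

HB.instance Definition _ :=
  Lmodule_isNormed.Build R sa sa_normD sa_normZ sa_norm0_eq0.

End SelfAdjointOperators.

Section OperatorAlgebra.
Context (R : realType) (H : hilbertType R).

Lemma bcomp_subproof (S T : bop H H) : S \o T \in @bounded_linear R H H.
Proof.
apply/asboolP; split; first by move=> a x y /=; rewrite !linearP.
exists (opnorm S * opnorm T) => x /=.
rewrite (le_trans (opnorm_ub S _))// -mulrA ler_wpM2l ?opnorm_ge0//.
exact: opnorm_ub.
Qed.

Definition bcomp (S T : bop H H) : bop H H := Bop (bcomp_subproof S T).

(* The set is a singleton, by the Riesz representation theorem. *)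
Definition adj (T : bop H H) : bop H H :=
  xget 0 [set S : bop H H | forall x y, '< T x, y > = '< x, S y > ].

Definition psd (A : sa H) : Prop := forall x, 0 <= '< A x, x >.

Definition is_parts (A : sa H) (PN : sa H * sa H) : Prop :=
  [/\ psd PN.1, psd PN.2, A = PN.1 - PN.2,
      bcomp PN.1 PN.2 = 0 & bcomp PN.2 PN.1 = 0].

(* The positive and negative parts exist and are unique, so that [xget] only
   names them. *)
Definition parts (A : sa H) : sa H * sa H := xget (0, 0) (is_parts A).
Definition pos_part (A : sa H) : sa H := (parts A).1.
Definition neg_part (A : sa H) : sa H := (parts A).2.

(* Least upper bound in the Loewner order, where [B - A] psd means A <= B. *)
Definition loewner_sup (A_ : nat -> sa H) (A : sa H) : Prop :=
  (forall i, psd (A - A_ i)) /\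
  (forall B, (forall i, psd (B - A_ i)) -> psd (B - A)).

End OperatorAlgebra.

(** The algebraic tensor product of the polynomial ring in [d] variables and a
    vector space [V], as the finitely supported families of coefficients in [V]
    indexed by the monomials. *)

Section VectorPolynomials.
Context (R : realType) (d : nat) (V : lmodType R).

Definition finsupp : {pred multinom d -> V} :=
  [pred F : multinom d -> V | `[< finite_set [set a | F a != 0] >]].

Lemma finsupp_submod : submod_closed finsupp.
Proof.
split.
  by apply/asboolP; apply: sub_finite_set (finite_set0 _) => a /= /eqP; apply.
move=> c F G /asboolP fF /asboolP fG; apply/asboolP.
apply: sub_finite_set (_ : _ `<=` [set a | F a != 0] `|` [set a | G a != 0]) _.
  move=> a /=; have [Fa|] := eqVneq (F a) 0; last by left.
  by rewrite !fctE Fa scaler0 add0r; right.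
by rewrite finite_setU.
Qed.

HB.instance Definition _ :=
  GRing.isSubmodClosed.Build R (multinom d -> V) finsupp finsupp_submod.

Record vpoly : predArgType :=
  VPoly { vcoef :> multinom d -> V; _ : vcoef \in finsupp }.

HB.instance Definition _ := [isSub for vcoef].
HB.instance Definition _ := [Choice of vpoly by <:].
HB.instance Definition _ := [SubChoice_isSubLmodule of vpoly by <:].

Definition vsupp (F : vpoly) : set (multinom d) := [set a | F a != 0].

Lemma vmono_subproof (a : multinom d) (v : V) :
  (fun b => if b == a then v else 0) \in finsupp.
Proof.
apply/asboolP; apply: sub_finite_set (finite_set1 a) => b /=.
by have [->//|_] := eqVneq b a; rewrite eqxx.
Qed.

(* The pure tensor of the monomial with exponents [a] and the vector [v]. *)
Definition vmono a v : vpoly := VPoly (vmono_subproof a v).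

(* The product of a scalar polynomial with a [V]-valued one. *)
Definition pscale (q : mpoly d R) (F : vpoly) : vpoly :=
  \sum_(a <- msupp q) \sum_(b \in vsupp F)
     vmono (mnm_add a b) (mcoeff a q *: F b).

End VectorPolynomials.

(* Applies [f] to each coefficient; meant for [f 0 = 0]. *)
Definition vmap (R : realType) d (V W : lmodType R) (f : V -> W)
    (F : vpoly d V) : vpoly d W :=
  \sum_(a \in vsupp F) vmono a (f (F a)).

Section OperatorPolynomials.
Context (R : realType) (d : nat) (H : hilbertType R).

Definition opmul (F G : vpoly d (bop H H)) : vpoly d (bop H H) :=
  \sum_(a \in vsupp F) \sum_(b \in vsupp G)
     vmono (mnm_add a b) (bcomp (F a) (G b)).

(* The transpose: every coefficient is replaced by its adjoint. *)
Definition optr (F : vpoly d (bop H H)) : vpoly d (bop H H) := vmap (@adj R H) F.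

(* The inclusion of the polynomials with self-adjoint coefficients. It is
   injective, and every product [pscale q (opmul (optr A) A)] is in its image. *)
Definition of_sa (F : vpoly d (sa H)) : vpoly d (bop H H) := vmap (@sa_op R H) F.

End OperatorPolynomials.

Section QuadraticModules.
Context (R : realType) (d : nat).

Definition quadratic_module (M : set (mpoly d R)) : Prop :=
  [/\ M 1, forall p q, M p -> M q -> M (p + q)
    & forall p q, M q -> M (p ^+ 2 * q)].

Definition archimedean (M : set (mpoly d R)) : Prop :=
  forall p, exists n : nat, M (n%:R + p) /\ M (n%:R - p).

(* The points of R^d, with the Borel sigma-algebra. *)
Definition borel_space := g_sigma_algebraType (@open 'rV[R]_d).

Definition peval (p : mpoly d R) (a : borel_space) : R :=
  meval ((a : 'rV[R]_d) 0) p.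

Definition nonneg_set (M : set (mpoly d R)) : set borel_space :=
  [set a | forall p, M p -> 0 <= peval p a].

End QuadraticModules.

Section OperatorMeasures.
Context (R : realType) (H K : hilbertType R) (T : Type) (P : set (set T)).

(* The values outside the sigma-algebra [P] are irrelevant. *)
Definition povm (E : set T -> sa K) : Prop :=
  [/\ forall D, P D -> psd (E D),
      forall D1 D2, P D1 -> P D2 -> D1 `&` D2 = set0 ->
        E (D1 `|` D2) = E D1 + E D2
    & forall D : nat -> set T, (forall i, P (D i)) ->
        (forall i, D i `<=` D i.+1) -> P (\bigcup_i D i) ->
        loewner_sup (E \o D) (E (\bigcup_i D i))].

Definition novm (m : set T -> bop (sa H) (sa K)) : Prop :=
  forall A, psd A -> povm (fun D => m D A).

End OperatorMeasures.

(** Integration over a subset [X] of a measurable space [T] against measures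
    defined on the trace sigma-algebra of [X]. A function on [X] is represented
    by a function on [T], whose values outside [X] are irrelevant. *)

Section Integration.
Context (R : realType) (H K : hilbertType R).
Context (disp : measure_display) (T : measurableType disp) (X : set T).

Definition trace_sigma : set (set T) := strace measurable X.

(* The measure <E(.) x, x> on [X], pushed forward to [T] by the inclusion. *)
Definition quad_measure (E : set T -> sa K) (x : K) (B : set T) : \bar R :=
  ('< E (B `&` X) x, x >)%:E.

Definition op_integrable (E : set T -> sa K) (f : T -> R) : Prop :=
  measurable_fun X f /\
  exists C : R, forall x : K,
    (\int[quad_measure E x]_(t in X) `|f t|%:E <= (C * `|x| ^+ 2)%:E)%E.

(* Meaningful for integrable [f], for which the set is a singleton. *)
Definition op_integral (E : set T -> sa K) (f : T -> R) : sa K :=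
  xget 0 [set S : sa K | forall x : K,
    ('< S x, x >)%:E = (\int[quad_measure E x]_(t in X) (f t)%:E)%E].

Variable m : set T -> bop (sa H) (sa K).

Definition ovm_integrable (f : T -> R) : Prop :=
  forall A, psd A -> op_integrable (fun D => m D A) f.

Definition ovm_integral (f : T -> R) (A : sa H) : sa K :=
  op_integral (fun D => m D (pos_part A)) f
  - op_integral (fun D => m D (neg_part A)) f.

End Integration.

Section PolynomialIntegration.
Context (R : realType) (d : nat) (H K : hilbertType R).
Variables (X : set (borel_space R d)).
Variable m : set (borel_space R d) -> bop (sa H) (sa K).

Definition monomial (a : multinom d) : borel_space R d -> R :=
  peval (mpolyX R a).

Definition poly_integrable (F : vpoly d (sa H)) : Prop :=
  forall a, vsupp F a -> ovm_integrable X m (monomial a).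

Definition poly_integral (F : vpoly d (sa H)) : sa K :=
  \sum_(a \in vsupp F) ovm_integral X m (monomial a) (F a).

(* [poly_integrable F] says that [F] is in the domain of the integral. *)
Definition represents (L : vpoly d (sa H) -> sa K) : Prop :=
  novm (trace_sigma X) m /\
  forall F, poly_integrable F /\ L F = poly_integral F.

End PolynomialIntegration.

(* Main.v *)
Require Import Defs.
From HB Require Import structures.
From mathcomp Require Import all_boot all_order all_algebra.
From mathcomp Require Import all_classical all_reals all_analysis.
From mathcomp Require Import -(notations) mpoly.
From mathcomp Require Import measurable_realfun ring lra.
Import Order.TTheory GRing.Theory Num.Theory.
Import numFieldNormedType.Exports.
Local Open Scope classical_set_scope.
Local Open Scope ring_scope.

Set Implicit Arguments.
Unset Strict Implicit.
Unset Printing Implicit Defensive.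

(** From the measure to positivity, the value of [q A^T A] at a point of the
    nonnegativity set is a positive operator, and the integral of a polynomial
    with positive values is approximated by the sums of [m (D_j) (F (t_j))] over
    fine partitions into measurable cells [D_j] with sample points [t_j]
    ([poly_integral_psd]).

    Conversely, let [L] be positive on all [q A^T A]. For a positive operator
    [A], written as a square, and a vector [x], the functional
    [p |-> <L (p (x) A) x, x>] on scalar polynomials is nonnegative on [M].
    By the archimedean Positivstellensatz
    ([archimedean_positivstellensatz]), it is nonnegative on every polynomial
    that is nonnegative on the compact nonnegativity set: an archimedean
    quadratic module that is maximal among the proper ones orders the polynomial
    ring, and the cut of the constants is multiplicative, hence a point.

    Such a functional is given by exactly one measure. It extends to the uniform
    limits of polynomials, an algebra closed under maxima and minima. The cheapest
    increasing sequence of such functions that reaches [1] on a set defines an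
    outer measure; Dini's argument bounds it from below, products with ramps show
    that superlevel sets are measurable in the sense of Caratheodory
    ([superlevel_caratheodory]), and slicing a function at small heights
    identifies its integral ([extend_integral]). Any measure with the same moments
    is at most the outer measure on each set and on its complement, hence equal
    to it ([moment_measure_unique]).

    By uniqueness, the scalar measure is additive in the functional. For a fixed
    set it therefore satisfies the parallelogram law in [x], and by the
    Jordan-von Neumann argument ([quadratic_form_operator]) it is the quadratic
    form of an operator, which is additive in [A] and extends linearly to all
    self-adjoint operators ([mo_operator]). Countable additivity in the Loewner
    order is the pointwise one, because the least upper bound of an increasing
    sequence is its pointwise limit ([loewner_sup_cvg]).

    The operator theory needed is elementary: bounded functionals are represented
    by vectors ([riesz_representation]), and square roots and positive and
    negative parts come from the iteration [Y := ((1 - G) + Y^2) / 2], which is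
    also used on polynomials to approximate absolute values. *)

(** * Bounded forms on a real Hilbert space *)

(** Squares of increments are what the parallelogram law provides. *)
Lemma cvgn_sqr_bound (R : realType) (V : completeNormedModType R)
    (u : nat -> V) (b : nat -> R) :
  b @ \oo --> 0 -> (forall n m, `|u n - u m| ^+ 2 <= b n + b m) -> cvgn u.
Proof.
move=> b0 ub; apply/cauchy_cvgP/cauchy_ballP => e e0; rewrite near_map2.
have be : \forall n \near \oo, b n < e ^+ 2 / 2.
  by apply: (cvgr_lt 0 b0); rewrite divr_gt0// exprn_gt0.
near=> n m => /=; rewrite -ball_normE /= -(@ltr_pXn2r _ 2)// ?nnegrE// ?(ltW e0)//.
apply: le_lt_trans (ub _ _) _; rewrite [ltRHS]splitr.
by apply: ltrD; [near: n|near: m].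
Unshelve. all: by end_near. Qed.

(** An additive function that is bounded on multiples in [0, 1] of a vector is
    homogeneous: the defect [g (c x) - c g x] is multiplied by [n] when [c] is,
    while it only depends on the fractional part of [c]. *)
Lemma additive_bounded_homogeneous (R : realType) (V : lmodType R)
    (g : V -> R) (C : V -> R) :
  (forall x y, g (x + y) = g x + g y) ->
  (forall x (c : R), 0 <= c <= 1 -> `|g (c *: x)| <= C x) ->
  forall c x, g (c *: x) = c * g x.
Proof.
move=> gD gC c x.
have g0 : g 0 = 0 by have := gD 0 0; rewrite addr0; lra.
have gN y : g (- y) = - g y by have := gD y (- y); rewrite subrr g0; lra.
have gn (n : nat) y : g (n%:R *: y) = n%:R * g y.
  elim: n => [|n IH]; first by rewrite scale0r mul0r.
  by rewrite -natr1 scalerDl scale1r gD IH mulrDl mul1r.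
have gz (k : int) y : g (k%:~R *: y) = k%:~R * g y.
  by case: k => n; rewrite ?NegzE ?mulrNz -?pmulrn ?scaleNr ?gN gn ?mulNr.
apply/eqP; rewrite -subr_eq0; apply/negPn/negP => d0.
pose D := C x + `|g x|.
have bnd (n : nat) : n%:R * `|g (c *: x) - c * g x| <= D.
  pose k := Num.floor (n%:R * c); pose r := n%:R * c - k%:~R.
  have r01 : 0 <= r <= 1.
    have /andP[h1 h2] := Num.Theory.floor_itv (n%:R * c).
    rewrite subr_ge0 h1 /=; rewrite /r -/k; move: h2; rewrite -/k intrD; lra.
  have e : n%:R * (g (c *: x) - c * g x) = g (r *: x) - r * g x.
    rewrite mulrBr -gn scalerA mulrA [n%:R * c](_ : _ = k%:~R + r); last first.
      by rewrite /r addrC subrK.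
    by rewrite scalerDl gD gz; ring.
  rewrite -[n%:R]ger0_norm// -normrM e (le_trans (ler_normB _ _))// lerD ?gC//.
  by rewrite normrM ler_piMl// ger0_norm; case/andP: r01.
have dpos : 0 < `|g (c *: x) - c * g x| by rewrite normr_gt0.
have := bnd (Num.truncn (D / `|g (c *: x) - c * g x|)).+1.
apply/negP; by rewrite -ltNge -ltr_pdivrMr// truncnS_gt.
Qed.

Section Hilbert.
Context {R : realType} {H : hilbertType R}.
Implicit Types (x y z : H).

Lemma innerDr x y z : '< x, y + z > = '< x, y > + '< x, z >.
Proof. by rewrite innerC innerDl !(innerC _ x). Qed.

Lemma innerZr (a : R) x y : '< x, a *: y > = a * '< x, y >.
Proof. by rewrite innerC innerZl innerC. Qed.

Lemma inner0l x : '< (0 : H), x > = 0.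
Proof. by rewrite -(scale0r 0) innerZl mul0r. Qed.

Lemma inner0r x : '< x, (0 : H) > = 0.
Proof. by rewrite innerC inner0l. Qed.

Lemma innerNl x y : '< - x, y > = - '< x, y >.
Proof. by rewrite -scaleN1r innerZl mulN1r. Qed.

Lemma innerNr x y : '< x, - y > = - '< x, y >.
Proof. by rewrite innerC innerNl innerC. Qed.

Lemma innerBl x y z : '< x - y, z > = '< x, z > - '< y, z >.
Proof. by rewrite innerDl innerNl. Qed.

Lemma innerBr x y z : '< x, y - z > = '< x, y > - '< x, z >.
Proof. by rewrite innerDr innerNr. Qed.

Definition innerE :=
  (@innerDl R H, innerDr, innerBl, innerBr, innerNl, innerNr, @innerZl R H, innerZr).

Lemma inner_ge0 x : 0 <= '< x, x >.
Proof. by rewrite inner_norm sqr_ge0. Qed.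

Lemma inner_eq0 x : '< x, x > = 0 -> x = 0.
Proof. by rewrite inner_norm => /eqP; rewrite sqrf_eq0 normr_eq0 => /eqP. Qed.

Lemma inner_inj x y : (forall z, '< x, z > = '< y, z >) -> x = y.
Proof.
move=> xy; apply/eqP; rewrite -subr_eq0; apply/eqP/inner_eq0.
by rewrite innerBl xy subrr.
Qed.

Lemma cauchy_schwarz x y : `|'< x, y >| <= `|x| * `|y|.
Proof.
rewrite -ler_sqr ?nnegrE ?mulr_ge0// real_normK ?num_real// exprMn -!inner_norm.
have [->|y0] := eqVneq y 0; first by rewrite !inner0r expr2 !mulr0.
have yy : 0 < '< y, y > by rewrite inner_norm exprn_gt0 ?normr_gt0.
have := inner_ge0 ('< y, y > *: x - '< x, y > *: y).
rewrite !innerE (innerC y x) => h.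
have : 0 <= '< y, y > * ('< x, x > * '< y, y > - '< x, y > ^+ 2) by lra.
by rewrite pmulr_rge0// subr_ge0.
Qed.

Lemma parallelogram x y :
  `|x + y| ^+ 2 + `|x - y| ^+ 2 = 2 * `|x| ^+ 2 + 2 * `|y| ^+ 2.
Proof. by rewrite -!inner_norm !innerE (innerC y x); ring. Qed.

Lemma inner_continuousl y : continuous (fun x => '< x, y >).
Proof.
move=> x; apply/cvgrPdist_lt => e e0; near=> z.
rewrite -innerBl (le_lt_trans (cauchy_schwarz _ _))//.
rewrite (@le_lt_trans _ _ (`|x - z| * (`|y| + 1)))//.
  by rewrite ler_wpM2l// lerDl.
rewrite -ltr_pdivlMr; last by rewrite ltr_wpDl.
by near: z; apply: cvgr_dist_lt => //; rewrite divr_gt0// ltr_wpDl.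
Unshelve. all: by end_near. Qed.

(** A bounded functional [f] is represented by the minimizer of
    [|y|^2 - 2 f y]: by the parallelogram law a minimizing sequence is Cauchy,
    and the first variation at its limit vanishes. *)
Lemma riesz_representation (f : H -> R) :
  scalar f -> (exists C : R, forall x, `|f x| <= C * `|x|) ->
  exists y, forall x, f x = '< x, y >.
Proof.
move=> lf [C fC].
have fD x y : f (x + y) = f x + f y by have := lf 1 x y; rewrite scale1r mul1r.
have f0 : f 0 = 0 by have := fD 0 0; rewrite addr0; lra.
have fZ a x : f (a *: x) = a * f x by have := lf a x 0; rewrite !addr0 f0 addr0.
pose J y : R := `|y| ^+ 2 - 2 * f y.
have Jlb y : - C ^+ 2 <= J y.
  have := fC y; rewrite ler_norml => /andP[_ fy].
  have := sqr_ge0 (`|y| - C); rewrite /J; nra.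
pose S := range J.
have hS : has_inf S.
  by split; [exists (J 0), 0|exists (- C ^+ 2) => _ [y _ <-]].
pose d := inf S.
have dJ y : d <= J y by apply: ge_inf => //; [exact: hS.2|exists y].
have /choice[u uP] (n : nat) : exists y, J y < d + n.+1%:R^-1.
  have n0 : 0 < n.+1%:R^-1 :> R by rewrite invr_gt0.
  by have [_ [y _ <-] yd] := inf_adherent n0 hS; exists y.
have mid x y : `|x - y| ^+ 2 <= 2 * (J x - d) + 2 * (J y - d).
  have := dJ (2^-1 *: (x + y)); have := parallelogram x y.
  rewrite /J normrZ fZ fD gtr0_norm ?invr_gt0// exprMn; lra.
have /cvg_ex[l ul] : cvgn u.
  apply: (@cvgn_sqr_bound _ _ _ (fun n => 2 * n.+1%:R^-1)).
    by rewrite -[X in _ --> X](mulr0 2); apply: cvgMl_tmp; exact: cvg_harmonic.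
  move=> n m; apply: le_trans (mid _ _) _ => /=.
  have := uP n; have := uP m; move: (J (u n)) (J (u m)) (n.+1%:R^-1) (m.+1%:R^-1) => a b x y; lra.
exists l => x; pose a := '< l, x > - f x.
have var t : 0 <= t ^+ 2 * '< x, x > + 2 * t * a.
  have h : (fun n => t ^+ 2 * '< x, x > + 2 * t * ('< u n, x > - f x)
      + n.+1%:R^-1) @ \oo --> t ^+ 2 * '< x, x > + 2 * t * a + 0.
    apply: cvgD; last exact: cvg_harmonic.
    apply: cvgD; first exact: cvg_cst.
    apply: cvgMl_tmp; apply: cvgB; last exact: cvg_cst.
    exact: cvg_comp ul (@inner_continuousl x l).
  rewrite -[leRHS]addr0; apply: cvgr_to_ge h _; near=> n.
  have := dJ (u n + t *: x); have := uP n.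
  rewrite /J -!inner_norm !innerE fD fZ (innerC x (u n)).
  move: (n.+1%:R^-1) => y; lra.
(* A positive form in [t] whose linear coefficient is not [0] is negative for
   some small [t]; [-a / (|x|^2 + 1)] avoids the case [x = 0]. *)
pose X := '< x, x >; have X0 : 0 <= X := inner_ge0 x.
have X1 : X + 1 != 0 by rewrite gt_eqF// ltr_wpDl.
have : 0 <= - (a ^+ 2 * (X + 2)) / (X + 1) ^+ 2.
  rewrite [leRHS](_ : _ = (- a / (X + 1)) ^+ 2 * X + 2 * (- a / (X + 1)) * a)//.
  by field.
rewrite pmulr_lge0 ?invr_gt0 ?exprn_even_gt0//= oppr_ge0 => h.
have : a ^+ 2 == 0 by rewrite eq_le sqr_ge0 andbT; have := sqr_ge0 a; nra.
by rewrite sqrf_eq0 subr_eq0 (innerC l) => /eqP.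
Unshelve. all: by end_near. Qed.

(** [adj] is defined by choice; the Riesz theorem shows that there is something
    to choose. *)
Lemma adjP (T : bop H H) x y : '< T x, y > = '< x, adj T y >.
Proof.
rewrite /adj; case: xgetP => [S -> //|noS]; exfalso.
have /choice[S SP] z : exists w, forall u, '< T u, z > = '< u, w >.
  have [||w wP] := @riesz_representation (fun u => '< T u, z >).
  - by move=> a u v; rewrite linearP innerDl innerZl.
  - exists (opnorm T * `|z|) => u.
    by rewrite (le_trans (cauchy_schwarz _ _))// mulrAC ler_wpM2r// opnorm_ub.
  - by exists w.
have Sb : S \in @bounded_linear R H H.
  apply/asboolP; split.
    move=> a u v; apply: inner_inj => z.
    by rewrite innerDl innerZl !(innerC _ z) -!SP innerDr innerZr.
  exists (opnorm T) => u.
  have [->|u0] := eqVneq (S u) 0; first by rewrite normr0 mulr_ge0// opnorm_ge0.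
  rewrite -(@ler_pM2l _ `|S u|) ?normr_gt0// -expr2 -inner_norm -SP.
  rewrite (le_trans (ler_norm _))// (le_trans (cauchy_schwarz _ _))//.
  by rewrite mulrCA mulrA ler_wpM2r// opnorm_ub.
by apply: (noS (Bop Sb)) => u v; exact: SP.
Qed.

Lemma sa_sym (A : sa H) x y : '< A x, y > = '< x, A y >.
Proof. by case: A => A /= /asboolP. Qed.

Lemma saBE (A B : sa H) x : (A - B) x = A x - B x. Proof. by []. Qed.

(** By polarization. *)
Lemma sa_ext (A B : sa H) : (forall x, '< A x, x > = '< B x, x >) -> A = B.
Proof.
move=> AB; apply/val_inj/bopP => x; apply: inner_inj => y.
have sym (B' : sa H) : '< B' y, x > = '< B' x, y > by rewrite sa_sym innerC.
by have := AB (x + y); rewrite !linearD !innerE !AB !sym; lra.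
Qed.

(** The Jordan-von Neumann argument: a bounded function that satisfies the
    parallelogram law is the quadratic form of a self-adjoint operator. Its
    polarization is additive by the parallelogram law and homogeneous by
    boundedness, hence represented by an operator. *)
Lemma quadratic_form_operator (Q : H -> R) (C : R) :
  (forall x y, Q (x + y) + Q (x - y) = 2 * Q x + 2 * Q y) ->
  (forall x, `|Q x| <= C * `|x| ^+ 2) ->
  exists S : sa H, forall x, '< S x, x > = Q x.
Proof.
move=> Qp Qb.
have C0 x : 0 <= C * `|x| ^+ 2 by apply: le_trans (Qb x).
have Q0 : Q 0 = 0 by have := Qp 0 0; rewrite subrr addr0; lra.
have QN x : Q (- x) = Q x by have := Qp 0 x; rewrite add0r sub0r Q0; lra.
have Q2 x : Q (x + x) = 4 * Q x by have := Qp x x; rewrite subrr Q0; lra.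
pose b x y := (Q (x + y) - Q (x - y)) / 4 : R.
have bC x y : b x y = b y x by rewrite /b (addrC x) -(QN (x - y)) opprB.
have b0 y : b 0 y = 0 by rewrite /b add0r sub0r QN subrr mul0r.
have bmid x y z : b x z + b y z = 2 * b (2^-1 *: (x + y)) z.
  have h w : Q (x + w) + Q (y + w)
      = 2 * Q (2^-1 *: (x + y) + w) + 2 * Q (2^-1 *: (x - y)).
    rewrite -Qp; congr (Q _ + Q _).
      rewrite addrAC -scalerDr addrACA subrr addr0 -mulr2n -[x *+ 2]scaler_nat scalerA.
      by rewrite mulVf// scale1r.
    rewrite addrAC -scalerBr opprB [x + y + _]addrC addrA subrK.
    by rewrite -mulr2n -[y *+ 2]scaler_nat scalerA mulVf// scale1r.
  by have := h z; have := h (- z); rewrite /b; lra.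
have bD x y z : b (x + y) z = b x z + b y z.
  by have := bmid (x + y) 0 z; rewrite b0 !addr0 bmid.
have bB x y : `|b x y| <= C * (`|x| ^+ 2 + `|y| ^+ 2) / 2.
  rewrite /b normrM [`|4^-1|]gtr0_norm//.
  have := ler_normB (Q (x + y)) (Q (x - y)); have := Qb (x + y).
  have := Qb (x - y); have := congr1 ( *%R C) (parallelogram x y).
  by rewrite mulrDr; lra.
have bZ c x y : b (c *: x) y = c * b x y.
  apply: (@additive_bounded_homogeneous _ _ (b ^~ y)
    (fun x => C * (`|x| ^+ 2 + `|y| ^+ 2) / 2)) => // {}x a /andP[a0 a1].
  apply: le_trans (bB _ _) _; rewrite normrZ (ger0_norm a0) exprMn.
  have := C0 x; have : a ^+ 2 <= 1 by rewrite expr_le1.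
  by nra.
have bZr c x y : b x (c *: y) = c * b x y by rewrite bC bZ bC.
have bQ x : b x x = Q x by rewrite /b subrr Q0 Q2; lra.
have /choice[S SP] y : exists w, forall x, b x y = '< x, w >.
  have [||w wP] := @riesz_representation (b ^~ y); last by exists w.
    by move=> a u v; rewrite bD bZ.
  exists (C * (1 + `|y| ^+ 2) / 2) => x.
  have [->|x0] := eqVneq x 0; first by rewrite b0 normr0 normr0 mulr0.
  have n1 : `| `|x|^-1 *: x| = 1.
    by rewrite normrZ normfV normr_id mulVf ?normr_eq0.
  have := bB (`|x|^-1 *: x) y; rewrite n1 bZ normrM normfV normr_id expr1n mulrC.
  by rewrite ler_pdivrMr ?normr_gt0.
have Sb : S \in @bounded_linear R H H.
  apply/asboolP; split.
    move=> a u v; apply: inner_inj => z.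
    by rewrite innerDl innerZl !(innerC _ z) -!SP bC bD bZ !(bC z).
  exists C => x; have [->|x0] := eqVneq x 0.
    have -> : S 0 = 0 by apply: inner_eq0; rewrite -SP bC b0.
    by rewrite !normr0 mulr0.
  have [->|S0] := eqVneq (S x) 0.
    have := C0 x; rewrite normr0 expr2 mulrA pmulr_lge0 ?normr_gt0//.
  (* [b] is bounded on pairs of vectors of equal norm. *)
  pose t := `|x| / `|S x|.
  have t0 : 0 <= t by rewrite divr_ge0.
  have nt : `|t *: S x| = `|x|.
    by rewrite normrZ ger0_norm// divfK ?normr_eq0.
  have := bB (t *: S x) x; rewrite nt SP innerZl inner_norm normrM.
  rewrite (ger0_norm t0) (ger0_norm (sqr_ge0 _)) expr2 mulrA divfK ?normr_eq0//.
  rewrite (_ : C * _ / 2 = `|x| * (C * `|x|)); last by field.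
  by rewrite ler_pM2l ?normr_gt0.
have Ssa : Bop Sb \in @selfadjoint R H.
  by apply/asboolP => x y /=; rewrite innerC -!SP bC.
by exists (Sa Ssa) => x /=; rewrite innerC -SP.
Qed.

(** Polarize at [x] and the unit vector in the direction of [S x]. *)
Lemma opnorm_quadratic_form (S : sa H) (C : R) : 0 <= C ->
  (forall x, `|'< S x, x >| <= C * `|x| ^+ 2) -> opnorm S <= C.
Proof.
move=> C0 SC; apply: opnorm_le => x x1.
have pol y : '< S x, y > <= C * (`|x| ^+ 2 + `|y| ^+ 2) / 2.
  have h1 : '< S (x + y), x + y > - '< S (x - y), x - y > = 4 * '< S x, y >.
    rewrite linearD linearB !innerE (sa_sym S y x) (innerC y (S x)); lra.
  have := SC (x + y); have := SC (x - y); rewrite !ler_norml.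
  move=> /andP[h2 _] /andP[_ h3].
  by have := congr1 ( *%R C) (parallelogram x y); rewrite mulrDr; lra.
have [->|Sx] := eqVneq (S x) 0; first by rewrite normr0.
have n0 : 0 < `|S x| by rewrite normr_gt0.
have := pol (`|S x|^-1 *: S x); rewrite innerZr inner_norm normrZ normfV normr_id.
rewrite expr2 mulKf ?gt_eqF// mulVf ?gt_eqF// expr1n => h; apply: le_trans h _.
have x2 : `|x| ^+ 2 <= 1 by rewrite expr_le1.
by have := ler_wpM2l C0 x2; lra.
Qed.

(** The least upper bound of an increasing sequence is its pointwise limit:
    the limit of the quadratic forms is itself the form of an operator, which
    is an upper bound and hence dominates the supremum. *)
Lemma loewner_sup_cvg (A_ : nat -> sa H) (A : sa H) :
  (forall i, psd (A_ i.+1 - A_ i)) -> loewner_sup A_ A ->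
  forall x, (fun i => '< A_ i x, x >) @ \oo --> '< A x, x >.
Proof.
move=> incA [ubA lubA].
have Bform (S T : sa H) x : '< (S - T) x, x > = '< S x, x > - '< T x, x >.
  by rewrite saBE innerBl.
have inc x : nondecreasing_seq (fun i => '< A_ i x, x >).
  by apply/nondecreasing_seqP => n; have := incA n x; rewrite Bform subr_ge0.
have ub x i : '< A_ i x, x > <= '< A x, x >.
  by have := ubA i x; rewrite Bform subr_ge0.
have cv x : cvgn (fun i => '< A_ i x, x >).
  apply: nondecreasing_is_cvgn => //.
  by exists '< A x, x > => _ [i _ <-].
pose Q x := limn (fun i => '< A_ i x, x >).
have Qc x : (fun i => '< A_ i x, x >) @ \oo --> Q x := cv x.
have lb x i : '< A_ i x, x > <= Q x by exact: nondecreasing_cvgn_le.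
have [||S SQ] := @quadratic_form_operator Q (opnorm A + opnorm (A_ 0)).
- move=> x y.
  have l1 : (fun i => '< A_ i (x + y), x + y > + '< A_ i (x - y), x - y >) @ \oo
      --> Q (x + y) + Q (x - y) by exact: cvgD.
  have l2 : (fun i => 2 * '< A_ i x, x > + 2 * '< A_ i y, y >) @ \oo
      --> 2 * Q x + 2 * Q y by exact: cvgD (cvgMl_tmp (Qc x)) (cvgMl_tmp (Qc y)).
  rewrite -(cvg_lim _ l1)// -(cvg_lim _ l2)//.
  rewrite [X in limn X](_ : _ = fun i => 2 * '< A_ i x, x > + 2 * '< A_ i y, y >)//.
  by apply/funext => i; rewrite linearD linearB !innerE; ring.
- move=> x.
  have h (B : sa H) : `|'< B x, x >| <= opnorm B * `|x| ^+ 2.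
    rewrite (le_trans (cauchy_schwarz _ _))// expr2 mulrA ler_wpM2r//.
    exact: opnorm_ub.
  have Qle : Q x <= '< A x, x > by apply: limr_le => //; exact: nearW.
  rewrite ler_norml mulrDl; apply/andP; split.
    have := h (A_ 0); rewrite ler_norml => /andP[+ _]; have := lb x 0.
    have : 0 <= opnorm A * `|x| ^+ 2 by rewrite mulr_ge0// opnorm_ge0.
    lra.
  have := h A; rewrite ler_norml => /andP[_].
  have : 0 <= opnorm (A_ 0) * `|x| ^+ 2 by rewrite mulr_ge0// opnorm_ge0.
  lra.
have AS : psd (S - A) by apply: lubA => i x; rewrite Bform SQ subr_ge0.
move=> x; rewrite (_ : '< A x, x > = Q x)//; apply/eqP; rewrite eq_le.
have := AS x; rewrite Bform SQ subr_ge0 => -> /=.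
by apply: limr_le => //; exact: nearW.
Qed.

End Hilbert.

(** * Square roots and positive parts of self-adjoint operators *)

Section SquareRoot.
Context {R : realType} {H : hilbertType R}.
Implicit Types (x y z : H) (A B C G S : sa H).

Lemma saDE A B x : (A + B) x = A x + B x. Proof. by []. Qed.
Lemma saNE A x : (- A) x = - A x. Proof. by []. Qed.
Lemma saZE (a : R) A x : (a *: A) x = a *: A x. Proof. by []. Qed.

Lemma opD A x y : A (x + y) = A x + A y. Proof. exact: linearD. Qed.
Lemma opB A x y : A (x - y) = A x - A y. Proof. exact: linearB. Qed.
Lemma opN A x : A (- x) = - A x. Proof. exact: linearN. Qed.
Lemma opZ (a : R) A x : A (a *: x) = a *: A x. Proof. exact: linearZ. Qed.
Lemma op0 A : A 0 = 0. Proof. exact: linear0. Qed.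

Lemma sa_eq A B : (forall x, A x = B x) -> A = B.
Proof. by move=> AB; apply: sa_ext => x; rewrite AB. Qed.

Lemma id_bounded : idfun \in @bounded_linear R H H.
Proof.
by apply/asboolP; split; [move=> a x y|exists 1 => x; rewrite mul1r].
Qed.

Lemma id_selfadjoint : Bop id_bounded \in @selfadjoint R H.
Proof. exact/asboolP. Qed.

Definition sa1 : sa H := Sa id_selfadjoint.

Lemma sa1E x : sa1 x = x. Proof. by []. Qed.

Lemma sa_sqr_selfadjoint A : bcomp A A \in @selfadjoint R H.
Proof. by apply/asboolP => x y /=; rewrite !sa_sym. Qed.

Definition sa_sqr A : sa H := Sa (sa_sqr_selfadjoint A).

Lemma sa_sqrE A x : sa_sqr A x = A (A x). Proof. by []. Qed.

Lemma bcompE A B x : bcomp A B x = A (B x). Proof. by []. Qed.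

Definition opE := (@saBE R H, saDE, saNE, saZE, sa1E, sa_sqrE).

Definition commuting A B := forall x, A (B x) = B (A x).

Lemma commuting_sym A B : commuting A B -> commuting B A.
Proof. by move=> AB x; rewrite AB. Qed.

Lemma commuting_sub_sqr A B x : commuting A B ->
  A (A x) - B (B x) = (A - B) (A x + B x).
Proof. by move=> AB; rewrite saBE !opD AB opprD addrA addrK. Qed.

Lemma half_sub_sqr A B x y : commuting A B -> A x = 2^-1 *: (y + B (B x)) ->
  2^-1 *: (y + A (A x)) - A x = 2^-1 *: ((A - B) (A x + B x)).
Proof.
move=> AB e; rewrite -(commuting_sub_sqr x AB) {2}e -scalerBr; congr (_ *: _).
by rewrite opprD addrACA subrr add0r.
Qed.

Lemma psd_sqr A : psd (sa_sqr A).
Proof. by move=> x; rewrite opE sa_sym inner_ge0. Qed.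

Lemma psdD A B : psd A -> psd B -> psd (A + B).
Proof. by move=> pA pB x; rewrite opE innerDl addr_ge0. Qed.

Lemma psdZ (a : R) A : 0 <= a -> psd A -> psd (a *: A).
Proof. by move=> a0 pA x; rewrite opE innerZl mulr_ge0. Qed.

Lemma quadratic_form_bound A x : `|'< A x, x >| <= opnorm A * `|x| ^+ 2.
Proof.
rewrite (le_trans (cauchy_schwarz _ _))// expr2 mulrA ler_wpM2r//.
exact: opnorm_ub.
Qed.

(** The numerical model of the iteration below, at the spectral value where it
    converges most slowly. *)
Fixpoint sqrt_bound (n : nat) : R :=
  if n is m.+1 then (1 + sqrt_bound m ^+ 2) / 2 else 0.

Lemma sqrt_bound_itv n : 0 <= sqrt_bound n <= 1.
Proof.
by elim: n => [|n /andP[h0 h1]] /=; rewrite ?lexx ?ler01//; apply/andP; nra.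
Qed.

Lemma sqrt_bound_gap n : 1 - sqrt_bound n <= 2 / n.+2%:R.
Proof.
elim: n => [|n IH]; first by rewrite subr0 divff.
have /andP[h0 h1] := sqrt_bound_itv n.
set v := 1 - sqrt_bound n in IH *; set t := n.+2%:R : R in IH *.
have t0 : 0 < t by rewrite ltr0n.
have -> : 1 - sqrt_bound n.+1 = v - v ^+ 2 / 2 by rewrite /v/=; field.
have t2 : 2 <= t by rewrite ler_nat.
have -> : n.+3%:R = t + 1 :> R by rewrite /t natr1.
have w1 : 2 / t <= 1 by rewrite ler_pdivrMr// mul1r.
have v0 : 0 <= v by rewrite /v; lra.
apply: (@le_trans _ _ (2 / t - (2 / t) ^+ 2 / 2)).
  move: (2 / t) IH w1 => w; nra.
rewrite ler_pdivlMr; last lra.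
rewrite (_ : (2 / t - (2 / t) ^+ 2 / 2) * (t + 1) = 2 - 2 / t ^+ 2); last first.
  by field; rewrite gt_eqF.
by rewrite gerBl divr_ge0// sqr_ge0.
Qed.

Lemma sqrt_bound_cvg : (fun n => 1 - sqrt_bound n) @ \oo --> 0.
Proof.
have h : (fun n => 2 * harmonic n.+1) @ \oo --> (0 : R).
  rewrite -[X in _ --> X](mulr0 2); apply: cvgMl_tmp.
  by rewrite (@cvg_shiftS _ (@harmonic R)); exact: cvg_harmonic.
apply: squeeze_cvgr (cvg_cst 0) h; apply: nearW => n.
rewrite sqrt_bound_gap andbT subr_ge0; by case/andP: (sqrt_bound_itv n).
Qed.

(** If [Y] is the limit of [sqrt_iter G], then [1 - Y] is the square root of
    [G]: the recursion is the fixed-point equation [2 Y = (1 - G) + Y^2], that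
    is [(1 - Y)^2 = G]. *)
Fixpoint sqrt_iter G n : sa H :=
  if n is m.+1 then 2^-1 *: ((sa1 - G) + sa_sqr (sqrt_iter G m)) else 0.

Lemma sqrt_iterS G n x : sqrt_iter G n.+1 x =
  2^-1 *: (x - G x + sqrt_iter G n (sqrt_iter G n x)).
Proof. by []. Qed.

Lemma sqrt_iter_commuting G C n : commuting C G -> commuting C (sqrt_iter G n).
Proof.
move=> CG; elim: n => [|n IH] x; first by rewrite /= op0.
by rewrite !sqrt_iterS opZ opD opB CG !IH.
Qed.

Lemma sqrt_iter_commutes G n m : commuting (sqrt_iter G n) (sqrt_iter G m).
Proof. exact/sqrt_iter_commuting/commuting_sym/sqrt_iter_commuting. Qed.

Section Contraction.
Variable G : sa H.
Hypotheses (G0 : psd G) (G1 : opnorm G <= 1).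

Lemma contraction_le x : `|G x| <= `|x|.
Proof. by rewrite (le_trans (opnorm_ub _ _))// ler_piMl. Qed.

(** Expanding [<G (x - G x), x - G x> >= 0] bounds [|G x|^2] by [<G x, x>]. *)
Lemma complement_contraction x : `|x - G x| <= `|x|.
Proof.
rewrite -ler_sqr ?nnegrE// -!inner_norm.
have := G0 (x - G x); rewrite opB !innerE (sa_sym G (G x)) (innerC x (G x)).
have := cauchy_schwarz (G (G x)) (G x); rewrite ler_norml => /andP[_].
have := contraction_le (G x); have := normr_ge0 (G x); have := inner_norm (G x).
have := normr_ge0 (G (G x)); rewrite !(sa_sym G (G x)); nra.
Qed.

Lemma sqrt_iter_le n x : `|sqrt_iter G n x| <= sqrt_bound n * `|x|.
Proof.
elim: n x => [|n IH] x; first by rewrite /= normr0 mul0r.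
have /andP[y0 _] := sqrt_bound_itv n.
rewrite sqrt_iterS normrZ gtr0_norm ?invr_gt0//=.
have := ler_normD (x - G x) (sqrt_iter G n (sqrt_iter G n x)).
have := complement_contraction x; have := IH (sqrt_iter G n x).
have := ler_wpM2l y0 (IH x); lra.
Qed.

(** Since the iterates commute, [Y^2 - Z^2] factors, and the increments obey the
    same recursion as those of [sqrt_bound]. *)
Lemma sqrt_iter_step n x :
  `|sqrt_iter G n.+1 x - sqrt_iter G n x| <=
  (sqrt_bound n.+1 - sqrt_bound n) * `|x|.
Proof.
elim: n x => [|n IH] x.
  by have := sqrt_iter_le 1 x; rewrite /= subr0 !subr0.
have /andP[y0 _] := sqrt_bound_itv n; have /andP[y1 _] := sqrt_bound_itv n.+1.
set Y := sqrt_iter G n.+1; set Z := sqrt_iter G n.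
have YZ : commuting Y Z := sqrt_iter_commutes G n.+1 n.
have -> : sqrt_iter G n.+2 x - Y x = 2^-1 *: ((Y - Z) (Y x + Z x)).
  rewrite (sqrt_iterS G n.+1 x) -/Y; have := sqrt_iterS G n x; rewrite -/Y -/Z.
  by move: (Y) (Z) YZ => Y' Z' YZ; exact: half_sub_sqr.
rewrite normrZ gtr0_norm ?invr_gt0// opE.
have := IH (Y x + Z x); rewrite -/Y -/Z.
have := sqrt_iter_le n.+1 x; have := sqrt_iter_le n x; rewrite -/Y -/Z.
have := ler_normD (Y x) (Z x).
have sD : 0 <= sqrt_bound n.+1 - sqrt_bound n.
  by rewrite /= subr_ge0; have := sqr_ge0 (1 - sqrt_bound n); lra.
move=> h1 h2 h3; have h4 : `|Y x + Z x| <= (sqrt_bound n.+1 + sqrt_bound n) * `|x|.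
  lra.
have e : sqrt_bound n.+2 - sqrt_bound n.+1
    = (sqrt_bound n.+1 - sqrt_bound n) * (sqrt_bound n.+1 + sqrt_bound n) / 2.
  by rewrite /=; field.
by move/le_trans => /(_ _ (ler_wpM2l sD h4)); rewrite e; lra.
Qed.

Lemma sqrt_iter_gap n m x : (n <= m)%N ->
  `|sqrt_iter G m x - sqrt_iter G n x| <= (sqrt_bound m - sqrt_bound n) * `|x|.
Proof.
elim: m => [|m IH]; first by rewrite leqn0 => /eqP ->; rewrite !subrr normr0 mul0r.
rewrite leq_eqVlt => /predU1P[->|]; first by rewrite !subrr normr0 mul0r.
rewrite ltnS => /IH h; rewrite -(subrKA (sqrt_iter G m x)).
rewrite (le_trans (ler_normD _ _))//.
by have := sqrt_iter_step m x; lra.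
Qed.

Lemma sqrt_iter_psd n : psd (sqrt_iter G n).
Proof.
case: n => [|n] x; first by rewrite /= inner0l.
apply: psdZ; first by rewrite invr_ge0.
apply: psdD; last exact: psd_sqr.
move=> {}x; rewrite opE innerBl sa1E subr_ge0.
have := contraction_le x; have := cauchy_schwarz (G x) x.
rewrite ler_norml inner_norm => /andP[_]; have := normr_ge0 x; nra.
Qed.

(** Besides existence, the two facts used below are that the square root
    commutes with everything that commutes with [G], and that order relations
    between the iterates and another operator pass to it. *)
Lemma contraction_sqrt : exists S : sa H,
  [/\ psd S, sa_sqr S = G, forall C, commuting C G -> commuting C S &
      forall x, (fun n => x - sqrt_iter G n x) @ \oo --> S x].
Proof.
have Yc x : cvgn (fun n => sqrt_iter G n x).
  apply: (@cvgn_sqr_bound _ _ _ (fun n => (1 - sqrt_bound n) * (2 * `|x| ^+ 2))).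
    rewrite -[X in _ --> X](mul0r (2 * `|x| ^+ 2)); apply: cvgMr_tmp.
    exact: sqrt_bound_cvg.
  move=> n m; wlog nm : n m / (n <= m)%N => [h|].
    have [nm|/ltnW nm] := leqP n m; first exact: h.
    by rewrite distrC [leRHS]addrC; exact: h.
  have /andP[y0 y1] := sqrt_bound_itv n; have /andP[z0 z1] := sqrt_bound_itv m.
  have := sqrt_iter_gap x nm; rewrite distrC => h.
  have x0 := sqr_ge0 `|x|.
  have : `|sqrt_iter G n x - sqrt_iter G m x| ^+ 2 <=
      (sqrt_bound m - sqrt_bound n) ^+ 2 * `|x| ^+ 2.
    rewrite -exprMn ler_sqr ?nnegrE// (le_trans _ h)//.
  have : (sqrt_bound m - sqrt_bound n) ^+ 2 <=
      (1 - sqrt_bound n + (1 - sqrt_bound m)) * 2 by nra.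
  by move=> /(ler_wpM2r x0); lra.
pose Y x := limn (fun n => sqrt_iter G n x).
have YP x : (fun n => sqrt_iter G n x) @ \oo --> Y x := Yc x.
have Yin x y : (fun n => '< sqrt_iter G n x, y >) @ \oo --> '< Y x, y >.
  exact: cvg_comp (YP x) (@inner_continuousl _ _ y _).
have Yle x : `|Y x| <= 1 * `|x|.
  have h : (fun n => `|sqrt_iter G n x|) @ \oo --> `|Y x| by exact: cvg_norm.
  apply: cvgr_to_le h _; apply: nearW => n; rewrite mul1r.
  apply: le_trans (sqrt_iter_le n x) _; have /andP[? ?] := sqrt_bound_itv n.
  by rewrite ler_piMl.
have Yb : Y \in @bounded_linear R H H.
  apply/asboolP; split; last by exists 1.
  move=> a x y; apply/cvg_lim => //.
  rewrite (_ : (fun n => sqrt_iter G n (a *: x + y)) =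
    (fun n => a *: sqrt_iter G n x + sqrt_iter G n y)); last first.
    by apply/funext => n; rewrite linearP.
  by apply: cvgD; [apply: cvgZl_tmp|]; exact: YP.
have Ysa : Bop Yb \in @selfadjoint R H.
  apply/asboolP => x y /=; rewrite (innerC x).
  rewrite -(cvg_lim _ (Yin x y))// -(cvg_lim _ (Yin y x))//.
  rewrite [X in limn X = _](_ : _ = fun n => '< sqrt_iter G n y, x >)//.
  by apply/funext => n; rewrite sa_sym innerC.
pose Yo := Sa Ysa.
have Ycomm C : commuting C G -> commuting C Yo.
  move=> CG x; apply: inner_inj => z; rewrite sa_sym.
  rewrite -(cvg_lim _ (Yin x (C z)))// -(cvg_lim _ (Yin (C x) z))//.
  rewrite [X in limn X = _](_ : _ = fun n => '< sqrt_iter G n (C x), z >)//.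
  by apply/funext => n; rewrite -(sqrt_iter_commuting _ CG) (sa_sym C).
have YY x : (fun n => sqrt_iter G n (sqrt_iter G n x)) @ \oo --> Y (Y x).
  have hx : (fun n => `|sqrt_iter G n x - Y x|) @ \oo --> 0.
    by apply/norm_cvg0P/subr_cvg0; exact: YP.
  have h0 : (fun n => sqrt_iter G n (sqrt_iter G n x - Y x)) @ \oo --> 0.
    apply/norm_cvg0P; apply: squeeze_cvgr (cvg_cst 0) hx; apply: nearW => n.
    rewrite normr_ge0 /=; apply: le_trans (sqrt_iter_le n _) _.
    by have /andP[? ?] := sqrt_bound_itv n; rewrite ler_piMl.
  rewrite -[X in _ --> X]add0r.
  rewrite (_ : (fun n => _) = (fun n => sqrt_iter G n (sqrt_iter G n x - Y x)
     + sqrt_iter G n (Y x))); first by apply: cvgD => //; exact: YP.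
  by apply/funext => n; rewrite opB subrK.
have Yfix x : Y x = 2^-1 *: (x - G x + Y (Y x)).
  have h1 : (fun n => sqrt_iter G n.+1 x) @ \oo --> Y x.
    by rewrite (@cvg_shiftS _ (fun n => sqrt_iter G n x)); exact: YP.
  have h2 : (fun n => sqrt_iter G n.+1 x) @ \oo --> 2^-1 *: (x - G x + Y (Y x)).
    under eq_fun do rewrite sqrt_iterS.
    by apply: cvgZl_tmp; apply: cvgD; [exact: cvg_cst|exact: YY].
  have hH := @norm_hausdorff R H.
  exact: etrans (esym (cvg_lim hH h1)) (cvg_lim hH h2).
have [S SE] : exists S : sa H, forall x, S x = x - Y x by exists (sa1 - Yo).
exists S; split.
- move=> x; rewrite SE innerBl subr_ge0.
  have := cauchy_schwarz (Y x) x; have := Yle x; rewrite inner_norm mul1r.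
  by rewrite ler_norml => h /andP[_]; have := normr_ge0 x; nra.
- apply: sa_eq => x; rewrite sa_sqrE.
  have YB : Y (x - Y x) = Y x - Y (Y x) by exact: (opB Yo).
  have e := Yfix x; apply: inner_inj => z.
  have := congr1 (fun u => '< u, z >) e.
  by rewrite !SE YB !innerE; lra.
- by move=> C /Ycomm CY x; rewrite !SE opB; congr (_ - _); exact: CY.
- by move=> x; rewrite SE; apply: cvgB; [exact: cvg_cst|exact: YP].
Unshelve. all: by end_near. Qed.

End Contraction.

Lemma contraction_rescale A : exists c : R,
  0 < c /\ opnorm (c^-1 *: A) <= 1.
Proof.
exists (opnorm A + 1); have h := opnorm_ge0 A; split; first by rewrite ltr_wpDl.
rewrite [opnorm _](_ : _ = opnorm ((opnorm A + 1)^-1 *: (A : bop H H)))// opnormZ.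
rewrite normfV ger0_norm ?addr_ge0// mulrC ler_pdivrMr ?ltr_wpDl//.
by rewrite mul1r lerDl.
Qed.

Lemma psd_sqrt A : psd A -> exists S : sa H,
  [/\ psd S, sa_sqr S = A & forall C, commuting C A -> commuting C S].
Proof.
move=> pA; have [c [c0 Ac]] := contraction_rescale A.
have ci : 0 <= c^-1 by rewrite invr_ge0 ltW.
have [S [pS SA SC _]] := contraction_sqrt (psdZ ci pA) Ac.
exists (Num.sqrt c *: S); split; first exact/psdZ/pS/sqrtr_ge0.
  apply: sa_eq => x; rewrite sa_sqrE !saZE opZ scalerA -expr2 sqr_sqrtr ?ltW//.
  by rewrite -sa_sqrE SA saZE scalerA mulfV ?scale1r ?gt_eqF.
move=> C CA x; rewrite !saZE opZ SC// => {}x.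
by rewrite !saZE opZ CA.
Qed.

(** With [A = S^2] and [S] commuting with [B], the form is that of [B] at
    [S x]. *)
Lemma commuting_psd_mul A B : psd A -> psd B -> commuting B A ->
  forall x, 0 <= '< A (B x), x >.
Proof.
move=> pA pB BA x; have [S [_ SA SC]] := psd_sqrt pA.
by rewrite -SA sa_sqrE sa_sym -(SC _ BA).
Qed.

Lemma commuting_shift A B (P N : sa H) : commuting A B ->
  (forall x, P x = x + A x - B x) -> (forall x, N x = x - A x - B x) ->
  commuting P N.
Proof.
move=> AB PE NE x; rewrite (PE (N x)) (NE (P x)) NE PE !opB !opD AB.
by apply: inner_inj => z; rewrite !innerE; lra.
Qed.

(** Both inequalities [-(1 - Y_n) <= A <= 1 - Y_n] are proved together, since
    the step factors as
    [(1 - Y_n+1) - A = ((1 - Y_n) - A) (2 - ((1 - Y_n) + A)) / 2]. *)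
Lemma sqrt_iter_sqr_bound A n : opnorm A <= 1 ->
  let D := sa1 - sqrt_iter (sa_sqr A) n in psd (D - A) /\ psd (D + A).
Proof.
move=> A1.
have sq1 : opnorm (sa_sqr A) <= 1.
  apply: opnorm_le => x x1; rewrite (le_trans (contraction_le A1 _))//.
  exact: le_trans (contraction_le A1 _) _.
have Aform x : `|'< A x, x >| <= '< x, x >.
  rewrite inner_norm (le_trans (quadratic_form_bound _ _))//.
  by apply: ler_piMl A1; exact: sqr_ge0.
elim: n => [|n [IHm IHp]] D.
  by split=> x; rewrite !opE /= subr0 !innerE; have := Aform x;
    rewrite ler_norml => /andP[]; lra.
set Y := sqrt_iter (sa_sqr A) n in IHm IHp.
have YA x : Y (A x) = A (Y x) by apply/esym/sqrt_iter_commuting.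
have Ypsd := sqrt_iter_psd sq1 n.
have p2 : psd (sa1 + Y - A) /\ psd (sa1 + Y + A).
  by split=> x; rewrite !opE !innerE; have := Ypsd x; have := Aform x;
    rewrite ler_norml -/Y => /andP[]; lra.
have psdM (B : sa H) : commuting Y B -> (forall x, B (B x) = A (A x)) ->
    psd (sa1 - Y - B) -> psd (sa1 + Y - B) -> psd (D - B).
  move=> YB BA p q x.
  have PE v : (sa1 - Y - B) v = v - Y v - B v by [].
  have NE v : (sa1 + Y - B) v = v + Y v - B v by [].
  have Dx : (D - B) x = x - 2^-1 *: (x - A (A x) + Y (Y x)) - B x by [].
  have e : (D - B) x = 2^-1 *: (sa1 - Y - B) ((sa1 + Y - B) x).
    rewrite Dx PE NE !opB !opD YB BA; apply: inner_inj => z.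
    by rewrite !innerE; lra.
  rewrite e innerZl; apply: mulr_ge0; first by rewrite invr_ge0.
  exact: (commuting_psd_mul p q (commuting_shift YB NE PE)).
have NA1 : commuting Y (- A) by move=> x; rewrite !saNE opN YA.
have NA2 x : (- A) ((- A) x) = A (A x) by rewrite !saNE opN opprK.
have pp := psdM (- A) NA1 NA2; rewrite !opprK in pp.
split; first exact: (psdM A YA (fun=> erefl) IHm p2.1).
exact: (pp IHp p2.2).
Qed.

(** With [S] the square root of [A^2], the parts are [(S + A) / 2] and
    [(S - A) / 2]; they are positive as limits of the iterates above, and their
    product is [(S^2 - A^2) / 4 = 0]. *)
Lemma contraction_parts A : opnorm A <= 1 -> exists PN, is_parts A PN.
Proof.
move=> A1.
have sq1 : opnorm (sa_sqr A) <= 1.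
  apply: opnorm_le => x x1; rewrite (le_trans (contraction_le A1 _))//.
  exact: le_trans (contraction_le A1 _) _.
have [S [pS SA SC Slim]] := contraction_sqrt (psd_sqr A) sq1.
have AS : commuting A S by apply: SC.
have SS x : S (S x) = A (A x) by rewrite -sa_sqrE SA.
have Sin x : (fun n => '< x - sqrt_iter (sa_sqr A) n x, x >) @ \oo --> '< S x, x >.
  exact: cvg_comp (Slim x) (@inner_continuousl _ _ x _).
have [P PE] : exists P : sa H, forall x, P x = 2^-1 *: (S x + A x).
  by exists (2^-1 *: (S + A)).
have [N NE] : exists N : sa H, forall x, N x = 2^-1 *: (S x - A x).
  by exists (2^-1 *: (S - A)).
exists (P, N); split; rewrite ?[_.1]/= ?[_.2]/=.
- move=> x; rewrite PE innerZl mulr_ge0 ?invr_ge0//.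
  rewrite innerDl -lerBlDr sub0r; apply: cvgr_to_ge (Sin x) _.
  apply: nearW => n; have [_ /(_ x)] := sqrt_iter_sqr_bound n A1.
  by rewrite saDE innerDl -lerBlDr sub0r.
- move=> x; rewrite NE innerZl mulr_ge0 ?invr_ge0//.
  rewrite innerBl subr_ge0; apply: cvgr_to_ge (Sin x) _.
  apply: nearW => n; have [/(_ x) + _] := sqrt_iter_sqr_bound n A1.
  by rewrite saBE innerBl subr_ge0.
- apply: sa_eq => x; rewrite saBE PE NE; apply: inner_inj => z.
  by rewrite !innerE; lra.
- apply: bopP => x; suff -> : bcomp P N x = 0 by [].
  rewrite bcompE NE PE !(opZ, opB) AS SS; apply: inner_inj => z.
  by rewrite !innerE inner0l; lra.
- apply: bopP => x; suff -> : bcomp N P x = 0 by [].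
  rewrite bcompE PE NE !opZ !opD AS SS; apply: inner_inj => z.
  by rewrite !innerE inner0l; lra.
Qed.

Lemma partsP A : is_parts A (parts A).
Proof.
have [c [c0 Ac]] := contraction_rescale A.
have [[P N] [pP pN AE PN NP]] := contraction_parts Ac.
have cA : A = c *: (c^-1 *: A) by rewrite scalerA mulfV ?scale1r// gt_eqF.
have scale0 (S T : sa H) : bcomp S T = 0 -> bcomp (c *: S) (c *: T) = 0.
  move=> ST; apply: bopP => x; suff -> : bcomp (c *: S) (c *: T) x = 0 by [].
  by rewrite bcompE !saZE opZ -bcompE ST !scaler0.
have exP : is_parts A (c *: P, c *: N).
  split; [exact: psdZ (ltW c0) pP|exact: psdZ (ltW c0) pN| |exact: scale0..].
  by rewrite {1}cA AE scalerBr.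
rewrite /parts; case: xgetP => [_ _ //|/(_ _ exP)//].
Qed.

Lemma pos_part_psd A : psd (pos_part A).
Proof. by case: (partsP A). Qed.

Lemma neg_part_psd A : psd (neg_part A).
Proof. by case: (partsP A). Qed.

Lemma parts_sub A : pos_part A - neg_part A = A.
Proof. by case: (partsP A). Qed.

End SquareRoot.

(** * Polynomials with vector coefficients *)

Section VectorPolynomial.
Context {R : realType} {d : nat}.
Local Notation T := (borel_space R d).
Local Notation "p @_ m" := (mcoeff m p) (at level 3, m at level 2, format "p @_ m").

Section Coefficients.
Context {V : lmodType R}.
Implicit Types (F G : vpoly d V) (v : V) (a b : multinom d).

Lemma vpoly_ext F G : (forall b, F b = G b) -> F = G.
Proof. by move=> FG; apply/val_inj/funext. Qed.

Lemma vcoef_sum (I : Type) (r : seq I) (G : I -> vpoly d V) b :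
  (\sum_(i <- r) G i) b = \sum_(i <- r) G i b.
Proof. by elim/big_rec2: _ => // i x y _ <-. Qed.

Lemma vmonoE a v b : vmono a v b = if b == a then v else 0.
Proof. by []. Qed.

Lemma finite_vsupp F : finite_set (vsupp F).
Proof. by case: F => f pf; have /asboolP := pf. Qed.

Definition vsupp_seq F : seq (multinom d) := finmap.enum_fset (fset_set (vsupp F)).

Lemma vsupp_seq_uniq F : uniq (vsupp_seq F).
Proof. exact: finmap.fset_uniq. Qed.

Lemma mem_vsupp_seq F a : (a \in vsupp_seq F) = (F a != 0).
Proof.
transitivity (a \in vsupp F); last by apply/idP/idP; rewrite inE.
exact: (in_fset_set (finite_vsupp F) a).
Qed.

Lemma vsupp_seqP F a : F a != 0 -> a \in vsupp_seq F.
Proof. by rewrite mem_vsupp_seq. Qed.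

(** Sums over different supports are compared by extending both to a common
    list. *)
Lemma sum_vsupp (W : nmodType) (phi : multinom d -> V -> W) F (s : seq (multinom d)) :
  (forall a, phi a 0 = 0) -> uniq s -> (forall a, F a != 0 -> a \in s) ->
  \sum_(a \in vsupp F) phi a (F a) = \sum_(a <- s) phi a (F a).
Proof.
move=> phi0 us Fs; rewrite fsbig_finite; last exact: finite_vsupp.
rewrite [RHS](bigID (fun a => F a != 0))/= [X in _ + X]big1 ?addr0; last first.
  by move=> a; rewrite negbK => /eqP ->.
rewrite -[RHS]big_filter; apply: (@perm_big _ _ _ _ (vsupp_seq F)).
apply: uniq_perm; [exact: vsupp_seq_uniq|exact: filter_uniq|move=> a].
by rewrite mem_filter mem_vsupp_seq; have [Fa|//] := boolP (F a != 0); rewrite Fs.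
Qed.

Lemma sum_vsuppE (W : nmodType) (phi : multinom d -> V -> W) F :
  (forall a, phi a 0 = 0) ->
  \sum_(a \in vsupp F) phi a (F a) = \sum_(a <- vsupp_seq F) phi a (F a).
Proof.
by move=> p0; apply: sum_vsupp => //; [exact: vsupp_seq_uniq|exact: vsupp_seqP].
Qed.

Lemma sum_vsupp_mono (W : nmodType) (phi : multinom d -> V -> W) a v :
  (forall a, phi a 0 = 0) ->
  \sum_(b \in vsupp (vmono a v)) phi b (vmono a v b) = phi a v.
Proof.
move=> p0; rewrite (@sum_vsupp _ _ _ [:: a])//.
  by rewrite big_seq1; congr (phi _ _); rewrite vmonoE ifT.
by move=> b; rewrite vmonoE inE; have [//|_] := eqVneq b a; rewrite eqxx.
Qed.

Lemma sum_vmonoE (s : seq (multinom d)) (g : multinom d -> V) b : uniq s ->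
  (\sum_(a <- s) vmono a (g a)) b = if b \in s then g b else 0.
Proof.
move=> us; rewrite vcoef_sum; under eq_bigr do rewrite vmonoE eq_sym.
rewrite -big_mkcond; case: ifPn => bs.
  by rewrite -big_filter filter_pred1_uniq// big_seq1.
by rewrite big_seq_cond big1// => a /andP[as_ /eqP ab]; rewrite -ab as_ in bs.
Qed.

Lemma vpoly_sumE F : F = \sum_(a <- vsupp_seq F) vmono a (F a).
Proof.
apply: vpoly_ext => b; rewrite (sum_vmonoE _ _ (vsupp_seq_uniq F)).
by case: ifPn => // bs; apply/eqP/negPn/negP => /vsupp_seqP; apply/negP.
Qed.

Definition veval (t : T) F : V := \sum_(a \in vsupp F) monomial a t *: F a.

Lemma veval_seq t F (s : seq (multinom d)) : uniq s ->
  (forall a, F a != 0 -> a \in s) -> veval t F = \sum_(a <- s) monomial a t *: F a.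
Proof.
by move=> us Fs; apply: (sum_vsupp (phi := fun a v => monomial a t *: v)) => // a;
  rewrite scaler0.
Qed.

Lemma vevalD t F G : veval t (F + G) = veval t F + veval t G.
Proof.
pose s := undup (vsupp_seq F ++ vsupp_seq G).
have us : uniq s by exact: undup_uniq.
have sF a : F a != 0 -> a \in s.
  by move=> /vsupp_seqP h; rewrite mem_undup mem_cat h.
have sG a : G a != 0 -> a \in s.
  by move=> /vsupp_seqP h; rewrite mem_undup mem_cat h orbT.
rewrite (veval_seq t us sF) (veval_seq t us sG) -big_split /=.
rewrite (@veval_seq t (F + G) s us); first by apply: eq_bigr => a _; rewrite -scalerDr.
move=> a; have [F0|/sF//] := eqVneq (F a) 0; have [G0|/sG//] := eqVneq (G a) 0.
by rewrite [vcoef _ _](_ : _ = F a + G a)// F0 G0 addr0 eqxx.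
Qed.

Lemma veval_mono t a v : veval t (vmono a v) = monomial a t *: v.
Proof.
by apply: (sum_vsupp_mono (phi := fun a v => monomial a t *: v)) => b;
  rewrite scaler0.
Qed.

Lemma veval0 t : veval t 0 = 0.
Proof. by have := vevalD t 0 0; rewrite addr0 => /eqP; rewrite -subr_eq0 opprD addrA subrr sub0r oppr_eq0 => /eqP. Qed.

Lemma veval_sum t (I : Type) (r : seq I) (G : I -> vpoly d V) :
  veval t (\sum_(i <- r) G i) = \sum_(i <- r) veval t (G i).
Proof. exact: (big_morph _ (vevalD t) (veval0 t)). Qed.

Lemma monomialD a b (t : T) : monomial (mnm_add a b) t = monomial a t * monomial b t.
Proof. by rewrite /monomial mpolyXD; exact: rmorphM. Qed.

Lemma pevalE_monomial (q : mpoly d R) (t : T) :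
  peval q t = \sum_(a <- msupp q) q@_a * monomial a t.
Proof.
rewrite {1}(mpolyE q) /peval raddf_sum /=; apply: eq_bigr => a _.
exact: linearZ.
Qed.

Lemma pscaleE (q : mpoly d R) F : pscale q F =
  \sum_(a <- msupp q) \sum_(b <- vsupp_seq F) vmono (mnm_add a b) (q@_a *: F b).
Proof.
apply: eq_bigr => a _.
apply: (sum_vsuppE (phi := fun b v => vmono (mnm_add a b) (q@_a *: v))) => b.
by apply: vpoly_ext => c; rewrite vmonoE scaler0 if_same.
Qed.

Lemma veval_pscale t (q : mpoly d R) F : veval t (pscale q F) = peval q t *: veval t F.
Proof.
rewrite pscaleE veval_sum pevalE_monomial scaler_suml; apply: eq_bigr => a _.
rewrite veval_sum (@veval_seq t F (vsupp_seq F)); last exact: vsupp_seqP.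
  rewrite scaler_sumr; apply: eq_bigr => b _.
  by rewrite veval_mono monomialD !scalerA; congr (_ *: _); ring.
exact: vsupp_seq_uniq.
Qed.

Definition tensor (p : mpoly d R) v : vpoly d V :=
  \sum_(a <- msupp p) vmono a (p@_a *: v).

Lemma tensorE p v b : tensor p v b = p@_b *: v.
Proof.
rewrite /tensor (sum_vmonoE _ _ (msupp_uniq p)).
by case: ifPn => // /memN_msupp_eq0 ->; rewrite scale0r.
Qed.

Lemma tensorDl (c : R) p q v : tensor (c *: p + q) v = c *: tensor p v + tensor q v.
Proof.
apply: vpoly_ext => b; rewrite tensorE mcoeffD mcoeffZ.
rewrite [RHS](_ : _ = c *: tensor p v b + tensor q v b)// !tensorE.
by rewrite scalerDl scalerA.
Qed.

Lemma tensorDr (c : R) p u v : tensor p (c *: u + v) = c *: tensor p u + tensor p v.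
Proof.
apply: vpoly_ext => b; rewrite tensorE.
rewrite [RHS](_ : _ = c *: tensor p u b + tensor p v b)// !tensorE.
by rewrite scalerDr !scalerA mulrC.
Qed.

Lemma tensorX a v : tensor (mpolyX R a) v = vmono a v.
Proof.
apply: vpoly_ext => b; rewrite tensorE vmonoE mcoeffX eq_sym.
by case: eqP; rewrite ?scale1r ?scale0r.
Qed.

End Coefficients.

Lemma vmapE (V W : lmodType R) (f : V -> W) (F : vpoly d V) b : f 0 = 0 ->
  vmap f F b = f (F b).
Proof.
move=> f0; rewrite /vmap.
rewrite (sum_vsuppE (phi := fun a v => vmono a (f v))); last first.
  by move=> a; apply: vpoly_ext => c; rewrite vmonoE f0 if_same.
rewrite (sum_vmonoE _ _ (vsupp_seq_uniq F)); case: ifPn => // bs.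
suff -> : F b = 0 by rewrite f0.
by apply/eqP/negPn/negP => /vsupp_seqP; apply/negP.
Qed.

Section Operators.
Context {H : hilbertType R}.
Implicit Types (A B : vpoly d (bop H H)) (F : vpoly d (sa H)).

Lemma bop_sumE (I : Type) (r : seq I) (B : I -> bop H H) x :
  (\sum_(i <- r) B i) x = \sum_(i <- r) B i x.
Proof. by elim/big_rec2: _ => // i u v _ <-. Qed.

Lemma sa_op_sum (I : Type) (r : seq I) (B : I -> sa H) :
  sa_op (\sum_(i <- r) B i) = \sum_(i <- r) sa_op (B i).
Proof. by elim/big_rec2: _ => // i u v _ <-. Qed.

Lemma inner_suml (I : Type) (r : seq I) (u : I -> H) x :
  '< \sum_(i <- r) u i, x > = \sum_(i <- r) '< u i, x >.
Proof.
by elim/big_rec2: _ => [|i a b _ <-]; [exact: inner0l|exact: innerDl].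
Qed.

Lemma inner_sumr (I : Type) (r : seq I) (u : I -> H) x :
  '< x, \sum_(i <- r) u i > = \sum_(i <- r) '< x, u i >.
Proof. by rewrite innerC inner_suml; apply: eq_bigr => i _; rewrite innerC. Qed.

Lemma adj0 : adj (0 : bop H H) = 0.
Proof.
apply: bopP => y; apply: inner_inj => z; rewrite innerC -adjP.
by rewrite [bop_fun 0 z](_ : _ = 0)// [bop_fun 0 y](_ : _ = 0)// !inner0l.
Qed.

Lemma adj_sa (B : sa H) : adj B = B.
Proof.
by apply: bopP => y; apply: inner_inj => z; rewrite innerC -adjP sa_sym innerC.
Qed.

Lemma of_saE F b : of_sa F b = F b.
Proof. exact: vmapE. Qed.

Lemma optrE A b : optr A b = adj (A b).
Proof. exact/vmapE/adj0. Qed.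

Lemma veval_of_sa t F : veval t (of_sa F) = veval t F.
Proof.
rewrite (@veval_seq _ t F (vsupp_seq F)); [|exact: vsupp_seq_uniq|exact: vsupp_seqP].
rewrite (@veval_seq _ t (of_sa F) (vsupp_seq F)); last 2 first.
- exact: vsupp_seq_uniq.
- move=> a; rewrite of_saE => Fa; apply: vsupp_seqP; apply: contra_neq Fa => ->.
  by [].
by rewrite sa_op_sum; apply: eq_bigr => a _; rewrite of_saE.
Qed.

Lemma opmulE A B : opmul A B = \sum_(a <- vsupp_seq A) \sum_(b <- vsupp_seq B)
  vmono (mnm_add a b) (bcomp (A a) (B b)).
Proof.
have z1 a (S : bop H H) b : vmono (mnm_add a b) (bcomp S 0) = 0 :> vpoly d (bop H H).
  apply: vpoly_ext => c; rewrite vmonoE; case: ifP => // _.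
  by apply: bopP => x; exact: (linear0 S).
have z2 a (S : bop H H) b : vmono (mnm_add a b) (bcomp 0 S) = 0 :> vpoly d (bop H H).
  by apply: vpoly_ext => c; rewrite vmonoE; case: ifP => // _; exact: bopP.
rewrite /opmul (sum_vsuppE (phi := fun a S => \sum_(b \in vsupp B)
  vmono (mnm_add a b) (bcomp S (B b)))); last first.
  move=> a; rewrite (sum_vsuppE (phi := fun b S => vmono (mnm_add a b) (bcomp 0 S))).
    by rewrite big1.
  by move=> b; exact: z1.
apply: eq_bigr => a _.
by rewrite (sum_vsuppE (phi := fun b S => vmono (mnm_add a b) (bcomp (A a) S))).
Qed.

(** Evaluation turns [A^T A] into [A(t)^T A(t)], so that products with a [q] that
    is nonnegative at [t] have a positive value there. *)
Lemma veval_gram t A x :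
  '< veval t (opmul (optr A) A) x, x > = '< veval t A x, veval t A x >.
Proof.
set s := vsupp_seq A; have us : uniq s by exact: vsupp_seq_uniq.
have evA y : veval t A y = \sum_(a <- s) monomial a t *: A a y.
  by rewrite (@veval_seq _ t A s us); [exact: bop_sumE|exact: vsupp_seqP].
have evT y z : '< veval t (optr A) y, z > = '< y, veval t A z >.
  rewrite (@veval_seq _ t (optr A) s us); last first.
    move=> a; rewrite optrE => Aa; apply: vsupp_seqP; apply: contra_neq Aa => ->.
    exact: adj0.
  rewrite bop_sumE inner_suml evA inner_sumr; apply: eq_bigr => a _.
  rewrite [bop_fun _ y](_ : _ = monomial a t *: optr A a y)//.
  by rewrite innerZl innerZr optrE innerC -adjP innerC.
rewrite -evT opmulE veval_sum bop_sumE.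
rewrite (@veval_seq _ t (optr A) (vsupp_seq (optr A))); last 2 first.
- exact: vsupp_seq_uniq.
- exact: vsupp_seqP.
rewrite bop_sumE; congr '< _, _ >; apply: eq_bigr => a _.
rewrite veval_sum bop_sumE [RHS](_ : _ = monomial a t *: optr A a (veval t A x))//.
rewrite evA linear_sum scaler_sumr; apply: eq_bigr => b _.
rewrite veval_mono monomialD linearZ /= scalerA.
by [].
Qed.

Lemma veval_weighted_gram_psd t (q : mpoly d R) A F :
  of_sa F = pscale q (opmul (optr A) A) -> 0 <= peval q t -> psd (veval t F).
Proof.
move=> e q0 x; have := congr1 (veval t) e; rewrite veval_of_sa veval_pscale => ->.
rewrite [bop_fun _ x](_ : _ = peval q t *: veval t (opmul (optr A) A) x)//.
by rewrite innerZl veval_gram mulr_ge0// inner_ge0.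
Qed.

(** A square of a self-adjoint operator is a Gram product of constant
    polynomials; this is how positivity of [L] on [q A^T A] reaches the tensors
    with a positive operator. *)
Lemma tensor_sqr_gram (q : mpoly d R) (B : sa H) :
  of_sa (tensor q (sa_sqr B)) =
  pscale q (opmul (optr (vmono mnm0 (B : bop H H))) (vmono mnm0 (B : bop H H))).
Proof.
set V : vpoly d (bop H H) := vmono mnm0 (sa_op B).
have -> : optr V = V.
  apply: vpoly_ext => b; rewrite optrE !vmonoE; case: ifP => _; first exact: adj_sa.
  exact: adj0.
have z1 (S : bop H H) : bcomp S 0 = 0 by apply: bopP => x; exact: (linear0 S).
have z2 (S : bop H H) : bcomp 0 S = 0 by exact: bopP.
have v0 a : vmono a 0 = 0 :> vpoly d (bop H H).
  by apply: vpoly_ext => c; rewrite vmonoE if_same.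
have -> : opmul V V = vmono mnm0 (bcomp B B).
  rewrite /opmul (sum_vsupp_mono (phi := fun a S => \sum_(b \in vsupp V)
    vmono (mnm_add a b) (bcomp S (V b)))); last first.
    move=> a; rewrite (sum_vsupp_mono (phi := fun b S => vmono (mnm_add a b) (bcomp 0 S))).
      by rewrite z2 v0.
    by move=> b; rewrite z1 v0.
  rewrite (sum_vsupp_mono (phi := fun b S => vmono (mnm_add mnm0 b) (bcomp B S))).
    by rewrite addm0.
  by move=> b; rewrite z1 v0.
apply: vpoly_ext => b; rewrite of_saE tensorE.
have -> : pscale q (vmono mnm0 (bcomp B B)) =
    \sum_(a <- msupp q) vmono a (q@_a *: bcomp B B).
  apply: eq_bigr => a _.
  rewrite (sum_vsupp_mono (phi := fun b S => vmono (mnm_add a b) (q@_a *: S))).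
    by rewrite addm0.
  by move=> c; rewrite scaler0 v0.
by rewrite -/(tensor q (bcomp B B)) tensorE.
Qed.

End Operators.
End VectorPolynomial.

(** * Positivity on the nonnegativity set of an archimedean quadratic module *)

Local Notation "c %:MP" := (mpolyC _ c) (at level 2, format "c %:MP").

Section QuadraticModule.
Context {R : realType} {d : nat}.
Implicit Types (M N Q : set (mpoly d R)) (p q f g : mpoly d R).

(** The multipliers that preserve every quadratic module; they contain the sums
    of squares and share the closure properties that matter. *)
Definition multiplier f : Prop :=
  forall N, quadratic_module N -> forall q, N q -> N (f * q).

Lemma multiplierD f g : multiplier f -> multiplier g -> multiplier (f + g).
Proof.
move=> mf mg N qN q Nq; rewrite mulrDl; have [_ ND _] := qN.
by apply: ND; [exact: mf|exact: mg].
Qed.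

Lemma multiplierM f g : multiplier f -> multiplier g -> multiplier (f * g).
Proof. by move=> mf mg N QN q Nq; rewrite -mulrA; apply: mf => //; exact: mg. Qed.

Lemma multiplier_sqr f : multiplier (f ^+ 2).
Proof. by move=> N [_ _ Nsq] q; exact: Nsq. Qed.

Lemma multiplier1 : multiplier 1.
Proof. by move=> N _ q; rewrite mul1r. Qed.

Lemma multiplier0 : multiplier 0.
Proof. by have := @multiplier_sqr 0; rewrite expr0n. Qed.

Lemma multiplierC (c : R) : 0 <= c -> multiplier c%:MP.
Proof.
by move=> c0; rewrite -(sqr_sqrtr c0) rmorphXn; exact: multiplier_sqr.
Qed.

Lemma qm_multiplier N f : quadratic_module N -> multiplier f -> N f.
Proof. by move=> qN mf; rewrite -(mulr1 f); apply: mf => //; case: qN. Qed.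

Definition qm_adjoin N f : set (mpoly d R) :=
  [set h | exists q s, [/\ N q, multiplier s & h = q + f * s]].

Lemma qm_adjoinP N f : quadratic_module N -> quadratic_module (qm_adjoin N f).
Proof.
move=> [N1 ND Nsq]; split.
- by exists 1, 0; split; [|exact: multiplier0|rewrite mulr0 addr0].
- move=> _ _ [q [s [Nq ms ->]]] [q' [s' [Nq' ms' ->]]].
  by exists (q + q'), (s + s'); split; [exact: ND|exact: multiplierD|ring].
- move=> p _ [q [s [Nq ms ->]]].
  exists (p ^+ 2 * q), (p ^+ 2 * s); split; [exact: Nsq| |ring].
  by apply: multiplierM ms; exact: multiplier_sqr.
Qed.

Lemma qm_adjoin_sub N f : N `<=` qm_adjoin N f.
Proof. by move=> q Nq; exists q, 0; split; [|exact: multiplier0|ring]. Qed.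

Lemma qm_adjoin_mem N f : quadratic_module N -> qm_adjoin N f f.
Proof.
move=> qN; exists 0, 1; split; [|exact: multiplier1|ring].
exact: qm_multiplier multiplier0.
Qed.

(** Zorn's lemma is applied to the sets [N] such that [N `|` M] is a proper
    quadratic module, rather than to the modules that contain [M], so that the
    union of the empty chain is admissible. *)
Lemma maximal_quadratic_module M : quadratic_module M -> ~ M (-1) ->
  exists Q, [/\ quadratic_module Q, M `<=` Q, ~ Q (-1) &
    forall N, quadratic_module N -> Q `<=` N -> ~ N (-1) -> N `<=` Q].
Proof.
move=> qM M1.
pose P N := quadratic_module (N `|` M) /\ ~ (N `|` M) (-1).
have [|Q [[qQ Q1] Qmax]] := @Zorn_bigcup _ P.
  move=> F FP Ftot; split.
    have [M1' MD Msq] := qM; split; first by right.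
    - have UD p q (X : set (mpoly d R)) : F X -> (X `|` M) p -> (X `|` M) q ->
          ((\bigcup_(X in F) X) `|` M) (p + q).
        move=> FX Xp Xq; have [[_ XD _] _] := FP _ FX.
        by case: (XD _ _ Xp Xq) => h; [left; exists X|right].
      move=> p q [[X FX Xp]|Mp] [[Y FY Yq]|Mq]; last by right; exact: MD.
      + have [XY|YX] := Ftot _ _ FX FY.
          by apply: (UD p q Y) => //; left => //; exact: XY.
        by apply: (UD p q X) => //; left => //; exact: YX.
      + by apply: (UD p q X) => //; [left|right].
      + by apply: (UD p q Y) => //; [right|left].
    - move=> p q [[X FX Xq]|Mq]; last by right; exact: Msq.
      have [[_ _ Xsq] _] := FP _ FX.
      by have [] := Xsq p q (or_introl Xq); [left; exists X|right].
  by move=> [[X FX Xm]|//]; have [_] := FP _ FX; apply; left.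
exists (Q `|` M); split => [//|p Mp|//|N qN QN N1]; first by right.
have NM : N `|` M = N.
  by apply/seteqP; split=> p; [case=> // Mp; exact: (QN p (or_intror Mp))|left].
apply: contrapT => NQ; apply: (Qmax N); last by split; rewrite NM.
split; first by move=> p Qp; exact: (QN p (or_introl Qp)).
by move=> NQ'; apply: NQ => p /NQ'; left.
Qed.

Section MaximalModule.
Variable Q : set (mpoly d R).
Hypotheses (qQ : quadratic_module Q) (archQ : archimedean Q) (Q1 : ~ Q (-1)).
Hypothesis Qmax :
  forall N, quadratic_module N -> Q `<=` N -> ~ N (-1) -> N `<=` Q.

Let QD p q : Q p -> Q q -> Q (p + q). Proof. by case: qQ => _ h _; exact: h. Qed.
Let Qm s q : multiplier s -> Q q -> Q (s * q). Proof. by move=> ms; exact: ms. Qed.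
Let QC (c : R) : 0 <= c -> Q c%:MP.
Proof. by move=> c0; apply: (qm_multiplier qQ); exact: multiplierC. Qed.

Lemma maximal_proper_const (c : R) : Q c%:MP -> 0 <= c.
Proof.
move=> Qc; rewrite leNgt; apply/negP => c0; apply: Q1.
have ci : 0 <= - c^-1 by rewrite oppr_ge0 invr_le0 ltW.
have := Qm (multiplierC ci) Qc; rewrite -rmorphM mulNr mulVf ?lt_eqF//.
by rewrite rmorphN1.
Qed.

(** If neither [f] nor [-f] belonged to [Q], then [-1 = s + f u = t - f v] with
    [s, t] in [Q]; multiplying out puts [-v] in [Q], and the [v] with both signs
    in [Q] form an ideal, so that [-1 = t - f v] would belong to [Q]. *)
Lemma maximal_total f : Q f \/ Q (- f).
Proof.
have [Qf|nQf] := pselect (Q f); first by left.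
have [QNf|nQNf] := pselect (Q (- f)); first by right.
exfalso; apply: Q1.
have adj1 h : ~ Q h -> qm_adjoin Q h (-1).
  move=> nQh; apply: contrapT => h1; apply: nQh.
  apply: (Qmax (qm_adjoinP h qQ)) => //; first exact: qm_adjoin_sub.
  exact: qm_adjoin_mem.
have [s [u [Qs mu e1]]] := adj1 _ nQf; have [t [v [Qt mv e2]]] := adj1 _ nQNf.
have QNv : Q (- v).
  rewrite (_ : - v = (v * s + u * t) + u); last first.
    have h1 : - v = v * (s + f * u) by rewrite -e1; ring.
    have h2 : u + u * (t + - f * v) = 0 by rewrite -e2; ring.
    by rewrite h1 -[LHS]addr0 -[X in _ + X = _]h2; ring.
  apply: QD; last exact: qm_multiplier.
  by apply: QD; exact: Qm.
have Qv : Q v by exact: qm_multiplier.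
(* [f = ((f + 1) / 2)^2 - ((f - 1) / 2)^2], hence the ideal property. *)
rewrite e2 (_ : t + _ = t + ((2^-1%:MP * (f - 1)) ^+ 2 * v
   + (2^-1%:MP * (f + 1)) ^+ 2 * (- v))); last first.
  have two : 4 * 2^-1%:MP ^+ 2 = 1 :> mpoly d R.
    by rewrite -mpolyC_nat -rmorphXn -rmorphM /= (_ : 4 * _ = 1) ?rmorph1//; field.
  move: (2^-1%:MP) two => c two; congr (_ + _).
  transitivity (4 * c ^+ 2 * (- f * v)); [by rewrite two mul1r|ring].
by apply: QD Qt _; apply: QD; apply: Qm => //; exact: multiplier_sqr.
Qed.

(** The ordering given by [Q] cuts the constants at the value of [f]. *)
Definition qm_value f : R := sup [set r : R | Q (f - r%:MP)].

Lemma qm_value_has_sup f : has_sup [set r : R | Q (f - r%:MP)].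
Proof.
have [n [Qnp Qnm]] := archQ f; split.
  by exists (- n%:R) => /=; rewrite rmorphN opprK rmorph_nat addrC.
exists n%:R => r /= Qr; rewrite -subr_ge0; apply: maximal_proper_const.
rewrite rmorphB rmorph_nat (_ : _ - _ = (n%:R - f) + (f - r%:MP)); last ring.
exact: QD.
Qed.

Lemma qm_value_spec f (e : R) : 0 < e ->
  Q (f - (qm_value f)%:MP + e%:MP) /\ Q ((qm_value f)%:MP - f + e%:MP).
Proof.
move=> e0; have hs := qm_value_has_sup f; split.
  have [r /= Qr re] := sup_adherent e0 hs.
  rewrite (_ : _ + _ = (f - r%:MP) + (r - (qm_value f - e))%:MP); last first.
    by rewrite !rmorphB /=; ring.
  by apply: QD => //; apply: QC; rewrite subr_ge0 ltW.
have [|] := maximal_total ((qm_value f)%:MP - f + e%:MP) => // h; exfalso.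
have : qm_value f + e <= qm_value f.
  apply: ub_le_sup; first exact: hs.2.
  by rewrite /= rmorphD /= (_ : _ - _ = - ((qm_value f)%:MP - f + e%:MP))//; ring.
by rewrite leNgt ltrDl e0.
Qed.

Lemma qm_value_unique f (c : R) :
  (forall e, 0 < e -> Q (f - c%:MP + e%:MP) /\ Q (c%:MP - f + e%:MP)) ->
  qm_value f = c.
Proof.
move=> fc; have le a b : (forall e, 0 < e -> Q (f - a%:MP + e%:MP)) ->
    (forall e, 0 < e -> Q (b%:MP - f + e%:MP)) -> a <= b.
  move=> fa fb; apply/ler_addgt0Pr => e e0; rewrite -subr_ge0.
  apply: maximal_proper_const.
  have e2 : 0 < e / 2 by rewrite divr_gt0.
  rewrite (_ : _%:MP = (f - a%:MP + (e / 2)%:MP) + (b%:MP - f + (e / 2)%:MP)).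
    exact: QD (fa _ e2) (fb _ e2).
  by rewrite {1}(splitr e) !(rmorphB, rmorphD) /=; ring.
by apply/eqP; rewrite eq_le !le// => e e0;
  [have [] := fc e e0|have [] := qm_value_spec f e0
  |have [] := qm_value_spec f e0|have [] := fc e e0].
Qed.

Lemma qm_value_ge0 f : Q f -> 0 <= qm_value f.
Proof.
move=> Qf; apply: ub_le_sup; first exact: (qm_value_has_sup f).2.
by rewrite /= rmorph0 subr0.
Qed.

Lemma qm_valueD f g : qm_value (f + g) = qm_value f + qm_value g.
Proof.
apply: qm_value_unique => e e0; have e2 : 0 < e / 2 by rewrite divr_gt0.
have [f1 f2] := qm_value_spec f e2; have [g1 g2] := qm_value_spec g e2.
split.
  rewrite (_ : _ + _ = (f - (qm_value f)%:MP + (e / 2)%:MP) +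
    (g - (qm_value g)%:MP + (e / 2)%:MP)); first exact: QD.
  by rewrite {1}(splitr e) !rmorphD /=; ring.
rewrite (_ : _ + _ = ((qm_value f)%:MP - f + (e / 2)%:MP) +
  ((qm_value g)%:MP - g + (e / 2)%:MP)); first exact: QD.
by rewrite {1}(splitr e) !rmorphD /=; ring.
Qed.

Lemma qm_valueC (c : R) : qm_value c%:MP = c.
Proof.
by apply: qm_value_unique => e e0; rewrite subrr add0r; split; exact/QC/ltW.
Qed.

Lemma qm_valueN f : qm_value (- f) = - qm_value f.
Proof.
by apply/eqP; rewrite -addr_eq0 -qm_valueD addNr -(rmorph0 (@mpolyC d R)) qm_valueC.
Qed.

Lemma qm_value_scale (c : R) f : qm_value (c%:MP * f) = c * qm_value f.
Proof.
wlog c0 : c / 0 < c => [h|].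
  have [c0|c0|<-] := ltgtP 0 c; first exact: h.
    by rewrite -[c]opprK rmorphN !mulNr qm_valueN h ?oppr_gt0//; ring.
  by rewrite mpolyC0 !mul0r -(mpolyC0 d R) qm_valueC.
apply: qm_value_unique => e e0; have [] := qm_value_spec f (divr_gt0 e0 c0).
have ec : e%:MP = c%:MP * (e / c)%:MP :> mpoly d R.
  by rewrite -rmorphM /= mulrC divfK ?gt_eqF.
have cm := multiplierC (ltW c0); have cv := rmorphM (@mpolyC d R) c (qm_value f).
move=> /(Qm cm) h1 /(Qm cm) h2; rewrite /= in cv; rewrite cv ec; split.
  by rewrite -mulrBr -mulrDr.
by rewrite -mulrBr -mulrDr.
Qed.

(** The identity [2 e (e^2 - h^2) = (e - h)^2 (e + h) + (e + h)^2 (e - h)] shows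
    that [h^2 <= e^2] in the ordering as soon as [-e <= h <= e]. *)
Lemma qm_value_sqr0 h : qm_value h = 0 -> qm_value (h ^+ 2) = 0.
Proof.
move=> h0; apply: qm_value_unique => e e0; rewrite rmorph0 subr0 sub0r; split.
  apply: QD; first by apply: (qm_multiplier qQ); exact: multiplier_sqr.
  exact/QC/ltW.
have s0 : 0 < Num.sqrt e by rewrite sqrtr_gt0.
have [] := qm_value_spec h s0; rewrite h0 rmorph0 subr0 sub0r => h1 h2.
set s := (Num.sqrt e)%:MP in h1 h2.
have se : s ^+ 2 = e%:MP by rewrite -rmorphXn /= sqr_sqrtr// ltW.
pose c := (2^-1 / Num.sqrt e)%:MP : mpoly d R.
have cs : 2 * (c * s) = 1.
  rewrite -rmorphM /= divfK ?gt_eqF// -mpolyC_nat -rmorphM /= mulfV ?rmorph1//.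
have cm : multiplier c by apply: multiplierC; rewrite divr_ge0 ?ltW// invr_gt0.
rewrite -[_ + _]mul1r -cs -se.
rewrite (_ : _ * _ = c * ((s - h) ^+ 2 * (h + s) + (s + h) ^+ 2 * (- h + s))); last ring.
apply: Qm => //; apply: QD; apply: Qm => //; exact: multiplier_sqr.
Qed.

(** Shift [f] by its value; the cross term has value [0]. *)
Lemma qm_value_sqr f : qm_value (f ^+ 2) = qm_value f ^+ 2.
Proof.
set c := qm_value f; pose h := f - c%:MP.
have h0 : qm_value h = 0 by rewrite qm_valueD qm_valueN qm_valueC subrr.
have -> : f ^+ 2 = h ^+ 2 + (c *+ 2)%:MP * h + (c ^+ 2)%:MP.
  by rewrite /h rmorphXn rmorphMn /=; ring.
by rewrite !qm_valueD qm_value_sqr0// qm_value_scale h0 mulr0 !add0r qm_valueC.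
Qed.

Lemma qm_valueM f g : qm_value (f * g) = qm_value f * qm_value g.
Proof.
have e : (f + g) ^+ 2 = f ^+ 2 + (f * g + f * g) + g ^+ 2 by ring.
have := congr1 qm_value e; rewrite !qm_valueD !qm_value_sqr qm_valueD.
by nra.
Qed.

(** Being multiplicative, the value is the evaluation at a point. *)
Lemma qm_value_point : exists a : borel_space R d,
  nonneg_set Q a /\ forall f, qm_value f = peval f a.
Proof.
pose a : 'rV[R]_d := \row_i qm_value (mpolyX R (mnm1 i)).
have val1 : qm_value 1 = 1 by rewrite -[X in qm_value X](rmorph1 (@mpolyC d R)) qm_valueC.
have valX f n : qm_value (f ^+ n) = qm_value f ^+ n.
  by elim: n => [|n IH]; rewrite ?expr0// !exprS qm_valueM IH.
have val0 : qm_value 0 = 0 by rewrite -(rmorph0 (@mpolyC d R)) qm_valueC.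
have ev f : qm_value f = peval f a.
  rewrite /peval mevalE {1}(mpolyE f) (big_morph _ qm_valueD val0).
  apply: eq_bigr => m _; rewrite -mul_mpolyC qm_value_scale; congr (_ * _).
  rewrite mpolyXE_id (big_morph _ qm_valueM val1); apply: eq_bigr => i _.
  by rewrite valX mxE.
by exists a; split => // f Qf; rewrite -ev; exact: qm_value_ge0.
Qed.

End MaximalModule.

Lemma archimedean_sub M N : M `<=` N -> archimedean M -> archimedean N.
Proof. by move=> MN aM p; have [n [h1 h2]] := aM p; exists n; split; exact: MN. Qed.

(** From [p s = 1 + t] with [s] a multiplier and [t] in [M], membership of
    [p + r] improves to [p + r - 1 / k^2] for a fixed [k], because
    [k^2 (p + r) - 1 = (k - s)^2 (p + r) + 2 k t + r s (2 k - s)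
     + (2 k - 1 - s^2 p)]; finitely many steps reach [p]. *)
Lemma positivstellensatz_descent M p s : quadratic_module M -> archimedean M ->
  multiplier s -> M (p * s - 1) -> M p.
Proof.
move=> qM aM ms Mt; have [_ MD _] := qM.
have MC (c : R) : 0 <= c -> M c%:MP.
  by move=> c0; apply: (qm_multiplier qM); exact: multiplierC.
have [n1 [_ h1]] := aM s; have [n2 [_ h2]] := aM (1 + s ^+ 2 * p).
pose k : R := (n1 + n2).+1%:R.
have k0 : 0 < k by rewrite ltr0n.
have M1 : M ((2 * k)%:MP - s).
  rewrite (_ : _ - _ = (n1%:R - s) + (2 * k - n1%:R)%:MP); last first.
    by rewrite rmorphB rmorph_nat /=; ring.
  apply: MD => //; apply: MC; rewrite subr_ge0.
  apply: (@le_trans _ _ k); last lra.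
  by rewrite ler_nat (leq_trans (leq_addr n2 n1)).
have M2 : M ((2 * k)%:MP - 1 - s ^+ 2 * p).
  rewrite (_ : _ - _ = (n2%:R - (1 + s ^+ 2 * p)) + (2 * k - n2%:R)%:MP); last first.
    by rewrite rmorphB rmorph_nat /=; ring.
  apply: MD => //; apply: MC; rewrite subr_ge0.
  apply: (@le_trans _ _ k); last lra.
  by rewrite ler_nat (leq_trans (leq_addl n1 n2)).
have step (r : R) : 0 <= r -> M (p + r%:MP) -> M (p + (r - k ^- 2)%:MP).
  move=> r0 Mr.
  have -> : p + (r - k ^- 2)%:MP = (k ^- 2)%:MP * (
      (k%:MP - s) ^+ 2 * (p + r%:MP) + (2 * k)%:MP * (p * s - 1)
      + (r%:MP * s) * ((2 * k)%:MP - s) + ((2 * k)%:MP - 1 - s ^+ 2 * p)).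
    have e : (k ^- 2)%:MP * k%:MP ^+ 2 = 1 :> mpoly d R.
      by rewrite -(rmorphXn (@mpolyC d R)) -(rmorphM (@mpolyC d R)) /= mulVf ?rmorph1// expf_neq0// gt_eqF.
    rewrite rmorphB rmorphM rmorph_nat /=.
    transitivity (((k ^- 2)%:MP * k%:MP ^+ 2) * (p + r%:MP) - (k ^- 2)%:MP).
      by rewrite e; ring.
    ring.
  apply: (multiplierC (_ : 0 <= k ^- 2)) => //.
    by rewrite invr_ge0 exprn_ge0// ltW.
  apply: (MD) M2; apply: (MD); first apply: (MD).
  - exact: multiplier_sqr.
  - by apply: multiplierC => //; rewrite mulr_ge0// ltW.
  - by apply: multiplierM M1 => //; exact: multiplierC.
have [n [hn _]] := aM p.
pose K := ((n1 + n2).+1 ^ 2)%N.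
have Kk : K%:R = k ^+ 2 by rewrite /K natrX.
have K0 : 0 < K%:R :> R by rewrite Kk exprn_gt0.
have descend (j : nat) : (j <= n * K)%N -> M (p + ((n * K - j)%:R / K%:R)%:MP).
  elim: j => [_|j IH jn].
    by rewrite subn0 natrM mulfK ?gt_eqF// rmorph_nat addrC.
  have {IH}IH := IH (ltnW jn).
  rewrite (_ : _ / _ = (n * K - j)%:R / K%:R - k ^- 2).
    by apply: step => //; rewrite divr_ge0.
  by rewrite -Kk subnS -subn1 natrB ?subn_gt0// mulrBl mul1r.
by have := descend _ (leqnn _); rewrite subnn mul0r rmorph0 addr0.
Qed.

(** If [p] is not in [M], adjoining [-p] keeps the module proper, and a point
    of a maximal extension is a point of [nonneg_set M] where [p <= 0]. *)
Theorem archimedean_positivstellensatz M p :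
  quadratic_module M -> archimedean M ->
  (forall a, nonneg_set M a -> 0 < peval p a) -> M p.
Proof.
move=> qM aM pos; apply: contrapT => nMp.
have pr : ~ qm_adjoin M (- p) (-1).
  move=> [t [s [Mt ms e]]]; apply: nMp.
  apply: (positivstellensatz_descent qM aM ms).
  by rewrite (_ : _ - 1 = t)// e; ring.
have qA := qm_adjoinP (- p) qM.
have [Q [qQ AQ Q1 Qmax]] := maximal_quadratic_module qA pr.
have MQ : M `<=` Q by apply: subset_trans AQ; exact: qm_adjoin_sub.
have [a [Ka ev]] := qm_value_point qQ (archimedean_sub MQ aM) Q1 Qmax.
have : 0 < peval p a by apply: pos => q Mq; apply: Ka; exact: MQ.
have : 0 <= peval (- p) a by apply: Ka; apply: AQ; exact: qm_adjoin_mem.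
by rewrite /peval rmorphN oppr_ge0 leNgt => /negP.
Qed.

(** For every [r > 0] the polynomial [p + r] is in [M], and [l r] can be made
    small. *)
Corollary positive_functional_ge0 M (l : mpoly d R -> R) p :
  quadratic_module M -> archimedean M ->
  scalar l -> (forall q, M q -> 0 <= l q) ->
  (forall a, nonneg_set M a -> 0 <= peval p a) -> 0 <= l p.
Proof.
move=> qM aM ll lM pK; apply/ler_addgt0Pr => e e0.
have l0 : 0 <= l 1 by apply: lM; case: qM.
have M1 : M (p + (e / (l 1 + 1))%:MP).
  apply: archimedean_positivstellensatz => // a Ka.
  rewrite /peval rmorphD /= mevalC ltr_wpDl ?divr_gt0//; first exact: pK.
  by rewrite ltr_wpDl.
have := lM _ M1; rewrite addrC -[X in X + _]mulr1 mul_mpolyC ll.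
have : e / (l 1 + 1) * l 1 <= e.
  by rewrite mulrAC ler_pdivrMr ?ltr_wpDl// ler_pM2l// lerDl.
lra.
Qed.

End QuadraticModule.

(** * Uniform limits of polynomials on a compact set *)

Local Notation "p @_ m" := (mcoeff m p) (at level 3, m at level 2, format "p @_ m").

Section Approximation.
Context {R : realType} {d : nat}.
Local Notation T := (borel_space R d).
Implicit Types (p q : mpoly d R) (f g h : T -> R) (a : T).

Lemma pevalD p q a : peval (p + q) a = peval p a + peval q a.
Proof. exact: rmorphD. Qed.
Lemma pevalB p q a : peval (p - q) a = peval p a - peval q a.
Proof. exact: rmorphB. Qed.
Lemma pevalM p q a : peval (p * q) a = peval p a * peval q a.
Proof. exact: rmorphM. Qed.
Lemma pevalZ (c : R) p a : peval (c *: p) a = c * peval p a.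
Proof. exact: linearZ. Qed.
Lemma peval1 a : peval 1 a = 1.
Proof. exact: rmorph1. Qed.
Lemma peval0 a : peval (0 : mpoly d R) a = 0.
Proof. exact: rmorph0. Qed.

Definition pevalE := (pevalB, pevalD, pevalM, pevalZ, peval1, peval0).

Lemma peval_continuous p : continuous (fun a : 'rV[R]_d => peval p a).
Proof.
pose P q := continuous (fun a : 'rV[R]_d => peval q a).
have PM p1 p2 : P p1 -> P p2 -> P (p1 * p2).
  move=> c1 c2 a; rewrite /continuous_at pevalM.
  under eq_fun do rewrite pevalM; exact: cvgM (c1 a) (c2 a).
have Pc (q : mpoly d R) (c : R) : (forall a : T, peval q a = c) -> P q.
  move=> qc; have e : (fun a : 'rV[R]_d => peval q a) = fun=> c.
    by apply/funext => b; exact: qc.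
  by rewrite /P e; exact: cst_continuous.
have P1 : P 1 by apply: (Pc _ 1) => a; exact: peval1.
have PX i : P (mpolyX R (mnm1 i)).
  move=> a; rewrite /continuous_at /peval mevalXU.
  by under eq_fun do rewrite mevalXU; exact: coord_continuous.
change (P p); rewrite (mpolyE p); elim/big_ind: _ => [|p1 p2 c1 c2|m _].
- by apply: (Pc _ 0) => a; exact: peval0.
- move=> a; rewrite /continuous_at pevalD.
  under eq_fun do rewrite pevalD; exact: cvgD (c1 a) (c2 a).
- have PXm : P (mpolyX R m).
    rewrite mpolyXE_id; elim/big_ind: _ => // i _.
    by elim: (m i) => [|n IH]; rewrite ?expr0// exprS; exact: PM.
  rewrite -mul_mpolyC; apply: PM => //.
  by apply: (Pc _ p@_m) => a; exact: mevalC.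
Qed.

Lemma open_measurable_borel (U : set T) : open (U : set 'rV[R]_d) -> measurable U.
Proof. by move=> oU; apply: sub_sigma_algebra. Qed.

Lemma closed_measurable_borel (U : set T) :
  closed (U : set 'rV[R]_d) -> measurable U.
Proof.
move=> cU; rewrite -(setCK U); apply: measurableC.
by apply: open_measurable_borel; exact: closed_openC.
Qed.

Lemma peval_measurable p : measurable_fun setT (fun a : T => peval p a).
Proof.
apply: (measurability _ (RGenOpens.measurableE R)).
move=> _ [_ [x [y ->]] <-]; rewrite setTI; apply: open_measurable_borel.
by have /continuousP := @peval_continuous p; apply; exact: interval_open.
Qed.

Variable X : set T.
Hypothesis cX : compact (X : set 'rV[R]_d).

Lemma compact_measurable_borel : measurable X.
Proof.
apply: closed_measurable_borel; apply: compact_closed cX.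
exact: norm_hausdorff.
Qed.

Lemma peval_bounded p : exists C, 0 < C /\ forall a, X a -> `|peval p a| <= C.
Proof.
have : compact ((fun a : 'rV[R]_d => peval p a) @` X).
  apply: continuous_compact cX; apply: continuous_subspaceT; exact: peval_continuous.
move=> /compact_bounded[B [_ Bp]].
have B1 : B < `|B| + 1 by rewrite (le_lt_trans (ler_norm _))// ltrDl.
exists (`|B| + 1); split=> [|a Xa]; first by rewrite ltr_wpDl.
by apply: (Bp _ B1); exists a.
Qed.

(** The uniform limits of polynomials form an algebra that is closed under
    maxima and minima, which is what the construction of the outer measure
    below takes from the space of continuous functions. *)
Definition uapprox f := forall e : R, 0 < e ->
  exists p, forall a, X a -> `|f a - peval p a| <= e.

Lemma uapprox_peval p : uapprox (peval p).
Proof. by move=> e e0; exists p => a _; rewrite subrr normr0 ltW. Qed.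

Lemma uapprox_ext f g : (forall a, X a -> f a = g a) -> uapprox f -> uapprox g.
Proof.
move=> fg uf e e0; have [p pP] := uf e e0.
by exists p => a Xa; rewrite -fg// pP.
Qed.

Lemma uapprox_cst (c : R) : uapprox (fun=> c).
Proof.
apply: uapprox_ext (uapprox_peval (c *: 1)) => a _.
by rewrite !pevalE mulr1.
Qed.

Lemma uapproxD f g : uapprox f -> uapprox g -> uapprox (fun a => f a + g a).
Proof.
move=> uf ug e e0; have e2 : 0 < e / 2 by rewrite divr_gt0.
have [p pP] := uf _ e2; have [q qP] := ug _ e2; exists (p + q) => a Xa.
rewrite pevalD opprD addrACA (le_trans (ler_normD _ _))// [leRHS]splitr.
by rewrite lerD ?pP ?qP.
Qed.

Lemma uapprox_bounded f : uapprox f ->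
  exists C, 0 < C /\ forall a, X a -> `|f a| <= C.
Proof.
move=> uf; have [p pP] := uf 1 ltr01; have [C [C0 CP]] := peval_bounded p.
exists (1 + C); split=> [|a Xa]; first by rewrite addr_gt0.
rewrite -[f a](subrK (peval p a)) (le_trans (ler_normD _ _))//.
by rewrite lerD ?pP ?CP.
Qed.

Lemma uapproxM f g : uapprox f -> uapprox g -> uapprox (fun a => f a * g a).
Proof.
move=> uf ug e e0; have [C [C0 CP]] := uapprox_bounded uf.
have d0 : 0 < e / (2 * C) by rewrite divr_gt0// mulr_gt0.
have [q qP] := ug _ d0; have [D [D0 DP]] := peval_bounded q.
have d1 : 0 < e / (2 * D) by rewrite divr_gt0// mulr_gt0.
have [p pP] := uf _ d1; exists (p * q) => a Xa; rewrite pevalM.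
rewrite (_ : _ - _ = f a * (g a - peval q a) + (f a - peval p a) * peval q a); last ring.
rewrite (le_trans (ler_normD _ _))// !normrM.
have -> : e = C * (e / (2 * C)) + (e / (2 * D)) * D.
  by field; rewrite !gt_eqF.
by rewrite lerD// ler_pM// ?CP ?qP ?pP ?DP.
Qed.

Lemma uapproxZ (c : R) f : uapprox f -> uapprox (fun a => c * f a).
Proof. by move=> uf; apply: uapproxM => //; exact: uapprox_cst. Qed.

Lemma uapproxN f : uapprox f -> uapprox (fun a => - f a).
Proof.
move=> /(uapproxZ (-1)); apply: uapprox_ext => a _; exact: mulN1r.
Qed.

Lemma uapproxB f g : uapprox f -> uapprox g -> uapprox (fun a => f a - g a).
Proof. by move=> uf /uapproxN; exact: uapproxD. Qed.

Lemma uapprox_sum n (g : nat -> T -> R) : (forall i, uapprox (g i)) ->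
  uapprox (fun a => \sum_(i < n) g i a).
Proof.
move=> ug; elim: n => [|n IH].
  by apply: uapprox_ext (uapprox_cst 0) => a _; rewrite big_ord0.
by apply: uapprox_ext (uapproxD IH (ug n)) => a _; rewrite big_ord_recr.
Qed.

Fixpoint abs_iter q n : mpoly d R :=
  if n is m.+1 then 2^-1 *: ((1 - q * q) + abs_iter q m * abs_iter q m) else 0.

(** This is the square root iteration at the value [q^2], so that [1 - abs_iter]
    converges to [|q|]; the error bound does not depend on the point. *)
Lemma abs_iterP q a n : `|peval q a| <= 1 ->
  0 <= peval (abs_iter q n) a <= sqrt_bound n /\
  0 <= (1 - `|peval q a|) - peval (abs_iter q n) a <= 1 - sqrt_bound n.
Proof.
move=> q1; have q0 := normr_ge0 (peval q a).
have qq : peval q a * peval q a = `|peval q a| * `|peval q a|.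
  by rewrite -normrM ger0_norm// -expr2 sqr_ge0.
elim: n => [|n [/andP[h1 h2] /andP[h3 h4]]].
  by rewrite /= peval0 !subr0 lexx; split=> //; apply/andP; lra.
have /andP[y0 y1] := @sqrt_bound_itv R n.
rewrite /= !pevalE qq; split; apply/andP; split; nra.
Qed.

Lemma uapprox_abs f : uapprox f -> uapprox (fun a => `|f a|).
Proof.
move=> uf e e0; have e2 : 0 < e / 2 by rewrite divr_gt0.
have [p pP] := uf _ e2; have [C [C0 CP]] := peval_bounded p.
have eC : 0 < e / (2 * C) by rewrite divr_gt0// mulr_gt0.
have [n nP] : exists n, 1 - sqrt_bound n <= e / (2 * C) :> R.
  have := cvgr_le 0 (@sqrt_bound_cvg R) _ eC => -[n _ /(_ n (leqnn n))].
  by exists n.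
pose q := C^-1 *: p.
exists (C *: (1 - abs_iter q n)) => a Xa.
have pq : peval p a = C * peval q a by rewrite pevalZ mulrA mulfV ?mul1r ?gt_eqF.
have q1 : `|peval q a| <= 1.
  by rewrite pevalZ normrM normfV (gtr0_norm C0) mulrC ler_pdivrMr// mul1r CP.
have [_ /andP[h1 h2]] := abs_iterP n q1.
have h3 : `| `|peval p a| - peval (C *: (1 - abs_iter q n)) a| <= e / 2.
  rewrite pevalZ pevalB peval1 pq normrM gtr0_norm// -mulrBr normrM gtr0_norm//.
  rewrite (_ : e / 2 = C * (e / (2 * C))); last by field; rewrite gt_eqF.
  rewrite ler_pM2l// ler_norml; apply/andP; lra.
have h4 : `| `|f a| - `|peval p a| | <= e / 2.
  by rewrite (le_trans (ler_dist_dist _ _))// pP.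
rewrite -(subrKA `|peval p a|) (le_trans (ler_normD _ _))// [leRHS]splitr.
exact: lerD.
Qed.

Lemma uapprox_max f g : uapprox f -> uapprox g ->
  uapprox (fun a => Num.max (f a) (g a)).
Proof.
move=> uf ug; have h := uapproxZ 2^-1
  (uapproxD (uapproxD uf ug) (uapprox_abs (uapproxB uf ug))).
by apply: uapprox_ext h => a _; rewrite maxr_absE mulrC.
Qed.

Lemma uapprox_min f g : uapprox f -> uapprox g ->
  uapprox (fun a => Num.min (f a) (g a)).
Proof.
move=> uf ug; have h := uapproxZ 2^-1
  (uapproxB (uapproxD uf ug) (uapprox_abs (uapproxB uf ug))).
by apply: uapprox_ext h => a _; rewrite minr_absE mulrC.
Qed.

End Approximation.

(** * The measure of a positive functional on polynomials *)

Section PositiveFunctional.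
Context {R : realType} {d : nat}.
Local Notation T := (borel_space R d).
Implicit Types (p q : mpoly d R) (f g h : T -> R) (a : T) (S : set T).

Variable X : set T.

(** The upper extension of a functional on polynomials; it is only meaningful
    on uniform limits of polynomials. *)
Definition extend (l : mpoly d R -> R) f : R :=
  inf [set l p | p in [set p | forall a, X a -> f a <= peval p a]].

(** [c] is the cost of covering [S] from above, by functions that increase to at
    least [1] on [S]. *)
Definition covers (l : mpoly d R -> R) S (c : R) : Prop :=
  exists g : nat -> T -> R, [/\ forall n, uapprox X (g n),
    forall n a, X a -> 0 <= g n a,
    forall n a, X a -> g n a <= g n.+1 a,
    forall n, extend l (g n) <= c &
    forall a, X a -> S a -> exists n, 1 <= g n a].

Definition moment_outer (l : mpoly d R -> R) S : R := inf [set c | covers l S c].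

Hypothesis cX : compact (X : set 'rV[R]_d).
Variable l : mpoly d R -> R.
Hypothesis ll : scalar l.
Hypothesis lpos : forall p, (forall a, X a -> 0 <= peval p a) -> 0 <= l p.

Local Notation I := (extend l).
Local Notation mu := (moment_outer l).

Let lD p q : l (p + q) = l p + l q.
Proof. by have := ll 1 p q; rewrite scale1r mul1r. Qed.
Let l0 : l 0 = 0. Proof. by have := lD 0 0; rewrite addr0; lra. Qed.
Let lZ (c : R) p : l (c *: p) = c * l p.
Proof. by have := ll c p 0; rewrite !addr0 l0 addr0. Qed.
Let lB p q : l (p - q) = l p - l q.
Proof. by rewrite lD -scaleN1r lZ mulN1r. Qed.
Let l1 : 0 <= l 1. Proof. by apply: lpos => a _; rewrite peval1. Qed.

Let lle p q (e : R) : (forall a, X a -> peval p a <= peval q a + e) ->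
  l p <= l q + e * l 1.
Proof.
move=> pq; rewrite -subr_ge0 addrAC -lB -lZ -lD; apply: lpos => a Xa.
by rewrite !pevalE mulr1; have := pq a Xa; lra.
Qed.

Lemma extend_spec f p (e : R) : (forall a, X a -> `|f a - peval p a| <= e) ->
  `|I f - l p| <= e * l 1.
Proof.
move=> fp; have fp' a (Xa : X a) : peval p a - e <= f a <= peval p a + e.
  by have := fp a Xa; rewrite ler_norml => /andP[h1 h2]; apply/andP; lra.
set A := [set l q | q in [set q | forall a, X a -> f a <= peval q a]].
have Ap : A (l p + e * l 1).
  exists (p + e *: 1); last by rewrite lD lZ.
  by move=> a Xa; rewrite !pevalE mulr1; have /andP[] := fp' a Xa.
have lb : lbound A (l p - e * l 1).
  move=> _ [q /= fq <-]; rewrite lerBlDr; apply: lle => a Xa.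
  by have := fq a Xa; have /andP[] := fp' a Xa; lra.
have hA : has_inf A by split; [exists (l p + e * l 1)|exists (l p - e * l 1)].
rewrite ler_norml; apply/andP; split.
  by have := lb_le_inf hA.1 lb; rewrite -/A; lra.
by have := ge_inf hA.2 Ap; lra.
Qed.

Lemma extend_eq f (c D : R) : uapprox X f ->
  (forall e p, 0 < e -> (forall a, X a -> `|f a - peval p a| <= e) ->
     `|c - l p| <= D * e) -> I f = c.
Proof.
move=> uf fc; apply/eqP; rewrite -subr_eq0 -normr_le0; apply/ler_addgt0Pr => e e0.
pose E := D + l 1; pose e' := e / (`|E| + 1).
have E1 : 0 < `|E| + 1 by rewrite ltr_wpDl.
have e'0 : 0 < e' by rewrite divr_gt0.
have [p pP] := uf _ e'0; have h1 := extend_spec pP; have h2 := fc _ _ e'0 pP.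
rewrite add0r -(subrKA (l p)) (le_trans (ler_normD _ _))// [X in _ + X]distrC.
apply: (@le_trans _ _ (E * e')); first by rewrite /E; lra.
rewrite /e' mulrA ler_pdivrMr// mulrC ler_pM2l//.
by rewrite (le_trans (ler_norm _))// lerDl.
Qed.

Lemma extend_peval p : I (peval p) = l p.
Proof.
apply: (@extend_eq _ _ (l 1)) (uapprox_peval X p) _ => e q e0 pq.
rewrite ler_norml; apply/andP; split.
  suff : l q <= l p + e * l 1 by lra.
  by apply: lle => a Xa; have := pq a Xa; rewrite ler_norml => /andP[]; lra.
suff : l p <= l q + e * l 1 by lra.
by apply: lle => a Xa; have := pq a Xa; rewrite ler_norml => /andP[]; lra.
Qed.

Lemma extend_mono f g : uapprox X f -> uapprox X g ->
  (forall a, X a -> f a <= g a) -> I f <= I g.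
Proof.
move=> uf ug fg; apply/ler_addgt0Pr => e e0.
pose e' := e / (4 * (l 1 + 1)).
have L1 : 0 < 4 * (l 1 + 1) by rewrite mulr_gt0// ltr_wpDl.
have e'0 : 0 < e' by rewrite divr_gt0.
have [p pP] := uf _ e'0; have [q qP] := ug _ e'0.
have := extend_spec pP; have := extend_spec qP; rewrite !ler_norml.
move=> /andP[h1 _] /andP[_ h2].
have h3 : l p <= l q + (2 * e') * l 1.
  apply: lle => a Xa; have := fg a Xa; have := pP a Xa; have := qP a Xa.
  by rewrite !ler_norml => /andP[? ?] /andP[? ?]; lra.
have e'E : e' * (4 * (l 1 + 1)) = e by rewrite divfK// gt_eqF.
lra.
Qed.

Lemma extend_ext f g : uapprox X f -> (forall a, X a -> f a = g a) -> I f = I g.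
Proof.
move=> uf fg; have ug := uapprox_ext fg uf.
by apply/eqP; rewrite eq_le !extend_mono// => a Xa; rewrite fg.
Qed.

Lemma extend_cst (c : R) : I (fun=> c) = c * l 1.
Proof.
rewrite -lZ -extend_peval; apply: extend_ext; first exact: uapprox_cst.
by move=> a _; rewrite !pevalE mulr1.
Qed.

Lemma extendD f g : uapprox X f -> uapprox X g ->
  I (fun a => f a + g a) = I f + I g.
Proof.
move=> uf ug; apply: (@extend_eq _ _ (3 * l 1)) (uapproxD uf ug) _ => e p e0 pP.
have [q qP] := ug e e0; have := extend_spec qP.
have fq a : X a -> `|f a - peval (p - q) a| <= 2 * e.
  move=> Xa; have := pP a Xa; have := qP a Xa; rewrite pevalB.
  by rewrite !ler_norml => /andP[? ?] /andP[? ?]; apply/andP; lra.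
have := extend_spec fq; rewrite lB !ler_norml => /andP[? ?] /andP[? ?].
by apply/andP; lra.
Qed.

Lemma extendZ (c : R) f : uapprox X f -> I (fun a => c * f a) = c * I f.
Proof.
move=> uf; apply: (@extend_eq _ _ ((1 + 2 * `|c|) * l 1)) (uapproxZ cX c uf) _.
move=> e p e0 pP; have [q qP] := uf e e0; have h1 := extend_spec qP.
have h2 : `|l (c *: q) - l p| <= (e + `|c| * e) * l 1.
  have pq a : X a -> `|peval (c *: q) a - peval p a| <= e + `|c| * e.
    move=> Xa; have := pP a Xa; have := qP a Xa; rewrite pevalZ => h3 h4.
    rewrite -(subrKA (c * f a)) (le_trans (ler_normD _ _))// addrC lerD//.
    by rewrite -mulrBr normrM distrC ler_wpM2l.
  by have := extend_spec pq; rewrite extend_peval.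
rewrite lZ in h2; rewrite -(subrKA (c * l q)) (le_trans (ler_normD _ _))//.
rewrite -mulrBr normrM.
have := ler_wpM2l (normr_ge0 c) h1; lra.
Qed.

Lemma extendB f g : uapprox X f -> uapprox X g ->
  I (fun a => f a - g a) = I f - I g.
Proof.
move=> uf ug; have := extendD (uapproxB cX uf ug) ug.
rewrite (@extend_ext (fun a => f a - g a + g a) f); first lra.
  exact: uapproxD (uapproxB cX uf ug) ug.
by move=> a _; rewrite subrK.
Qed.

Lemma extend_ge0 f : uapprox X f -> (forall a, X a -> 0 <= f a) -> 0 <= I f.
Proof.
move=> uf f0; rewrite -(mul0r (l 1)) -extend_cst.
by apply: extend_mono => //; exact: uapprox_cst.
Qed.

Lemma extend_sum n (g : nat -> T -> R) : (forall i, uapprox X (g i)) ->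
  I (fun a => \sum_(i < n) g i a) = \sum_(i < n) I (g i).
Proof.
move=> ug; elim: n => [|n IH].
  rewrite big_ord0 -[RHS](mul0r (l 1)) -extend_cst; apply: extend_ext.
    exact: (uapprox_sum 0 ug).
  by move=> a _; rewrite big_ord0.
rewrite big_ord_recr /= -IH -extendD//; last exact: (uapprox_sum n ug).
apply: extend_ext; first exact: (uapprox_sum n.+1 ug).
by move=> a _; rewrite big_ord_recr.
Qed.

Lemma covers_ge0 S c : covers l S c -> 0 <= c.
Proof.
move=> [g [ug g0 _ gc _]]; apply: le_trans (gc 0%N).
by apply: extend_ge0; [exact: ug|exact: g0].
Qed.

Lemma covers_total S : covers l S (l 1).
Proof.
exists (fun _ _ => 1); split=> // n; first exact: uapprox_cst.
by rewrite extend_cst mul1r.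
Qed.

Lemma covers_has_inf S : has_inf [set c | covers l S c].
Proof.
by split; [exists (l 1); exact: covers_total|exists 0 => c; exact: covers_ge0].
Qed.

Lemma moment_outer_le S c : covers l S c -> mu S <= c.
Proof. by move=> Sc; apply: ge_inf Sc; exact: (covers_has_inf S).2. Qed.

Lemma moment_outer_ge S c : (forall c', covers l S c' -> c <= c') -> c <= mu S.
Proof. by move=> Sc; apply: lb_le_inf => //; exact: (covers_has_inf S).1. Qed.

Lemma covers_near S (e : R) : 0 < e -> exists2 c, covers l S c & c < mu S + e.
Proof. by move=> e0; have [c] := inf_adherent e0 (covers_has_inf S); exists c. Qed.

Lemma moment_outer_ge0 S : 0 <= mu S.
Proof. by apply: moment_outer_ge => c; exact: covers_ge0. Qed.

Lemma covers_mono S1 S2 c1 c2 : S1 `<=` S2 -> c2 <= c1 ->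
  covers l S2 c2 -> covers l S1 c1.
Proof.
move=> S12 c21 [g [ug g0 gi gc gS]]; exists g; split=> // [n|a Xa /S12].
  exact: le_trans (gc n) c21.
exact: gS.
Qed.

Lemma increasing_le (g : nat -> T -> R) a n m :
  (forall n, g n a <= g n.+1 a) -> (n <= m)%N -> g n a <= g m a.
Proof.
by move=> gi nm; move/nondecreasing_seqP : gi => /(_ _ _ nm).
Qed.

(** By compactness, an increasing sequence that dominates [h] pointwise in the
    limit dominates it uniformly up to any [e], at some finite stage. *)
Lemma dini_cover S h c : uapprox X h ->
  (forall a, X a -> S a -> h a <= 1) -> (forall a, X a -> ~ S a -> h a <= 0) ->
  covers l S c -> I h <= c.
Proof.
move=> uh hS hN [g [ug g0 gi gc gS]]; apply/ler_addgt0Pr => e e0.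
pose e' := e / (5 * (l 1 + 1)).
have L1 : 0 < 5 * (l 1 + 1) by rewrite mulr_gt0// ltr_wpDl.
have e'0 : 0 < e' by rewrite divr_gt0.
have [r rP] := uh _ e'0; have /choice[p pP] n := ug n _ e'0.
pose O n := [set a : 'rV[R]_d | - (3 * e') < peval (p n - r) a].
have oO n : open (O n).
  apply: (@open_comp _ _ (fun a : 'rV[R]_d => peval (p n - r) a)
    [set y | - (3 * e') < y]); last exact: open_gt.
  by move=> a _; exact: peval_continuous.
have XO : X `<=` \bigcup_n O n.
  move=> a Xa; have [n gn] : exists n, h a <= g n a.
    have [Sa|nSa] := pselect (S a).
      by have [n gn] := gS a Xa Sa; exists n; rewrite (le_trans (hS a Xa Sa)).
    by exists 0; rewrite (le_trans (hN a Xa nSa))// g0.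
  exists n => //; rewrite /O /= pevalB.
  have := rP a Xa; have := pP n a Xa; rewrite !ler_norml => /andP[? ?] /andP[? ?].
  by lra.
(* At a point of [O n], [h] exceeds [g n] by at most [5 e']: the condition gives
   [3 e'], and each of the two approximations [e']. *)
have := cX; rewrite compact_cover => /(_ _ _ _ (fun n _ => oO n) XO)[D _ XD].
pose N := (\max_(i <- finmap.enum_fset D) i)%N.
have hg a : X a -> h a <= g N a + 5 * e'.
  move=> Xa; have [n /= nD] := XD a Xa; rewrite /O /= pevalB => On.
  have nN : (n <= N)%N by exact: leq_bigmax_seq.
  have := increasing_le (gi ^~ a ^~ Xa) nN.
  have := rP a Xa; have := pP n a Xa; rewrite !ler_norml => /andP[? ?] /andP[? ?].
  by lra.
have u5 := uapproxD (ug N) (uapprox_cst X (5 * e')).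
have := extend_mono uh u5 hg; rewrite extendD//; last exact: uapprox_cst.
rewrite extend_cst; have := gc N.
have e'E : e' * (5 * (l 1 + 1)) = e by rewrite divfK// gt_eqF.
lra.
Qed.

(** The sums of the first [n] terms of the first [n] covers increase with [n], so
    that countably many covers are merged into one sequence. *)
Lemma covers_bigcup (F : nat -> set T) (c : nat -> R) (C : R) :
  (forall i, covers l (F i) (c i)) -> (forall n, \sum_(i < n) c i <= C) ->
  covers l (\bigcup_i F i) C.
Proof.
move=> /choice[g gP] cC.
have g0 i n a : X a -> 0 <= g i n a by have [_ h _ _ _] := gP i; exact: h.
have ug i n : uapprox X (g i n) by have [h _ _ _ _] := gP i; exact: h.
exists (fun n a => \sum_(i < n) g i n a); split.
- by move=> n; apply: (@uapprox_sum _ _ _ _ (fun i => g i n)).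
- by move=> n a Xa; apply: sumr_ge0 => i _; exact: g0.
- move=> n a Xa; rewrite big_ord_recr /=; apply: (@le_trans _ _ (\sum_(i < n) g i n.+1 a)).
    by apply: ler_sum => i _; have [_ _ h _ _] := gP i; exact: h.
  by rewrite lerDl g0.
- move=> n; rewrite (@extend_sum n (fun i => g i n))//; apply: le_trans (cC n).
  by apply: ler_sum => i _; have [_ _ _ h _] := gP i; exact: h.
- move=> a Xa [i _ Fa]; have [_ _ gi _ /(_ a Xa Fa)[n gn]] := gP i.
  exists (maxn i.+1 n).
  have iN : (i < maxn i.+1 n)%N by rewrite leq_max leqnn.
  rewrite (bigD1 (Ordinal iN))//= -[1]addr0 lerD//.
    apply: le_trans gn _; apply: increasing_le; last by rewrite leq_maxr.
    by move=> m; exact: gi.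
  by apply: sumr_ge0 => j _; exact: g0.
Qed.

Definition moment_outer_e S : \bar R := (mu S)%:E.

Lemma moment_outer_e0 : moment_outer_e set0 = 0%E.
Proof.
congr EFin; apply/eqP; rewrite eq_le moment_outer_ge0 andbT.
apply: moment_outer_le; exists (fun _ _ => 0); split=> // n.
  exact: uapprox_cst.
by rewrite extend_cst mul0r.
Qed.

Lemma moment_outer_e_ge0 S : (0 <= moment_outer_e S)%E.
Proof. by rewrite lee_fin moment_outer_ge0. Qed.

Lemma le_moment_outer_e : {homo moment_outer_e : A B / A `<=` B >-> (A <= B)%E}.
Proof.
move=> A B AB; rewrite lee_fin; apply: moment_outer_ge => c Bc.
by apply: moment_outer_le; exact: covers_mono AB _ Bc.
Qed.

Lemma moment_outer_e_sigma_subadditive : sigma_subadditive moment_outer_e.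
Proof.
move=> F; apply/lee_addgt0Pr => e e0.
have h0 i : (0 <= moment_outer_e (F i))%E by exact: moment_outer_e_ge0.
apply: le_trans (epsilon_trick xpredT h0 (ltW e0)).
have /choice[c cP] i : exists c, covers l (F i) c /\ c <= mu (F i) + e / (2 ^ i.+1)%:R.
  have ei : 0 < e / (2 ^ i.+1)%:R by rewrite divr_gt0// ltr0n expn_gt0.
  by have [c Fc /ltW cm] := covers_near (F i) ei; exists c.
apply: (@le_trans _ _ (\sum_(0 <= i <oo) (c i)%:E)%E); last first.
  apply: lee_nneseries => [i _ _|i _].
    by rewrite lee_fin; exact: covers_ge0 (cP i).1.
  by rewrite -EFinD lee_fin; exact: (cP i).2.
have c0 i : 0 <= c i by exact: covers_ge0 (cP i).1.
have part n : ((\sum_(i < n) c i)%:E <= \sum_(0 <= i <oo) (c i)%:E)%E.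
  rewrite -sumEFin -(big_mkord xpredT (fun i => (c i)%:E)).
  by apply: nneseries_lim_ge => i _; rewrite lee_fin.
move: part; case: (\sum_(0 <= i <oo) (c i)%:E)%E => [r|_|/(_ 0)//]; last by rewrite leey.
move=> part; rewrite lee_fin; apply: moment_outer_le.
apply: (covers_bigcup (fun i => (cP i).1)) => n; by have := part n; rewrite lee_fin.
Qed.

HB.instance Definition _ := isOuterMeasure.Build R T moment_outer_e
  moment_outer_e0 moment_outer_e_ge0 le_moment_outer_e
  moment_outer_e_sigma_subadditive.

Definition moment_outer_measure : {outer_measure set T -> \bar R} :=
  moment_outer_e.

Definition ramp f (c : R) (k : nat) a := Num.min 1 (k%:R * Num.max (f a - c) 0).

Lemma uapprox_ramp f c k : uapprox X f -> uapprox X (ramp f c k).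
Proof.
move=> uf; apply: (uapprox_min cX); first exact: uapprox_cst.
apply: (uapproxZ cX); apply: (uapprox_max cX); last exact: uapprox_cst.
by apply: (uapproxB cX) => //; exact: uapprox_cst.
Qed.

Lemma ramp_ge0 f c k a : 0 <= ramp f c k a.
Proof. by rewrite le_min ler01 mulr_ge0// le_max lexx orbT. Qed.

Lemma ramp_le1 f c k a : ramp f c k a <= 1.
Proof. by rewrite ge_min lexx. Qed.

Lemma ramp_mono f c k a : ramp f c k a <= ramp f c k.+1 a.
Proof.
rewrite le_min ramp_le1 /= ge_min; apply/orP; right.
by rewrite ler_wpM2r ?le_max ?lexx ?orbT// ler_nat.
Qed.

Lemma ramp0 f c k a : ~ (c < f a) -> ramp f c k a = 0.
Proof.
move=> /negP; rewrite -leNgt => fc; rewrite /ramp max_r ?subr_le0// mulr0.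
by rewrite min_r.
Qed.

Lemma ramp1 f c a : c < f a -> exists k, ramp f c k a = 1.
Proof.
move=> cf; exists (Num.truncn (f a - c)^-1).+1.
have fc : 0 < f a - c by rewrite subr_gt0.
rewrite /ramp max_l ?(ltW fc)// min_l//.
by rewrite -ler_pdivrMr// mul1r ltW// truncnS_gt.
Qed.

(** The sets [f > c] split every cover: if [h_k] increases to the indicator of
    [f > c], then [h_n g_n] covers the part of [S] inside, and for a fixed [k]
    the functions [(1 - h_k) g_n] cover the part outside; the first cost is
    nearly attained at the stage [k], so that the two costs add up to at most
    the cost of [g] plus [e]. *)
Lemma superlevel_caratheodory f c : uapprox X f ->
  caratheodory_measurable moment_outer_e [set a | c < f a].
Proof.
move=> uf; apply: le_caratheodory_measurable => S; rewrite -EFinD lee_fin.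
apply: moment_outer_ge => C [g [ug g0 gi gC gS]].
pose hh := ramp f c.
have uh k : uapprox X (hh k) by exact: uapprox_ramp.
have uhg k n : uapprox X (fun a => hh k a * g n a) by exact: uapproxM.
have u1h k : uapprox X (fun a => 1 - hh k a).
  by apply: (uapproxB cX) => //; exact: uapprox_cst.
have u1hg k n : uapprox X (fun a => (1 - hh k a) * g n a) by exact: uapproxM.
have hg0 k n a : X a -> 0 <= hh k a * g n a.
  by move=> Xa; rewrite mulr_ge0 ?ramp_ge0 ?g0.
have h1g0 k n a : X a -> 0 <= (1 - hh k a) * g n a.
  by move=> Xa; rewrite mulr_ge0 ?subr_ge0 ?ramp_le1 ?g0.
have split_cost k n : I (fun a => hh k a * g n a)
    + I (fun a => (1 - hh k a) * g n a) = I (g n).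
  rewrite -extendD//; apply: extend_ext; first exact: uapproxD.
  by move=> a _; ring.
pose b n := I (fun a => hh n a * g n a).
have bC n : b n <= C.
  apply: le_trans (gC n); apply: extend_mono => // a Xa.
  by rewrite ler_piMl ?g0 ?ramp_le1.
pose s := sup (range b).
have hs : has_sup (range b) by split; [exists (b 0), 0|exists C => _ [n _ <-]].
have bs n : b n <= s by apply: ub_le_sup; [exact: hs.2|exists n].
have in_le : mu (S `&` [set a | c < f a]) <= s.
  apply: moment_outer_le; exists (fun n a => hh n a * g n a).
  split=> [n|n a|n a Xa|n|a Xa [Sa /= cf]]; [exact: uhg|exact: hg0| |exact: bs|].
    by apply: ler_pM; [exact: ramp_ge0|exact: g0|exact: ramp_mono|exact: gi].
  have [n gn] := gS a Xa Sa; have [k hk] := ramp1 cf.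
  exists (maxn k n).
  have -> : hh (maxn k n) a = 1.
    apply/eqP; rewrite eq_le ramp_le1 -hk.
    by apply: (@increasing_le hh) (leq_maxl k n) => m; exact: ramp_mono.
  rewrite mul1r (le_trans gn)//; apply: increasing_le (leq_maxr k n) => m.
  exact: gi.
apply/ler_addgt0Pr => e e0.
have [_ [k _ <-] bk] := sup_adherent e0 hs.
suff out_le : mu (S `&` ~` [set a | c < f a]) <= C - s + e by lra.
apply: moment_outer_le; exists (fun n a => (1 - hh k a) * g n a).
split=> [n|n a|n a Xa|n|a Xa [Sa /= cf]]; [exact: u1hg|exact: h1g0| | |].
- by apply: ler_wpM2l; [rewrite subr_ge0 ramp_le1|exact: gi].
- apply: (@le_trans _ _ (I (fun a => (1 - hh k a) * g (maxn k n) a))).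
    apply: extend_mono; [exact: u1hg|exact: u1hg|move=> a Xa].
    apply: ler_wpM2l; first by rewrite subr_ge0 ramp_le1.
    by apply: increasing_le (leq_maxr k n) => m; exact: gi.
  have := split_cost k (maxn k n); have := gC (maxn k n).
  have : b k <= I (fun a => hh k a * g (maxn k n) a).
    apply: extend_mono; [exact: uhg|exact: uhg|move=> a Xa].
    apply: ler_wpM2l; first exact: ramp_ge0.
    by apply: increasing_le (leq_maxl k n) => m; exact: gi.
  rewrite -/s in bk *; lra.
- have [n gn] := gS a Xa Sa; exists n.
  by rewrite /hh ramp0// subr0 mul1r.
Qed.

End PositiveFunctional.

(** * Integration of bounded functions against finite measures *)

Section BoundedIntegral.
Context {disp : measure_display} {T : measurableType disp} {R : realType}.
Implicit Types (f g : T -> R) (D : set T).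

Definition bounded_measurable D f :=
  measurable_fun D f /\ exists C : R, forall x, D x -> `|f x| <= C.

Variables (nu : {measure set T -> \bar R}) (D : set T).
Hypotheses (mD : measurable D) (nuD : (nu D < +oo)%E).

Lemma bounded_integrable f : bounded_measurable D f -> nu.-integrable D (EFin \o f).
Proof.
move=> [mf [C fC]]; apply: measurable_bounded_integrable => //.
exists C; split; first exact: num_real.
by move=> x Cx y Dy; apply: (le_trans (fC y Dy)); exact: ltW.
Qed.

Lemma bounded_integralE f : bounded_measurable D f ->
  (\int[nu]_(x in D) (f x)%:E)%E = (\int[nu]_(x in D) f x)%:E.
Proof.
move=> bf; rewrite fineK//; apply: integrable_fin_num => //.
exact: bounded_integrable.
Qed.

Lemma fine_finite A : measurable A -> A `<=` D -> (fine (nu A))%:E = nu A.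
Proof.
move=> mA AD; rewrite fineK// ge0_fin_numE// (le_lt_trans _ nuD)//.
by apply: le_measure => //; rewrite inE.
Qed.

Lemma chebyshev_bounded f A (c : R) : bounded_measurable D f -> measurable A ->
  A `<=` D -> (forall x, D x -> 0 <= f x) -> (forall x, A x -> c <= f x) ->
  0 <= c -> c * fine (nu A) <= \int[nu]_(x in D) f x.
Proof.
move=> bf mA AD f0 fA c0; have AE : A `&` D = A by apply/setIidPl.
rewrite -lee_fin EFinM fine_finite// -bounded_integralE// -AE -integral_indic//.
rewrite -ge0_integralZl_EFin//; last first.
  exact/measurable_EFinP/measurable_indic.
apply: ge0_le_integral => //.
- by move=> x _; rewrite mule_ge0 ?lee_fin.
- by apply: measurable_funeM; exact/measurable_EFinP/measurable_indic.
- by apply/measurable_EFinP; case: bf.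
- move=> x Dx; rewrite -EFinM lee_fin indicE.
  by have [/set_mem Ax|_] := boolP (x \in A); rewrite ?mulr1 ?mulr0 ?fA ?f0.
Qed.

End BoundedIntegral.

(** * The representing measure *)

Section Representation.
Context {R : realType} {d : nat}.
Local Notation T := (borel_space R d).
Implicit Types (p q : mpoly d R) (f g h : T -> R) (a : T) (S : set T).

Variable X : set T.
Hypothesis cX : compact (X : set 'rV[R]_d).

Let mX : measurable X. Proof. exact: compact_measurable_borel. Qed.

Lemma uapprox_bounded_measurable f : uapprox X f -> bounded_measurable X f.
Proof.
move=> uf; split; last first.
  by have [C [_ CP]] := uapprox_bounded cX uf; exists C.
have e0 n : 0 < n.+1%:R^-1 :> R by rewrite invr_gt0.
have /choice[p pP] n := uf _ (e0 n).
apply: (@measurable_fun_cvg _ _ _ _ (fun n a => peval (p n) a)) => [n|a Xa].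
  apply: measurable_funS (@peval_measurable _ _ _) => //.
apply/subr_cvg0/norm_cvg0P; apply: squeeze_cvgr (cvg_cst 0) cvg_harmonic.
by apply: nearW => n; rewrite normr_ge0 distrC pP.
Qed.

Section Borel.
Variable mu : {outer_measure set T -> \bar R}.
Hypothesis mu_superlevel : forall f (c : R), uapprox X f ->
  caratheodory_measurable mu [set a | c < f a].

Let mbox (a : 'rV[R]_d) (r : R) : caratheodory_measurable mu
  [set t | forall i, `|a ord0 i - (t : 'rV[R]_d) ord0 i| < r].
Proof.
have -> : [set t : T | forall i, `|a ord0 i - (t : 'rV[R]_d) ord0 i| < r] =
    \big[setI/setT]_(i <- index_enum 'I_d)
      [set t : T | - r < - `|a ord0 i - (t : 'rV[R]_d) ord0 i|].
  rewrite -bigcap_seq; apply/seteqP; split=> t /= h i.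
    by move=> _ /=; rewrite ltrN2.
  by have := h i; rewrite /= mem_index_enum ltrN2; apply.
elim/big_ind: _ => [|A B|i _].
- by rewrite -setC0; apply/caratheodory_measurable_setC/caratheodory_measurable_set0.
- exact: caratheodory_measurable_setI.
- apply: mu_superlevel; apply: (uapproxN cX); apply: (uapprox_abs cX).
  apply: (uapproxB cX); first exact: uapprox_cst.
  apply: uapprox_ext (uapprox_peval X (mpolyX R (mnm1 i))) => t _.
  by rewrite /peval mevalXU.
Qed.

Let mset0 : caratheodory_measurable mu set0.
Proof. exact: caratheodory_measurable_set0. Qed.

(** Open sets are countable unions of boxes with rational centres and radii
    [1 / (k + 1)]. *)
Lemma open_caratheodory (U : set T) : open (U : set 'rV[R]_d) ->
  caratheodory_measurable mu U.
Proof.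
move=> oU.
pose box (a : 'rV[R]_d) (r : R) : set T :=
  [set t | forall i, `|a ord0 i - (t : 'rV[R]_d) ord0 i| < r].
pose qbox (u : 'rV[rat]_d * nat) : set T :=
  box (map_mx ratr u.1) u.2.+1%:R^-1.
pose F n : set T := if unpickle n is Some u then
  (if pselect (qbox u `<=` U) then qbox u else set0) else set0.
have -> : U = \bigcup_n F n.
  apply/seteqP; split=> t; last first.
    move=> [n _]; rewrite /F; case: unpickle => [u|//].
    by case: pselect => // h; exact: h.
  move=> Ut; have /nbhs_ballP[e /= e0 eU] : nbhs (t : 'rV[R]_d) U.
    by apply: open_nbhs_nbhs; split.
  have e2 : 0 < e / 2 by rewrite divr_gt0.
  have [k _ /(_ k (leqnn k)) kE] := near_infty_natSinv_lt (PosNum e2).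
  pose r : R := k.+1%:R^-1; rewrite /= -/r in kE.
  have r0 : 0 < r by rewrite invr_gt0.
  have /choice[c cP] i : exists q : rat, `|ratr q - (t : 'rV[R]_d) ord0 i| < r.
    have /rat_in_itvoo[q] : (t : 'rV[R]_d) ord0 i - r < (t : 'rV[R]_d) ord0 i + r.
      lra.
    rewrite in_itv /= => /andP[h1 h2]; exists q.
    by rewrite ltr_norml; apply/andP; split; lra.
  pose u : 'rV[rat]_d * nat := (\row_i c i, k).
  exists (pickle u) => //; rewrite /F pickleK; case: pselect => [_ i|[]] /=.
    by rewrite !mxE; exact: cP.
  move=> s /= h; apply: eU; split => // i j; rewrite (ord1 i).
  rewrite -ball_normE /=; have := h j; rewrite !mxE -/r => h1; have h2 := cP j.
  rewrite -(subrKA (ratr (c j))) (le_lt_trans (ler_normD _ _))//.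
  by rewrite [ltRHS]splitr distrC ltrD// (lt_trans _ kE)// distrC.
apply: caratheodory_measurable_bigcup => n; rewrite /F.
case: unpickle => [u|]; last exact: mset0.
by case: pselect => h; [exact: mbox|exact: mset0].
Qed.

Lemma borel_caratheodory S : measurable S -> caratheodory_measurable mu S.
Proof.
move=> mS; have := mS; apply: smallest_sub; last exact: open_caratheodory.
split; first exact: mset0.
- by move=> A; rewrite setTD; exact: caratheodory_measurable_setC.
- exact: caratheodory_measurable_bigcup.
Qed.

Lemma borel_sigma_additive : semi_sigma_additive (mu : set T -> \bar R).
Proof.
move=> A mA tA mbA.
apply: (@caratheodory_measure_sigma_additive R T mu A) => //.
  by move=> n; exact: borel_caratheodory.
exact: borel_caratheodory.
Qed.

End Borel.
End Representation.

Section RepresentingMeasure.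
Context {R : realType} {d : nat}.
Local Notation T := (borel_space R d).
Implicit Types (p q : mpoly d R) (f g h : T -> R) (a : T) (S : set T).

Variable X : set T.
Hypothesis cX : compact (X : set 'rV[R]_d).
Variable l : mpoly d R -> R.
Hypothesis ll : scalar l.
Hypothesis lpos : forall p, (forall a, X a -> 0 <= peval p a) -> 0 <= l p.

Local Notation I := (extend X l).
Local Notation mu := (moment_outer X l).

Let mX : measurable X. Proof. exact: compact_measurable_borel. Qed.
Let l1 : 0 <= l 1. Proof. by apply: lpos => a _; rewrite peval1. Qed.

Lemma moment_outerI S : mu (S `&` X) = mu S.
Proof.
congr inf; apply/seteqP; split=> c; last first.
  by apply: covers_mono => // a [].
move=> [g [ug g0 gi gc gS]]; exists g; split=> // a Xa Sa; exact: gS.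
Qed.

Lemma moment_outer_total : mu X = l 1.
Proof.
apply/eqP; rewrite eq_le; apply/andP; split.
  exact: (moment_outer_le ll lpos (covers_total ll lpos X)).
apply: (moment_outer_ge ll lpos) => c Xc; rewrite -[l 1]mul1r.
rewrite -(extend_cst ll lpos).
by apply: (dini_cover cX ll lpos) Xc => //; exact: uapprox_cst.
Qed.

Definition moment_measure_fun S : \bar R := moment_outer_measure ll lpos S.

Let mm0 : moment_measure_fun set0 = 0%E. Proof. exact: outer_measure0. Qed.
Let mm_ge0 S : (0 <= moment_measure_fun S)%E. Proof. exact: outer_measure_ge0. Qed.
Let mm_sigma : semi_sigma_additive moment_measure_fun.
Proof.
apply: (borel_sigma_additive cX) => f c uf.
exact: superlevel_caratheodory.
Qed.

HB.instance Definition _ :=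
  measure_function.isMeasure.Build _ T R moment_measure_fun mm0 mm_ge0 mm_sigma.

Definition moment_measure : {measure set T -> \bar R} := moment_measure_fun.

Local Notation mm := moment_measure.
Local Notation J f := (\int[mm]_(x in X) f x).

Let mmX : (mm X < +oo)%E. Proof. by rewrite /mm /= ltry. Qed.

Let ib f : uapprox X f -> mm.-integrable X (EFin \o f).
Proof. move=> uf; apply: bounded_integrable => //; exact: uapprox_bounded_measurable. Qed.

Let pos_part_approx f (c : R) : uapprox X f -> uapprox X (fun a => Num.max (f a - c) 0).
Proof.
move=> uf; apply: (uapprox_max cX); last exact: uapprox_cst.
by apply: (uapproxB cX) => //; exact: uapprox_cst.
Qed.

(** Slicing [f] at height [delta]: the bottom slice [min f delta] has extension
    at most [delta mu {f > 0}] and integral at least [delta mu {f > delta}], so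
    that the errors of consecutive slices telescope. *)
Lemma extend_le_integral_sliced (delta : R) n f : 0 < delta -> uapprox X f ->
  (forall a, X a -> 0 <= f a <= n%:R * delta) ->
  I f <= J f + delta * mu [set a | 0 < f a].
Proof.
move=> d0; elim: n f => [|n IH] f uf fn.
  have f0 a : X a -> 0 = f a.
    by move=> Xa; have := fn a Xa; rewrite mul0r => /andP[? ?]; apply/eqP; rewrite eq_le; apply/andP.
  rewrite -(extend_ext ll lpos (uapprox_cst X 0) f0) (extend_cst ll lpos) mul0r.
  rewrite addr_ge0//; last by rewrite mulr_ge0 ?(ltW d0)//; exact: moment_outer_ge0.
  by apply: Rintegral_ge0 => a Xa; rewrite -f0.
pose f1 a := Num.min (f a) delta; pose f2 a := Num.max (f a - delta) 0.
have u1 : uapprox X f1 by apply: (uapprox_min cX) => //; exact: uapprox_cst.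
have u2 : uapprox X f2 by exact: pos_part_approx.
have f12 a : f1 a + f2 a = f a.
  rewrite /f1 /f2; have [fd|fd] := leP (f a) delta.
    by rewrite max_r ?addr0// subr_le0.
  by rewrite max_l ?subr_ge0 ?(ltW fd)//; ring.
have If : I f = I f1 + I f2.
  by rewrite -(extendD ll lpos u1 u2); apply: (extend_ext ll lpos) => // a _.
have Jf : J f = J f1 + J f2.
  rewrite -RintegralD//; [|exact: ib|exact: ib].
  by apply: eq_Rintegral => a _; rewrite f12.
have I1 : I f1 <= delta * mu [set a | 0 < f a].
  rewrite -ler_pdivrMl//; apply: (moment_outer_ge ll lpos) => c Sc.
  rewrite -(extendZ cX ll lpos)//.
  apply: (dini_cover cX ll lpos) Sc; first exact: uapproxZ.
    by move=> a _ _; rewrite ler_pdivrMl// mulr1 /f1 ge_min lexx orbT.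
  move=> a _ /negP; rewrite -leNgt => fa.
  by rewrite pmulr_rle0 ?invr_gt0// /f1 ge_min fa.
have J1 : delta * mu [set a | delta < f a] <= J f1.
  have mS : measurable ([set a | delta < f a] `&` X).
    have [mf _] := uapprox_bounded_measurable cX uf.
    rewrite setIC; have := mf mX _ (measurable_itv `]delta, +oo[).
    by congr measurable; apply/seteqP; split=> a [Xa] /=; rewrite in_itv/= andbT.
  rewrite -moment_outerI -[mu _]/(fine (mm _)).
  apply: chebyshev_bounded => //; first exact: uapprox_bounded_measurable.
  - by move=> a Xa; rewrite /f1 le_min (ltW d0) andbT; have /andP[] := fn a Xa.
  - by move=> a [/= fa _]; rewrite /f1 le_min lexx (ltW fa).
  - exact: ltW.
have := IH f2 u2; rewrite (_ : [set a | 0 < f2 a] = [set a | delta < f a]); last first.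
  by apply/seteqP; split=> a /=; rewrite /f2 lt_max ltxx orbF subr_gt0.
rewrite If Jf => /(_ _)/[dup] h; have {h}: I f2 <= J f2 + delta * mu [set a | delta < f a].
  apply: h => a Xa; rewrite /f2 le_max lexx orbT /= ge_max mulr_ge0 ?(ltW d0)// andbT.
  by have /andP[_] := fn a Xa; rewrite -natr1; lra.
lra.
Qed.

(** The sliced bound, applied to [C + f] and to [C - f], gives both
    inequalities. *)
Lemma extend_integral f : uapprox X f -> J f = I f.
Proof.
have le g : uapprox X g -> (forall a, X a -> 0 <= g a) -> I g <= J g.
  move=> ug g0; have [C [C0 gC]] := uapprox_bounded cX ug.
  apply/ler_addgt0Pr => e e0; pose delta := e / (l 1 + 1).
  have L1 : 0 < l 1 + 1 by rewrite ltr_wpDl.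
  have dl0 : 0 < delta by rewrite divr_gt0.
  have dE : delta * (l 1 + 1) = e by rewrite divfK// gt_eqF.
  have bnd a : X a -> 0 <= g a <= (Num.truncn (C / delta)).+1%:R * delta.
    move=> Xa; rewrite g0//= (le_trans (ler_norm _))// (le_trans (gC a Xa))//.
    by rewrite -ler_pdivrMr// ltW// truncnS_gt.
  have := extend_le_integral_sliced dl0 ug bnd.
  have : mu [set a | 0 < g a] <= l 1.
    exact: (moment_outer_le ll lpos (covers_total ll lpos _)).
  by move=> /(ler_wpM2l (ltW dl0)); lra.
move=> uf; have [C [C0 fC]] := uapprox_bounded cX uf.
have uC := uapprox_cst X C.
have JC : J (fun=> C) = C * l 1.
  by rewrite Rintegral_cst// -[fine _]/(mu X) moment_outer_total.
have IC := extend_cst ll lpos C.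
have := le _ (uapproxD uC uf); rewrite (extendD ll lpos)// RintegralD//; [|exact: ib..].
rewrite JC IC => h1.
have := le _ (uapproxB cX uC uf); rewrite (extendB cX ll lpos)// RintegralB//; [|exact: ib..].
rewrite JC IC => h2.
have {}h1 := h1 _; have {}h2 := h2 _.
apply/eqP; rewrite eq_le; apply/andP; split.
  suff : C * l 1 - I f <= C * l 1 - J f by lra.
  by apply: h2 => a Xa; have := fC a Xa; rewrite ler_norml => /andP[? ?]; lra.
suff : C * l 1 + I f <= C * l 1 + J f by lra.
by apply: h1 => a Xa; have := fC a Xa; rewrite ler_norml => /andP[? ?]; lra.
Qed.

Lemma moment_measure_integral p : (\int[mm]_(x in X) (peval p x)%:E = (l p)%:E)%E.
Proof.
have up := uapprox_peval X p.
rewrite bounded_integralE//; last exact: uapprox_bounded_measurable.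
by rewrite extend_integral// (extend_peval ll lpos).
Qed.

Lemma moment_measure_sub S : (mm (S `&` X) = mm S)%E.
Proof. by congr EFin; exact: moment_outerI. Qed.

(** A measure with the same moments is dominated by the outer measure, because
    [g_n >= 1] has measure at most the integral of [g_n]; applied to a set and
    to its complement, the bound is an equality. *)
Lemma moment_measure_unique (nu : {measure set T -> \bar R}) :
  (forall p, (\int[nu]_(x in X) (peval p x)%:E = (l p)%:E)%E) ->
  forall S, measurable S -> nu (S `&` X) = (mu S)%:E.
Proof.
move=> nul.
have nuX : nu X = (l 1)%:E.
  rewrite -nul; under eq_integral do rewrite peval1.
  by rewrite (integral_cst _ mX 1) mul1e.
have nuXoo : (nu X < +oo)%E by rewrite nuX ltry.
have nfin S : measurable S -> (fine (nu (S `&` X)))%:E = nu (S `&` X).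
  by move=> mS; apply: (fine_finite mX nuXoo) => //; exact: measurableI.
have Jnu g : uapprox X g -> \int[nu]_(x in X) g x <= I g.
  move=> ug; apply: lb_le_inf.
    have [C [_ gC]] := uapprox_bounded cX ug.
    exists (l (C *: 1)), (C *: 1) => //= a Xa.
    by rewrite pevalZ peval1 mulr1 (le_trans (ler_norm _))// gC.
  move=> _ [p /= gp <-]; rewrite -lee_fin -nul.
  have bp := uapprox_bounded_measurable cX (uapprox_peval X p).
  rewrite (bounded_integralE mX nuXoo bp) lee_fin; apply: le_Rintegral => //.
    by apply: bounded_integrable => //; exact: uapprox_bounded_measurable.
  exact: bounded_integrable.
have le S : measurable S -> fine (nu (S `&` X)) <= mu S.
  move=> mS; apply: (moment_outer_ge ll lpos) => c [g [ug g0 gi gc gS]].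
  pose A n := X `&` [set a | 1 <= g n a].
  have mA n : measurable (A n).
    have [mg _] := uapprox_bounded_measurable cX (ug n).
    have := mg mX _ (measurable_itv `[1, +oo[).
    by congr measurable; apply/seteqP; split=> a [Xa] /=; rewrite in_itv/= andbT.
  have mUA : measurable (\bigcup_n A n) by exact: bigcupT_measurable.
  have ndA : nondecreasing_seq A.
    apply/nondecreasing_seqP => n; apply/subsetPset => a [Xa /= ga].
    by split=> //=; rewrite (le_trans ga)// gi.
  have cvgA : (nu \o A) @ \oo --> nu (\bigcup_n A n).
    exact: nondecreasing_cvg_mu.
  have Ac n : (nu (A n) <= c%:E)%E.
    have AX : A n `<=` X by move=> a [].
    rewrite -(fine_finite mX nuXoo (mA n) AX) lee_fin.
    apply: le_trans (gc n); apply: le_trans (Jnu _ (ug n)).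
    rewrite -[leLHS]mul1r; apply: chebyshev_bounded => //.
    - exact: uapprox_bounded_measurable.
    - exact: g0.
    - by move=> a [].
  rewrite -lee_fin nfin//; apply: (@le_trans _ _ (nu (\bigcup_n A n))).
    apply: le_measure; rewrite ?inE//; first exact: measurableI.
    by move=> a [Sa Xa]; have [n gn] := gS a Xa Sa; exists n.
  rewrite -(cvg_lim _ cvgA)//; apply: lime_le; first by apply/cvg_ex; eexists; exact: cvgA.
  exact: nearW.
move=> S mS; have mSc : measurable (~` S) by exact: measurableC.
have sumnu : fine (nu (S `&` X)) + fine (nu (~` S `&` X)) = l 1.
  have e : nu X = (nu (S `&` X) + nu (~` S `&` X))%E.
    rewrite -measureU; [|exact: measurableI|exact: measurableI|].
      by rewrite -setIUl setUCr setTI.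
    by rewrite setIACA setICr set0I.
  by move: e; rewrite -(nfin _ mS) -(nfin _ mSc) nuX -EFinD => -[->].
have summu : mu S + mu (~` S) = l 1.
  have e : mm setT = (mm S + mm (~` S))%E.
    by rewrite -measureU// ?setICr// setUCr.
  move: e; rewrite -[mm setT]moment_measure_sub setTI -[mm X]/((mu X)%:E).
  by rewrite moment_outer_total => -[->].
rewrite -nfin//; congr EFin; have := le _ mS; have := le _ mSc.
by move=> h1 h2; apply/eqP; rewrite eq_le h2 /=; lra.
Qed.

End RepresentingMeasure.

(** * Positive operator-valued measures and their integrals *)

Import HBNNSimple.

(** The integral is defined for any set function, but simple functions only see
    its values on measurable sets. *)
Lemma eq_measurable_integral (disp : measure_display) (T : measurableType disp)
    (R : realType) (mu nu : set T -> \bar R) (D : set T) (f : T -> \bar R) :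
  (forall A, measurable A -> mu A = nu A) ->
  (\int[mu]_(x in D) f x = \int[nu]_(x in D) f x)%E.
Proof.
move=> munu; rewrite /integral.
have sE (h : {nnsfun T >-> R}) : sintegral mu h = sintegral nu h.
  by apply: eq_fsbigr => r _; rewrite munu.
by congr (ereal_sup _ - ereal_sup _)%E; apply: eq_imagel => h _; exact: sE.
Qed.

Section Povm.
Context {disp : measure_display} {T : measurableType disp} {R : realType}.
Context {K : hilbertType R}.
Variables (X : set T) (mX : measurable X) (E : set T -> sa K).
Hypothesis povmE : povm (trace_sigma X) E.
Implicit Types (x y : K) (A B D : set T) (f : T -> R).

Let traceI B : measurable B -> trace_sigma X (B `&` X).
Proof. by move=> mB; exists B. Qed.

Lemma povm_add x A B : measurable A -> measurable B -> A `&` B = set0 ->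
  '< E ((A `|` B) `&` X) x, x > = '< E (A `&` X) x, x > + '< E (B `&` X) x, x >.
Proof.
move=> mA mB AB; have [_ Eadd _] := povmE.
rewrite setIUl Eadd; [by rewrite saDE innerDl|exact: traceI|exact: traceI|].
by rewrite setIACA AB set0I.
Qed.

Lemma povm_set0 x : '< E (set0 `&` X) x, x > = 0.
Proof.
have := @povm_add x set0 set0 measurable0 measurable0 (setI0 _).
by rewrite setU0; lra.
Qed.

Lemma povm_ge0 x B : measurable B -> 0 <= '< E (B `&` X) x, x >.
Proof. by move=> mB; have [Eps _ _] := povmE; apply: Eps; exact: traceI. Qed.

(** The values outside the sigma-algebra are replaced by [0], to obtain a
    genuine measure. *)
Definition povm_measure_fun x B : \bar R :=
  if `[< measurable B >] then quad_measure X E x B else 0%E.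

Lemma povm_measureE x B : measurable B ->
  povm_measure_fun x B = ('< E (B `&` X) x, x >)%:E.
Proof. by move=> mB; rewrite /povm_measure_fun; case: asboolP. Qed.

Let pm0 x : povm_measure_fun x set0 = 0%E.
Proof. by rewrite povm_measureE// povm_set0. Qed.

Let pm_ge0 x B : (0 <= povm_measure_fun x B)%E.
Proof.
by rewrite /povm_measure_fun; case: asboolP => // mB; rewrite lee_fin povm_ge0.
Qed.

Lemma povm_measure_sum x (A : nat -> set T) n : (forall i, measurable (A i)) ->
  trivIset setT A ->
  '< E ((\big[setU/set0]_(i < n) A i) `&` X) x, x >
  = \sum_(i < n) '< E (A i `&` X) x, x >.
Proof.
move=> mA tA; elim: n => [|n IH]; first by rewrite !big_ord0 povm_set0.
rewrite !big_ord_recr /= povm_add ?IH//; first exact: bigsetU_measurable.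
by apply: (@trivIset_bigsetUI _ predT) => //; rewrite /predT /= trueE.
Qed.

Let pm_sigma x : semi_sigma_additive (povm_measure_fun x).
Proof.
move=> A mA tA mU; pose B n := \big[setU/set0]_(i < n) A i.
have mB n : measurable (B n) by exact: bigsetU_measurable.
have BU : \bigcup_n (B n `&` X) = (\bigcup_n A n) `&` X.
  apply/seteqP; split=> t.
    by move=> [n _ [Bt Xt]]; split=> //; exact: bigsetU_bigcup Bt.
  by move=> [[n _ At] Xt]; exists n.+1 => //; split=> //; rewrite /B big_ord_recr; right.
have [Eps Eadd Esup] := povmE.
have Binc n : B n `&` X `<=` B n.+1 `&` X.
  by apply: setSI; rewrite /B big_ord_recr; left.
have sup : loewner_sup (E \o (fun n => B n `&` X)) (E (\bigcup_n (B n `&` X))).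
  apply: Esup => [n| |]; [exact: traceI|exact: Binc|rewrite BU; exact: traceI].
have inc n : psd (E (B n.+1 `&` X) - E (B n `&` X)).
  move=> y; rewrite saBE innerBl /B big_ord_recr /= povm_add//; last first.
  - by apply: (@trivIset_bigsetUI _ predT) => //; rewrite /predT /= trueE.
  - exact: mB.
  by rewrite addrC addKr povm_ge0.
have := @loewner_sup_cvg _ _ _ _ inc sup x.
rewrite BU povm_measureE// => cv.
rewrite (_ : (fun n => _) = EFin \o (fun n => '< E (B n `&` X) x, x >)).
  by apply: cvg_EFin; [exact: nearW|exact: cv].
apply/funext => n /=; rewrite big_mkord povm_measure_sum// -sumEFin.
by apply: eq_bigr => i _; rewrite povm_measureE.
Qed.

HB.instance Definition _ x := measure_function.isMeasure.Build _ T R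
  (povm_measure_fun x) (@pm0 x) (@pm_ge0 x) (@pm_sigma x).

Definition povm_measure x : {measure set T -> \bar R} := povm_measure_fun x.

Lemma povm_measureEI x B : measurable B ->
  povm_measure x B = ('< E (B `&` X) x, x >)%:E.
Proof. exact: povm_measureE. Qed.

Lemma povm_measure_total x : povm_measure x X = ('< E X x, x >)%:E.
Proof. by rewrite povm_measureEI// setIid. Qed.

Lemma povm_measure_finite x : (povm_measure x X < +oo)%E.
Proof. by rewrite povm_measure_total ltry. Qed.

Lemma quad_measure_integral x (f : T -> \bar R) :
  (\int[quad_measure X E x]_(t in X) f t = \int[povm_measure x]_(t in X) f t)%E.
Proof.
by apply: eq_measurable_integral => B mB; rewrite povm_measureEI.
Qed.

Local Notation J x f := (\int[povm_measure x]_(t in X) f t).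

Lemma povm_integral_bound x f (C : R) : bounded_measurable X f ->
  (forall t, X t -> `|f t| <= C) -> `|J x f| <= C * '< E X x, x >.
Proof.
move=> bf fC; have fin := povm_measure_finite x.
have bc : bounded_measurable X (fun=> C).
  by split; [exact: measurable_cst|exists `|C|].
apply: le_trans (le_normr_Rintegral mX (bounded_integrable mX fin bf)) _.
rewrite (_ : C * _ = J x (fun=> C)).
  apply: le_Rintegral => //; last 1 first.
  - exact: bounded_integrable.
  apply: bounded_integrable => //; split; first by apply: measurableT_comp; case: bf.
  by exists C => t Xt; rewrite normr_id fC.
by rewrite Rintegral_cst// povm_measure_total.
Qed.

Lemma povm_op_integrable f : bounded_measurable X f -> op_integrable X E f.
Proof.
move=> bf; have [mf [C fC]] := bf; split=> //; exists (`|C| * opnorm (E X)) => x.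
have ba : bounded_measurable X (fun t => `|f t|).
  by split; [exact: measurableT_comp|exists C => t Xt; rewrite normr_id fC].
rewrite quad_measure_integral bounded_integralE//; last exact: povm_measure_finite.
rewrite lee_fin -mulrA; apply: le_trans (ler_norm _) _.
have fC' t : X t -> `| `|f t| | <= `|C|.
  by move=> Xt; rewrite normr_id (le_trans (fC t Xt)) ?ler_norm.
apply: le_trans (povm_integral_bound x ba fC') _.
by rewrite ler_wpM2l// (le_trans (ler_norm _))// quadratic_form_bound.
Qed.

(** The parallelogram law holds for the value of the measure at each set, that
    is, as an identity between sums of measures. *)
Lemma povm_integral_parallelogram f x y : bounded_measurable X f ->
  J (x + y) f + J (x - y) f = 2 * J x f + 2 * J y f.
Proof.
move=> bf; have [mf _] := bf.
have int x' := bounded_integrable mX (povm_measure_finite x') bf.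
have mEf : measurable_fun X (EFin \o f) by exact/measurable_EFinP.
have add u v : (\int[measure_add (povm_measure u) (povm_measure v)]_(t in X) (f t)%:E
    = (J u f + J v f)%:E)%E.
  rewrite integral_measure_add//.
  by rewrite !bounded_integralE//; exact: povm_measure_finite.
have e : (\int[measure_add (measure_add (povm_measure x) (povm_measure x))
     (measure_add (povm_measure y) (povm_measure y))]_(t in X) (f t)%:E
    = \int[measure_add (povm_measure (x + y)%R) (povm_measure (x - y)%R)]_(t in X)
     (f t)%:E)%E.
  apply: eq_measurable_integral => B mB.
  have addE u v : measure_add (povm_measure u) (povm_measure v) B =
      ('< E (B `&` X) u, u > + '< E (B `&` X) v, v >)%:E.
    by rewrite measure_addE !povm_measureEI.
  rewrite [LHS]measure_addE addE [X in (X + _)%E = _](addE x x).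
  rewrite [X in (_ + X)%E = _](addE y y) -EFinD; congr EFin.
  by rewrite opD opB !innerE; ring.
have int2 u : (measure_add (povm_measure u) (povm_measure u)).-integrable X (EFin \o f).
  apply: bounded_integrable => //.
  rewrite [Z in (Z < _)%E](measure_addE (povm_measure u) (povm_measure u) X).
  by rewrite lte_add_pinfty// povm_measure_finite.
move: e; rewrite integral_measure_add//; [|exact: int2|exact: int2].
rewrite !add -EFinD => -[]; lra.
Qed.

(** By the parallelogram law, the scalar integrals are the quadratic form of an
    operator, so that the choice in [op_integral] is not vacuous. *)
Lemma op_integralE f x : bounded_measurable X f ->
  '< op_integral X E f x, x > = J x f.
Proof.
move=> bf; have [mf [C fC]] := bf.
have [||S SP] := @quadratic_form_operator _ _ (fun x => J x f) (`|C| * opnorm (E X)).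
- by move=> u v; exact: povm_integral_parallelogram.
- move=> u; have fC' t : X t -> `|f t| <= `|C|.
    by move=> Xt; rewrite (le_trans (fC t Xt)) ?ler_norm.
  apply: le_trans (povm_integral_bound u bf fC') _; rewrite -mulrA ler_wpM2l//.
  by rewrite (le_trans (ler_norm _))// quadratic_form_bound.
have SI : [set S : sa K | forall x : K, ('< S x, x >)%:E =
    (\int[quad_measure X E x]_(t in X) (f t)%:E)%E] S.
  move=> u /=; rewrite quad_measure_integral bounded_integralE//; first by rewrite SP.
  exact: povm_measure_finite.
rewrite /op_integral; case: xgetP => [S' _ /(_ x)|/(_ _ SI)//].
rewrite quad_measure_integral bounded_integralE//; last exact: povm_measure_finite.
by move=> -[].
Qed.

End Povm.

Section RiemannSum.
Context {disp : measure_display} {T : measurableType disp} {R : realType}.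
Variables (X : set T) (mX : measurable X).

(** Finitely many bounded measurable functions are simultaneously almost constant
    on the cells of a finite measurable partition: each function splits the
    cells according to its value rounded down to a multiple of [e]. *)
Lemma finite_oscillation_partition (I : eqType) (s : seq I) (f : I -> T -> R) (e : R) :
  0 < e -> (forall i, i \in s -> bounded_measurable X (f i)) ->
  exists (J : finType) (phi : T -> J),
    (forall j, measurable (X `&` phi @^-1` [set j])) /\
    (forall i, i \in s -> forall t u, X t -> X u -> phi t = phi u ->
       `|f i t - f i u| <= e).
Proof.
move=> e0; elim: s => [_|i s IH fsX].
  exists unit, (fun=> tt); split=> // -[].
  by rewrite (_ : _ @^-1` _ = setT) ?setIT//; apply/seteqP; split.
have [k ks|J [phi [mphi osc]]] := IH; first by apply: fsX; rewrite inE ks orbT.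
have [mf [C fC]] : bounded_measurable X (f i) by apply: fsX; rewrite inE eqxx.
pose N := Num.truncn (2 * `|C| / e).
pose lvl t := Num.truncn ((f i t + `|C|) / e).
pose psi t : J * 'I_N.+1 := (phi t, inord (lvl t)).
have fb t : X t -> - `|C| <= f i t <= `|C|.
  by move=> Xt; rewrite -ler_norml (le_trans (fC t Xt))// ler_norm.
have lvlN t : X t -> (lvl t < N.+1)%N.
  move=> Xt; rewrite ltnS; apply: le_truncn; rewrite ler_pM2r ?invr_gt0//.
  by have /andP[_] := fb t Xt; lra.
have lvlP t (k : nat) : X t ->
    (lvl t = k) <-> (k%:R * e - `|C| <= f i t < k.+1%:R * e - `|C|).
  move=> Xt; have pos : 0 <= (f i t + `|C|) / e.
    by rewrite divr_ge0 ?(ltW e0)//; have /andP[+ _] := fb t Xt; lra.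
  have rng : (k%:R <= (f i t + `|C|) / e < k.+1%:R) =
      (k%:R * e - `|C| <= f i t < k.+1%:R * e - `|C|).
    by rewrite ler_pdivlMr// ltr_pdivrMr// lerBlDr ltrBrDr.
  rewrite -rng; split=> [<-|]; first exact: truncn_itv.
  exact: truncn_def.
exists (J * 'I_N.+1)%type, psi; split=> [[j k]|k].
  have -> : X `&` psi @^-1` [set (j, k)] = (X `&` phi @^-1` [set j]) `&`
      (X `&` f i @^-1` `[k%:R * e - `|C|, k.+1%:R * e - `|C|[).
    apply/seteqP; split=> t /=.
      move=> [Xt [<- kE]]; split=> //; split=> //; rewrite in_itv /=.
      by apply/lvlP => //; rewrite -kE inordK// lvlN.
    move=> [[Xt <-] [_]]; rewrite in_itv /= => /lvlP tk; split=> //.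
    by congr pair; apply: val_inj; rewrite /= inordK ?lvlN// tk.
  by apply: measurableI => //; apply: mf => //; exact: measurable_itv.
rewrite inE => /predU1P[->|ks] t u Xt Xu [phitu kE]; last exact: osc.
have le : lvl t = lvl u.
  by have := congr1 val kE; rewrite /= !inordK ?lvlN.
have /andP[u1 u2] := iffLR (lvlP u _ Xu) erefl.
have /andP[t1 t2] := iffLR (lvlP t _ Xt) le.
by rewrite -natr1 in u2 t2; rewrite ler_norml; apply/andP; split; lra.
Qed.

Variable nu : {measure set T -> \bar R}.
Hypothesis nuX : (nu X < +oo)%E.

Lemma simple_sum_integral (J : Type) (r : seq J) (A : J -> set T) (c : J -> R) :
  (forall j, measurable (A j)) -> (forall j, A j `<=` X) ->
  bounded_measurable X (fun t => \sum_(j <- r) c j * \1_(A j) t) /\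
  \int[nu]_(t in X) (\sum_(j <- r) c j * \1_(A j) t) =
  \sum_(j <- r) c j * fine (nu (A j)).
Proof.
move=> mA AX; have b1 j : bounded_measurable X (fun t => c j * \1_(A j) t).
  split; first by apply: measurable_funM.
  exists `|c j| => t _; rewrite normrM ler_piMr// indicE.
  by case: (t \in A j); rewrite ?normr1 ?normr0.
have i1 j : \int[nu]_(t in X) (c j * \1_(A j) t) = c j * fine (nu (A j)).
  have bi : bounded_measurable X (fun t => \1_(A j) t : R).
    split; first exact: measurable_indic.
    exists 1 => t _; rewrite indicE.
    by case: (t \in A j); rewrite ?normr1 ?normr0.
  rewrite RintegralZl//; last exact: bounded_integrable.
  by rewrite /Rintegral integral_indic//; congr (_ * fine (nu _)); apply/setIidPl.
elim: r => [|j r [[mr [C rC]] IH]].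
  have -> : (fun t => \sum_(j <- [::]) c j * \1_(A j) t) = fun=> 0.
    by apply/funext => t; rewrite big_nil.
  split; last by rewrite Rintegral_cst// mul0r big_nil.
  by split; [exact: measurable_cst|exists 0 => t _; rewrite normr0].
have e : (fun t => \sum_(j <- j :: r) c j * \1_(A j) t) =
    (fun t => c j * \1_(A j) t + \sum_(j <- r) c j * \1_(A j) t).
  by apply/funext => t; rewrite big_cons.
split.
  rewrite e; have [m1 [C1 h1]] := b1 j; split; first exact: measurable_funD.
  exists (C1 + C) => t Xt; rewrite (le_trans (ler_normD _ _))// lerD ?h1 ?rC//.
under eq_Rintegral do rewrite big_cons.
rewrite RintegralD//; [|exact: bounded_integrable|].
  by rewrite i1 IH big_cons.
by apply: bounded_integrable => //; split=> //; exists C.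
Qed.

Lemma riemann_sum_bound (J : finType) (phi : T -> J) (pt : J -> T) (f : T -> R) (e : R) :
  bounded_measurable X f ->
  (forall j, measurable (X `&` phi @^-1` [set j])) ->
  (forall t u, X t -> X u -> phi t = phi u -> `|f t - f u| <= e) ->
  (forall t, X t -> X (pt (phi t)) /\ phi (pt (phi t)) = phi t) ->
  `|\int[nu]_(t in X) f t
    - \sum_(j : J) f (pt j) * fine (nu (X `&` phi @^-1` [set j]))| <=
  e * fine (nu X).
Proof.
move=> bf mphi osc ptP.
have AX j : X `&` phi @^-1` [set j] `<=` X by move=> t [].
have [bs <-] := simple_sum_integral (index_enum J) (fun j => f (pt j)) mphi AX.
have sE t : X t -> \sum_(j : J) f (pt j) * \1_(X `&` phi @^-1` [set j]) t = f (pt (phi t)).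
  move=> Xt; rewrite (bigD1 (phi t))//= big1 ?addr0.
    by rewrite indicE mem_set// mulr1.
  move=> j jt; rewrite indicE memNset ?mulr0// => -[_ /= tj].
  by rewrite tj eqxx in jt.
have int_f := bounded_integrable mX nuX bf.
have int_s := bounded_integrable mX nuX bs.
rewrite -RintegralB//.
have bd : bounded_measurable X (fun t => f t -
    \sum_(j : J) f (pt j) * \1_(X `&` phi @^-1` [set j]) t).
  have [mf [C1 h1]] := bf; have [ms [C2 h2]] := bs.
  split; first exact: measurable_funB.
  by exists (C1 + C2) => t Xt; rewrite (le_trans (ler_normB _ _))// lerD ?h1 ?h2.
apply: le_trans (le_normr_Rintegral mX (bounded_integrable mX nuX bd)) _.
rewrite -Rintegral_cst//; apply: le_Rintegral => //.
- apply: bounded_integrable => //; have [md [C dC]] := bd.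
  by split; [exact: measurableT_comp|exists C => t Xt; rewrite normr_id dC].
- apply: bounded_integrable => //; split; first exact: measurable_cst.
  by exists `|e|.
- by move=> t Xt; have [Xp pE] := ptP t Xt; rewrite sE// osc.
Qed.

End RiemannSum.

(** * From the measure to positivity *)

Section NonnegSet.
Context {R : realType} {d : nat}.
Variable M : set (mpoly d R).
Hypothesis archM : archimedean M.

(** The archimedean property bounds each coordinate. *)
Lemma nonneg_set_compact : compact (nonneg_set M : set 'rV[R]_d).
Proof.
have /choice[n nP] i : exists n : nat, M (n%:R + mpolyX R (mnm1 i)) /\
    M (n%:R - mpolyX R (mnm1 i)) by exact: archM.
apply: (@subclosed_compact _ _ [set v : 'rV[R]_d |
    forall i, `[- (n i)%:R, (n i)%:R]%classic (v ord0 i)]).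
- have -> : (nonneg_set M : set 'rV[R]_d) =
      \bigcap_(p in M) [set a : 'rV[R]_d | 0 <= peval p a] by apply/seteqP; split.
  apply: closed_bigI => p _.
  apply: (@preimage_closed _ _ (fun a : 'rV[R]_d => peval p a) [set y | 0 <= y]).
    by move=> a _; exact: peval_continuous.
  exact: closed_ge.
- apply: (@rV_compact R d (fun i => `[- (n i)%:R, (n i)%:R]%classic)) => i.
  exact: segment_compact.
- move=> a Ka i; rewrite /= in_itv /=; have [Mp Mm] := nP i.
  have := Ka _ Mp; have := Ka _ Mm; rewrite pevalB pevalD.
  rewrite /peval mevalXU raddfMn /= rmorph1 => h1 h2.
  by apply/andP; split; lra.
Qed.

End NonnegSet.

Lemma bop_sumr (R : realType) (V W : normedModType R) (f : bop V W) (I : Type)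
  (r : seq I) (u : I -> V) : f (\sum_(i <- r) u i) = \sum_(i <- r) f (u i).
Proof. exact: linear_sum. Qed.

Section Representation.
Context {R : realType} {d : nat} {H K : hilbertType R}.
Local Notation T := (borel_space R d).
Variable X : set T.
Hypothesis cX : compact (X : set 'rV[R]_d).
Implicit Types (m : set T -> bop (sa H) (sa K)) (A B : sa H) (x : K).

Let mX : measurable X. Proof. exact: compact_measurable_borel. Qed.

Lemma monomial_bounded_measurable a : bounded_measurable X (monomial a : T -> R).
Proof. exact/uapprox_bounded_measurable/uapprox_peval. Qed.

Section Novm.
Variables (m : set T -> bop (sa H) (sa K)) (nm : novm (trace_sigma X) m).

Definition novm_measure A (pA : psd A) x := povm_measure (nm pA) x.

Local Notation J pA x f := (\int[novm_measure pA x]_(t in X) f t).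

Lemma novm_measureE A (pA : psd A) x D : measurable D ->
  novm_measure pA x D = ('< m (D `&` X) A x, x >)%:E.
Proof. exact: povm_measureEI. Qed.

Lemma novm_measure_finite A (pA : psd A) x : (novm_measure pA x X < +oo)%E.
Proof. exact: povm_measure_finite. Qed.

Lemma novm_integralD A B C (pA : psd A) (pB : psd B) (pC : psd C) x (f : T -> R) :
  C = A + B -> bounded_measurable X f -> J pC x f = J pA x f + J pB x f.
Proof.
move=> CE bf.
have fin E (pE : psd E) := novm_measure_finite pE x.
have int E (pE : psd E) := bounded_integrable mX (fin E pE) bf.
have IE E (pE : psd E) := bounded_integralE mX (fin E pE) bf.
apply: EFin_inj; rewrite EFinD -!IE.
rewrite -(integral_measure_add mX (int A pA) (int B pB)).
apply: eq_measurable_integral => D mD.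
rewrite [RHS]measure_addE !novm_measureE// CE linearD -EFinD.
by congr EFin; rewrite saDE innerDl.
Qed.

Lemma ovm_integralE (f : T -> R) A x : bounded_measurable X f ->
  '< ovm_integral X m f A x, x > =
  J (pos_part_psd A) x f - J (neg_part_psd A) x f.
Proof.
move=> bf; rewrite /ovm_integral saBE innerBl.
by rewrite (op_integralE mX (nm (pos_part_psd A)) x bf)
  (op_integralE mX (nm (neg_part_psd A)) x bf).
Qed.

(** The integral is additive in the operator, so that the integral for a positive
    [A] equals the difference of those for the parts of [A]. *)
Lemma ovm_integral_psd (f : T -> R) A (pA : psd A) x : bounded_measurable X f ->
  '< ovm_integral X m f A x, x > = J pA x f.
Proof.
move=> bf; rewrite ovm_integralE//.
rewrite (@novm_integralD _ _ _ pA (neg_part_psd A) (pos_part_psd A))//.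
  by rewrite addrK.
by rewrite -{2}(parts_sub A) subrK.
Qed.

Lemma ovm_integral0 (f : T -> R) : ovm_integral X m f 0 = 0.
Proof.
rewrite /ovm_integral; have := parts_sub (0 : sa H) => /eqP; rewrite subr_eq0 => /eqP ->.
exact: subrr.
Qed.

Lemma poly_integral_seq (F : vpoly d (sa H)) : poly_integral X m F =
  \sum_(a <- vsupp_seq F) ovm_integral X m (monomial a) (F a).
Proof.
by apply: (sum_vsuppE (phi := fun a A => ovm_integral X m (monomial a) A)) => a;
  exact: ovm_integral0.
Qed.

(** The integral of a polynomial with nonnegative values is approximated by the
    sums of [m (D_j) (F (t_j))] over a fine partition, which are positive. *)
Lemma poly_integral_psd (F : vpoly d (sa H)) :
  (forall t, X t -> psd (veval t F)) -> psd (poly_integral X m F).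
Proof.
move=> Fpos x; rewrite poly_integral_seq sa_op_sum bop_sumE inner_suml.
set s := vsupp_seq F.
pose nuP a := novm_measure (pos_part_psd (F a)) x.
pose nuN a := novm_measure (neg_part_psd (F a)) x.
have finP a : (nuP a X < +oo)%E by exact: novm_measure_finite.
have finN a : (nuN a X < +oo)%E by exact: novm_measure_finite.
pose C := \sum_(a <- s) (fine (nuP a X) + fine (nuN a X)).
have C0 : 0 <= C by apply: sumr_ge0 => a _; rewrite addr_ge0// fine_ge0.
apply/ler_addgt0Pr => e e0; pose e' := e / (C + 1).
have C1 : 0 < C + 1 by rewrite ltr_wpDl.
have e'0 : 0 < e' by rewrite divr_gt0.
have bm a (_ : a \in s) := monomial_bounded_measurable a.
have [Jt [phi [mphi osc]]] := finite_oscillation_partition mX e'0 bm.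
(* A point of the cell [j]; the default only occurs for empty cells, where
   [m (D j) = 0]. *)
pose pt j := xget (0 : 'rV[R]_d) [set t : 'rV[R]_d | X t /\ phi t = j].
have ptP t : X t -> X (pt (phi t)) /\ phi (pt (phi t)) = phi t.
  by move=> Xt; apply: (@xgetPex _ 0 [set u | X u /\ phi u = phi t]); exists t.
pose D j := X `&` phi @^-1` [set j].
have DX j : D j `&` X = D j by apply/setIidPl => t [].
pose S (nu : {measure set T -> \bar R}) a :=
  \sum_(j : Jt) monomial a (pt j) * fine (nu (D j)).
have bnd (nu : {measure set T -> \bar R}) a : a \in s -> (nu X < +oo)%E ->
    `|\int[nu]_(t in X) monomial a t - S nu a| <= e' * fine (nu X).
  move=> sa nuX; apply: riemann_sum_bound => //; first exact: bm.
  exact: osc.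
have low a : a \in s -> S (nuP a) a - S (nuN a) a
    <= '< ovm_integral X m (monomial a) (F a) x, x >
       + e' * (fine (nuP a X) + fine (nuN a X)).
  move=> sa; rewrite ovm_integralE; last exact: bm.
  have := bnd _ a sa (finP a); have := bnd _ a sa (finN a).
  by rewrite !ler_norml => /andP[_ h1] /andP[h2 _]; rewrite /nuP /nuN in h1 h2 *; lra.
have sum_ge0 : 0 <= \sum_(a <- s) (S (nuP a) a - S (nuN a) a).
  rewrite (_ : \sum_(a <- s) _ = \sum_(j : Jt) '< m (D j) (veval (pt j) F) x, x >).
    apply: sumr_ge0 => j _; have [[t [Xt tj]]|noj] := pselect (exists t, X t /\ phi t = j).
      have [Xp _] := ptP t Xt; rewrite tj in Xp.
      have [h _ _] := nm (Fpos _ Xp); apply: h.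
      by exists (D j) => //; exact: mphi.
    have -> : D j = set0 `&` X.
      by rewrite set0I; apply/seteqP; split=> // t [Xt tj]; apply: noj; exists t.
    rewrite -(parts_sub (veval (pt j) F)) linearB saBE innerBl.
    rewrite (povm_set0 (nm (pos_part_psd (veval (pt j) F))) x).
    by rewrite (povm_set0 (nm (neg_part_psd (veval (pt j) F))) x) subrr.
  rewrite (eq_bigr (fun a => \sum_(j : Jt) monomial a (pt j) * '< m (D j) (F a) x, x >)).
    rewrite exchange_big; apply: eq_bigr => j _.
    rewrite (@veval_seq _ _ _ (pt j) F s); [|exact: vsupp_seq_uniq|exact: vsupp_seqP].
    rewrite bop_sumr sa_op_sum bop_sumE inner_suml; apply: eq_bigr => a _.
    rewrite [in RHS](_ : m (D j) _ = monomial a (pt j) *: m (D j) (F a)).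
      by rewrite saZE innerZl.
    exact: linearZ.
  move=> a _; rewrite -sumrB; apply: eq_bigr => j _; rewrite -mulrBr; congr (_ * _).
  rewrite /nuP /nuN !novm_measureE; [|exact: mphi|exact: mphi].
  by rewrite -/(D j) DX /= -innerBl -saBE -linearB parts_sub.
have tot : e' * C <= e.
  by rewrite /e' mulrAC ler_pdivrMr// ler_pM2l// lerDl.
apply: le_trans sum_ge0 _.
apply: (@le_trans _ _ (\sum_(a <- s) ('< ovm_integral X m (monomial a) (F a) x, x >
    + e' * (fine (nuP a X) + fine (nuN a X))))).
  by rewrite big_seq [leRHS]big_seq; apply: ler_sum => a; exact: low.
by rewrite big_split /= -mulr_sumr lerD2l.
Qed.

End Novm.
End Representation.

(** * Construction and uniqueness of the representing operator-valued measure *)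

Section MomentOuterAdditive.
Context {R : realType} {d : nat}.
Local Notation T := (borel_space R d).
Variable X : set T.
Hypothesis cX : compact (X : set 'rV[R]_d).

Let mX : measurable X. Proof. exact: compact_measurable_borel. Qed.

Definition positive_on (l : mpoly d R -> R) :=
  scalar l /\ forall p, (forall a, X a -> 0 <= peval p a) -> 0 <= l p.

(** By uniqueness of the representing measure. *)
Lemma moment_outerD l1 l2 (D : set T) : positive_on l1 -> positive_on l2 ->
  measurable D ->
  moment_outer X (fun p => l1 p + l2 p) D = moment_outer X l1 D + moment_outer X l2 D.
Proof.
move=> [s1 p1] [s2 p2] mD.
have s12 : scalar (fun p => l1 p + l2 p).
  by move=> a u v; rewrite s1 s2; ring.
have p12 p : (forall a, X a -> 0 <= peval p a) -> 0 <= l1 p + l2 p.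
  by move=> pX; rewrite addr_ge0 ?p1 ?p2.
have bp p := uapprox_bounded_measurable cX (uapprox_peval X p).
have f1 : (moment_measure cX s1 p1 X < +oo)%E by rewrite /= ltry.
have f2 : (moment_measure cX s2 p2 X < +oo)%E by rewrite /= ltry.
have := @moment_measure_unique _ _ _ cX _ s12 p12
  (measure_add (moment_measure cX s1 p1) (moment_measure cX s2 p2)).
move=> /(_ _ D mD) => uq; apply: EFin_inj; rewrite -uq => [|p].
  by rewrite [LHS]measure_addE !moment_measure_sub.
rewrite (integral_measure_add mX); [|exact: bounded_integrable..].
by rewrite !moment_measure_integral.
Qed.

Lemma moment_outer_le_total l (D : set T) : positive_on l ->
  0 <= moment_outer X l D <= l 1.
Proof.
move=> [sl pl]; rewrite moment_outer_ge0//=.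
exact: (moment_outer_le sl pl (covers_total sl pl D)).
Qed.

End MomentOuterAdditive.

Section Construction.
Context {R : realType} {d : nat} {H K : hilbertType R}.
Local Notation T := (borel_space R d).
Variable X : set T.
Hypothesis cX : compact (X : set 'rV[R]_d).
Variable L : {linear vpoly d (sa H) -> sa K}.
Implicit Types (A B P N : sa H) (x y : K) (p q : mpoly d R) (D : set T).

Let mX : measurable X. Proof. exact: compact_measurable_borel. Qed.

Definition moment_form A x p : R := '< L (tensor p A) x, x >.

Hypothesis Lpos : forall A p, psd A -> (forall a, X a -> 0 <= peval p a) ->
  psd (L (tensor p A)).

Local Notation mo A x D := (moment_outer X (moment_form A x) D).

Lemma moment_form_positive A x : psd A -> positive_on X (moment_form A x).
Proof.
move=> pA; split=> [c p q|p pX]; last exact: Lpos.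
by rewrite /moment_form tensorDl linearP saDE saZE innerDl innerZl.
Qed.

Lemma moment_formD A B x :
  moment_form (A + B) x = (fun p => moment_form A x p + moment_form B x p).
Proof.
apply/funext => p; rewrite /moment_form.
have -> : tensor p (A + B) = tensor p A + tensor p B.
  by have := tensorDr 1 p A B; rewrite !scale1r.
by rewrite linearD saDE innerDl.
Qed.

Section Cell.
Variable D : set T.
Hypothesis mD : measurable D.

Lemma moD A B x : psd A -> psd B -> mo (A + B) x D = mo A x D + mo B x D.
Proof.
move=> pA pB; rewrite moment_formD.
by apply: (moment_outerD cX) => //; exact: moment_form_positive.
Qed.

(** The measure depends additively on the functional, and the functional
    satisfies the parallelogram law in the vector. *)
Lemma mo_form A : psd A -> exists S : sa K, forall x, '< S x, x > = mo A x D.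
Proof.
move=> pA; have pos x := moment_form_positive x pA.
have rng x := moment_outer_le_total D (pos x).
apply: (@quadratic_form_operator _ _ _ (opnorm (L (tensor 1 A)))).
  move=> x y.
  have pos2 u : positive_on X (fun p => moment_form A u p + moment_form A u p).
    by rewrite -moment_formD; apply: moment_form_positive; exact: psdD.
  have dbl u := moment_outerD cX (pos u) (pos u) mD.
  have sum4 := moment_outerD cX (pos2 x) (pos2 y) mD.
  rewrite !dbl in sum4.
  rewrite -(moment_outerD cX (pos (x + y)) (pos (x - y)) mD).
  rewrite !mulr_natl !mulr2n -sum4; congr moment_outer.
  by apply/funext => p; rewrite /moment_form opD opB !innerE; ring.
move=> x; have /andP[m0 m1] := rng x; rewrite ger0_norm//.
apply: le_trans m1 _; apply: le_trans (ler_norm _) _.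
exact: quadratic_form_bound.
Qed.

(** Additivity on positive operators makes the extension through positive and
    negative parts additive; it is homogeneous because the total mass bounds it
    on the multiples in [0, 1], and bounded because [-|A| <= A <= |A|] implies
    the same inequalities for the images. *)
Lemma mo_operator : exists S : bop (sa H) (sa K),
  forall A x, psd A -> '< S A x, x > = mo A x D.
Proof.
have /choice[S SP] A : exists S : sa K, psd A -> forall x, '< S x, x > = mo A x D.
  have [pA|nA] := pselect (psd A); last by exists 0.
  by have [S SP] := mo_form pA; exists S.
pose Tf A := S (pos_part A) - S (neg_part A).
have TE A P N x : psd P -> psd N -> A = P - N ->
    '< Tf A x, x > = mo P x D - mo N x D.
  move=> pP pN AE; rewrite saBE innerBl !SP; [|exact: neg_part_psd|exact: pos_part_psd].
  have e : pos_part A + N = neg_part A + P.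
    rewrite -(subrK (neg_part A) (pos_part A)) parts_sub AE addrAC subrK.
    by rewrite addrC.
  have := moD x (pos_part_psd A) pN; have := moD x (neg_part_psd A) pP.
  by rewrite e => -> ; lra.
have z0 : psd (0 : sa H) by move=> x; rewrite inner0l.
have mo0 x : mo 0 x D = 0.
  by have := moD x z0 z0; rewrite addr0; lra.
have Tpos A x : psd A -> '< Tf A x, x > = mo A x D.
  by move=> pA; rewrite (TE A A 0)// ?subr0// mo0 subr0.
have Tadd A B : Tf (A + B) = Tf A + Tf B.
  apply: sa_ext => x.
  rewrite (TE (A + B) (pos_part A + pos_part B) (neg_part A + neg_part B)).
  - rewrite saDE innerDl (TE A _ _ x (pos_part_psd A) (neg_part_psd A))//.
      rewrite (TE B _ _ x (pos_part_psd B) (neg_part_psd B)) ?parts_sub//.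
      rewrite (moD x (pos_part_psd A) (pos_part_psd B)).
      by rewrite (moD x (neg_part_psd A) (neg_part_psd B)) opprD addrACA.
    by rewrite parts_sub.
  - by apply: psdD; exact: pos_part_psd.
  - by apply: psdD; exact: neg_part_psd.
  - by rewrite opprD addrACA !parts_sub.
have mo_le A x : psd A -> 0 <= mo A x D <= moment_form A x 1.
  by move=> pA; exact/moment_outer_le_total/moment_form_positive.
have formZ A x (c : R) : moment_form (c *: A) x 1 = c * moment_form A x 1.
  rewrite /moment_form (_ : tensor 1 (c *: A) = c *: tensor 1 A).
    by rewrite linearZ saZE innerZl.
  by apply: vpoly_ext => b; rewrite tensorE [RHS](_ : _ = c *: tensor 1 A b)//
    tensorE !scalerA mulrC.
have Thom c A : Tf (c *: A) = c *: Tf A.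
  apply: sa_ext => x; rewrite saZE innerZl.
  apply: (@additive_bounded_homogeneous _ _ (fun A => '< Tf A x, x >)
    (fun A => moment_form (pos_part A) x 1 + moment_form (neg_part A) x 1)).
    by move=> A' B'; rewrite Tadd saDE innerDl.
  move=> {}A {}c /andP[c0 c1].
  have pp := psdZ c0 (pos_part_psd A); have pn := psdZ c0 (neg_part_psd A).
  rewrite (TE _ _ _ x pp pn); last by rewrite -scalerBr parts_sub.
  have := mo_le _ x pp; have := mo_le _ x pn; rewrite !formZ.
  have := mo_le _ x (pos_part_psd A); have := mo_le _ x (neg_part_psd A).
  move=> /andP[a1 a2] /andP[b1 b2] /andP[h1 h2] /andP[h3 h4].
  have f1 := ler_piMl (le_trans a1 a2) c1; have f2 := ler_piMl (le_trans b1 b2) c1.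
  by rewrite ler_norml; apply/andP; split; lra.
have Tbound A x : `|'< Tf A x, x >| <= opnorm A * '< Tf sa1 x, x >.
  have n0 := opnorm_ge0 A.
  have pm (s : R) : `|s| = 1 -> psd (opnorm A *: sa1 + s *: A).
    move=> s1 y; rewrite !opE !innerE inner_norm.
    have := quadratic_form_bound A y.
    have := ler_norm (- (s * '< A y, y >)); rewrite normrN normrM s1 mul1r; lra.
  have bnd (s : R) : `|s| = 1 -> - (s * '< Tf A x, x >) <= opnorm A * '< Tf sa1 x, x >.
    move=> s1; have := Tpos _ x (pm s s1); rewrite Tadd !Thom !opE !innerE.
    have /andP[+ _] := mo_le _ x (pm s s1); lra.
  have := bnd 1 (normr1 _); have := bnd (-1) (normrN1 _).
  by rewrite ler_norml => h1 h2; apply/andP; split; lra.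
have Tb : Tf \in @bounded_linear R (sa H) (sa K).
  apply/asboolP; split; first by move=> c A B; rewrite Tadd Thom.
  exists (opnorm (Tf sa1)) => A; apply: opnorm_quadratic_form.
    by rewrite mulr_ge0// opnorm_ge0.
  move=> x; apply: le_trans (Tbound A x) _.
  have -> : opnorm (Tf sa1) * `|A| * `|x| ^+ 2 = opnorm A * (opnorm (Tf sa1) * `|x| ^+ 2).
    by rewrite [`|A|](_ : _ = opnorm A)//; ring.
  rewrite ler_wpM2l ?opnorm_ge0//; apply: le_trans (ler_norm _) _.
  exact: quadratic_form_bound.
by exists (Bop Tb) => A x; exact: Tpos.
Qed.

End Cell.

Definition form_measure A x (pA : psd A) : {measure set T -> \bar R} :=
  moment_measure cX (moment_form_positive x pA).1 (moment_form_positive x pA).2.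

Lemma form_measureE A x (pA : psd A) D : form_measure x pA D = (mo A x D)%:E.
Proof. by []. Qed.

Lemma trace_measurable D : trace_sigma X D -> measurable D.
Proof. by move=> [B mB <-]; exact: measurableI. Qed.

Section Measure.
Variable m : set T -> bop (sa H) (sa K).
Hypothesis mP : forall D, measurable D -> forall A x, psd A ->
  '< m D A x, x > = mo A x D.

Lemma moment_novm : novm (trace_sigma X) m.
Proof.
move=> A pA; split.
- move=> D /trace_measurable mD x; rewrite mP//.
  by have /andP[] := moment_outer_le_total D (moment_form_positive x pA).
- move=> D1 D2 /trace_measurable m1 /trace_measurable m2 D12.
  apply: sa_ext => x; rewrite saDE innerDl !mP//; last exact: measurableU.
  by apply: EFin_inj; rewrite EFinD -!(form_measureE x pA) measureU.
- move=> D tD Dinc tU; have mD i := trace_measurable (tD i).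
  have mU := trace_measurable tU.
  have ndD : nondecreasing_seq D.
    by apply/nondecreasing_seqP => n; apply/subsetPset.
  split=> [i x|B Bub x]; rewrite saBE innerBl subr_ge0 /=.
    rewrite !mP// -lee_fin -!(form_measureE x pA) le_measure ?inE//.
    exact: bigcup_sup.
  have cv : (form_measure x pA \o D) @ \oo --> form_measure x pA (\bigcup_i D i).
    exact: nondecreasing_cvg_mu.
  rewrite mP// -lee_fin -(form_measureE x pA) -(cvg_lim _ cv)//.
  apply: lime_le; first by apply/cvg_ex; eexists; exact: cv.
  apply: nearW => i /=; rewrite form_measureE lee_fin -mP//.
  by have := Bub i x; rewrite saBE innerBl subr_ge0.
Qed.

Lemma form_measure_integral A x (pA : psd A) p :
  \int[form_measure x pA]_(t in X) peval p t = moment_form A x p.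
Proof. by rewrite /Rintegral moment_measure_integral. Qed.

Lemma novm_measure_integral A x (pA : psd A) p :
  \int[novm_measure moment_novm pA x]_(t in X) peval p t = moment_form A x p.
Proof.
rewrite -(form_measure_integral x pA); congr fine.
apply: eq_measurable_integral => D mD.
rewrite novm_measureE// mP//; last exact: measurableI.
by rewrite moment_outerI.
Qed.

Lemma moment_represents : represents X m L.
Proof.
split; first exact: moment_novm.
move=> F; split.
  move=> a _ A pA; apply: povm_op_integrable => //; first exact: moment_novm.
  exact: monomial_bounded_measurable.
rewrite poly_integral_seq {1}(vpoly_sumE F) linear_sum.
apply: eq_bigr => a _; apply: sa_ext => x.
rewrite (ovm_integralE cX moment_novm); last exact: monomial_bounded_measurable.
rewrite !novm_measure_integral -tensorX -/(moment_form (F a) x _).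
have e : F a + neg_part (F a) = pos_part (F a).
  by rewrite -{1}(parts_sub (F a)) subrK.
by rewrite -e moment_formD addrK.
Qed.

End Measure.

(** The scalar measures of a representing measure have the moments of the
    functional, which determine them. *)
Lemma represents_unique m' (m1 : novm (trace_sigma X) m') :
  (forall F, L F = poly_integral X m' F) ->
  forall D, measurable D -> D `<=` X -> forall A x, psd A ->
  '< m' D A x, x > = mo A x D.
Proof.
move=> rep D mD DX A x pA.
have [sl pl] := moment_form_positive x pA.
have bm a := monomial_bounded_measurable cX a.
have fin := novm_measure_finite cX m1 pA x.
have moment a : \int[novm_measure m1 pA x]_(t in X) monomial a t =
    '< L (vmono a A) x, x >.
  rewrite -(ovm_integral_psd cX m1 pA x (bm a)) rep /poly_integral.
  rewrite (sum_vsupp_mono (phi := fun a A => ovm_integral X m' (monomial a) A))//.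
  by move=> b; exact: ovm_integral0.
have := @moment_measure_unique _ _ _ cX _ sl pl (novm_measure m1 pA x).
have DE : D `&` X = D by apply/setIidPl.
move=> /(_ _ D mD) uq; apply: EFin_inj; rewrite -uq.
  by rewrite DE novm_measureE// DE.
move=> p; rewrite bounded_integralE//; last first.
  exact/uapprox_bounded_measurable/uapprox_peval.
congr EFin.
pose Jp q := \int[novm_measure m1 pA x]_(t in X) peval q t.
have JpD u v : Jp (u + v) = Jp u + Jp v.
  rewrite /Jp -RintegralD//; first by apply: eq_Rintegral => t _; rewrite pevalD.
    by apply: bounded_integrable => //; exact/uapprox_bounded_measurable/uapprox_peval.
  by apply: bounded_integrable => //; exact/uapprox_bounded_measurable/uapprox_peval.
have Jp0 : Jp 0 = 0 by have := JpD 0 0; rewrite addr0; lra.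
have JpZ c q : Jp (c *: q) = c * Jp q.
  rewrite /Jp -RintegralZl//; first by apply: eq_Rintegral => t _; rewrite pevalZ.
  by apply: bounded_integrable => //; exact/uapprox_bounded_measurable/uapprox_peval.
rewrite -[LHS]/(Jp p) {1}(mpolyE p) (big_morph _ JpD Jp0).
have f0 : moment_form A x 0 = 0.
  by have := sl 1 0 0; rewrite scale1r addr0 mul1r; lra.
have fD u v : moment_form A x (u + v) = moment_form A x u + moment_form A x v.
  by have := sl 1 u v; rewrite scale1r mul1r.
have fZ c u : moment_form A x (c *: u) = c * moment_form A x u.
  by have := sl c u 0; rewrite !addr0 f0 addr0.
rewrite [in RHS](mpolyE p) (big_morph _ fD f0); apply: eq_bigr => a _.
by rewrite JpZ fZ /moment_form tensorX -moment.
Qed.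

End Construction.

Theorem theorem5 (R : realType) (d : nat) (H K : hilbertType R)
    (L : {linear vpoly d (sa H) -> sa K})
    (M : set (mpoly d R))
    (quadM : quadratic_module M) (archM : archimedean M) :
  (exists m : set (borel_space R d) -> bop (sa H) (sa K),
      represents (nonneg_set M) m L /\
      forall m' : set (borel_space R d) -> bop (sa H) (sa K),
        represents (nonneg_set M) m' L ->
        forall D, trace_sigma (nonneg_set M) D -> m' D = m D)
  <->
  (forall (q : mpoly d R) (A : vpoly d (bop H H)) (F : vpoly d (sa H)),
      M q -> of_sa F = pscale q (opmul (optr A) A) -> psd (L F)).
Proof.
have cX := nonneg_set_compact archM; split.
  move=> [m [[nm rep] _]] q A F Mq FE.
  have [_ ->] := rep F; apply: (poly_integral_psd cX nm) => t Xt.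
  by apply: (veval_weighted_gram_psd FE); exact: Xt.
move=> Lpos.
have LM A q : psd A -> M q -> psd (L (tensor q A)).
  move=> pA Mq; have [S [_ <- _]] := psd_sqrt pA.
  exact: (Lpos q _ _ Mq (tensor_sqr_gram q S)).
have LX A p : psd A -> (forall a, nonneg_set M a -> 0 <= peval p a) ->
    psd (L (tensor p A)).
  move=> pA pX x.
  apply: (@positive_functional_ge0 _ _ M (moment_form L A x) p quadM archM) => //.
    by move=> c u v; rewrite /moment_form tensorDl linearP saDE saZE innerDl innerZl.
  by move=> q Mq; exact: LM.
have /choice[m mP] D : exists S : bop (sa H) (sa K), measurable D ->
    forall A x, psd A ->
    '< S A x, x > = moment_outer (nonneg_set M) (moment_form L A x) D.
  have [mD|nD] := pselect (measurable D); last by exists 0.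
  by have [S SP] := mo_operator cX LX mD; exists S.
exists m; split; first exact: (moment_represents cX LX mP).
move=> m' [nm' rep'] D tD.
have mD := trace_measurable cX tD.
have DX : D `<=` nonneg_set M by case: tD => B _ <- t [].
have eq A : psd A -> m' D A = m D A.
  move=> pA; apply: sa_ext => x; rewrite (mP D mD)//.
  by apply: (represents_unique cX LX nm' _ mD DX) => // F; have [_] := rep' F.
apply: bopP => A; rewrite -(parts_sub A) linearB [RHS]linearB.
by rewrite /= !eq//; [exact: neg_part_psd|exact: pos_part_psd].
Qed.
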